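(* Let $k\ge2$. There is a polynomial-time algorithm that, given a connected $k$-uniform hypergraph $G=(V,E)$, outputs a spanning transition walk of hyperedges of length at most $2(1+\ln k)\,h_k(G)$.
   Context: A $k$-uniform hypergraph $G=(V,E)$ has a finite vertex set $V$ and a set $E$ of hyperedges, each a $k$-element subset of $V$ (no repeated hyperedges). It is connected if its line graph (vertices: hyperedges; two adjacent iff they intersect) is connected, and we assume every vertex lies in some hyperedge. Two hyperedges $e,e'$ are adjacent if either (shift) $e\cap e'\neq\emptyset$, or (jump) there is a bijection $\sigma:e\to e'$ such that for every $x\in e$ the set $\{x,\sigma(x)\}$ is contained in some hyperedge of $G$. A transition walk of length $l$ is a sequence of hyperedges $e_0,\dots,e_l$ with $e_{t}$ and $e_{t+1}$ adjacent for all $t$; it is spanning if $\bigcup_t e_t=V$. $h_k(G)$ denotes the minimum length of a spanning transition walk ($k$-HWP on hypergraphs). *)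

(* Defs.v *)
From Stdlib Require Import Reals.
From mathcomp Require Import all_boot.
Set Implicit Arguments. Unset Strict Implicit. Unset Printing Implicit Defensive.

Section Hyper.
Variable n : nat.
Implicit Types (E : {set {set 'I_n}}) (e : {set 'I_n}) (w : seq {set 'I_n}).

Definition uniform (k : nat) E : Prop := forall e, e \in E -> #|e| = k.

Definition covers E : Prop := forall x : 'I_n, exists2 e, e \in E & x \in e.

Definition meets (e e' : {set 'I_n}) : bool := [exists x, (x \in e) && (x \in e')].

(* the line graph is connected (and nonempty is required separately) *)
Definition hconnected E : Prop :=
  forall e e', e \in E -> e' \in E ->
    exists s : seq {set 'I_n},
      [/\ all (fun f => f \in E) s, path meets e s & last e s = e'].

Definition adjacent E e e' : Prop :=
  meets e e' \/
  exists f : 'I_n -> 'I_n,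
    [/\ {in e &, injective f}, f @: e = e' &
        forall x, x \in e -> exists2 g, g \in E & (x \in g) && (f x \in g)].

Definition transition_walk E w : Prop :=
  [/\ w != [::], (forall e, e \in w -> e \in E) &
      forall i, i.+1 < size w -> adjacent E (nth set0 w i) (nth set0 w i.+1)].

Definition spanning w : Prop := forall x : 'I_n, exists2 e, e \in w & x \in e.

(* length l of the walk e_0, ..., e_l *)
Definition walk_length w : nat := (size w).-1.

Definition is_hk E (h : nat) : Prop :=
  (exists w, [/\ transition_walk E w, spanning w & walk_length w = h]) /\
  (forall w, transition_walk E w -> spanning w -> h <= walk_length w).

End Hyper.

(* ---------------- Encodings as strings over {0,...,4} ----------------
   symbols: 0 = blank, 1 = bit 0, 2 = bit 1, 3 = vertex separator,
   4 = edge separator. *)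

Definition bin (m : nat) : seq nat :=
  [seq (odd (m %/ 2 ^ i) : nat).+1 | i <- iota 0 (trunc_log 2 m).+1].

Definition enc_set n (e : {set 'I_n}) : seq nat :=
  flatten [seq bin (val i) ++ [:: 3] | i <- enum e].

Definition enc_edges n (s : seq {set 'I_n}) : seq nat :=
  flatten [seq enc_set e ++ [:: 4] | e <- s].

Definition enc_graph n (E : {set {set 'I_n}}) : seq nat :=
  bin n ++ [:: 4] ++ enc_edges (enum E).

Record TM := mkTM {
  tm_Q : nat;
  tm_S : nat;                       (* alphabet: ordinals below tm_S+5; 0 = blank *)
  tm_start : 'I_(tm_Q);
  tm_halt : 'I_(tm_Q);
  tm_delta : 'I_(tm_Q) -> 'I_(tm_S.+4.+1) -> 'I_(tm_Q) * 'I_(tm_S.+4.+1) * bool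
                                      (* true = move right, false = move left *)
}.

Record config (M : TM) := Config {
  c_state : 'I_(tm_Q M);
  c_left : seq 'I_((tm_S M).+4.+1);    (* cells left of the head, nearest first *)
  c_head : 'I_((tm_S M).+4.+1);
  c_right : seq 'I_((tm_S M).+4.+1)    (* cells right of the head, nearest first *)
}.

Definition blank (M : TM) : 'I_((tm_S M).+4.+1) := ord0.

Definition tm_step (M : TM) (c : config M) : config M :=
  if c_state c == tm_halt M then c else
  let: (q', a', dir) := tm_delta (c_state c) (c_head c) in
  if dir then
    Config q' (a' :: c_left c) (head (blank M) (c_right c)) (behead (c_right c))
  else
    Config q' (behead (c_left c)) (head (blank M) (c_left c)) (a' :: c_right c).

Definition tm_init (M : TM) (inp : seq nat) : config M :=
  let s := [seq (inord x : 'I_((tm_S M).+4.+1)) | x <- inp] in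
  Config (tm_start M) [::] (head (blank M) s) (behead s).

Definition tm_output (M : TM) (c : config M) : seq nat :=
  let s := c_head c :: c_right c in
  map val (take (find (fun a => a == blank M) s) s).

Definition halts_with (M : TM) (inp : seq nat) (t : nat) (out : seq nat) : Prop :=
  let c := iter t (@tm_step M) (tm_init M inp) in
  c_state c = tm_halt M /\ tm_output c = out.

(* Main.v *)
Require Import Defs.
From Stdlib Require Import Reals Lra ClassicalEpsilon.
From mathcomp Require Import all_boot zify.
Set Implicit Arguments. Unset Strict Implicit. Unset Printing Implicit Defensive.
Delimit Scope R_scope with R.

(** A set [T] of hyperedges, initially one hyperedge [s], is grown greedily until it covers all
    vertices.  A move adds a path of at most four successively adjacent hyperedges; it
    costs its length, plus one if none of its hyperedges meets the vertices covered so far, and the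
    move of largest gain-to-cost ratio is taken.  The surcharge pays for joining the components of
    [T] by extra hyperedges, so the final connected [T] has at most one element more than the total
    cost.  When [s] is the first hyperedge of an optimal walk of length [h], a potential function
    summed over the sites of that walk (harmonic numbers on sites already touched, [1 + ln k] up to
    corrections of size [1 / (2 (k + 1))] on untouched ones, and a charge on certain consecutive
    sites) decreases by at least the cost of every move, so the total cost is at most
    [(1 + ln k) h + 1 / (k + 1)].  Every [s] is tried and the smallest [T] kept.  A depth-first tour
    of a breadth-first tree of [T], stopped at the last new hyperedge, has length at most
    [2 |T| - 3], which leaves room for the additive term.

    The algorithm is written in a small language of searches over the positions of the input word,
    whose programs compile to polynomial-time one-tape machines. *)

(** * Sweeping machines *)

(** The obstacle is the surcharge. An untouched site offers its [k] vertices only at cost 2, so if a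
    move leaves [m] of them uncovered, the potential of that site has to pay [2 (k - m) / k + H_m],
    which may exceed [1 + ln k], though by at most [2 x] with [x = 1 / (2 (k + 1))]. Neighbours on
    the walk help, because consecutive sites together form a competing move: a touched neighbour
    with a vertex left, or two untouched neighbours, lower the price per vertex to [2 / (k + 1)],
    and this fits under [1 + ln k]; a single untouched neighbour leaves a deficit of [x]. A
    neighbour with no vertex left gives no help, so it deposits [x] on its link to the untouched
    site when it runs out. Vertices shared by consecutive sites would weaken the competing moves;
    therefore a link counts only if its right end is disjoint from all earlier sites, and the sites
    at the two ends of a run of links carry [x] less or [x] more. These corrections cancel along the
    walk up to [2 x]. *)

Section Fragments.
Variables (G : finType) (bl : G).

(** A transition table with two exits: a target [inr b] leaves the fragment with answer [b], and
    this is what lets fragments be combined into conditionals and loops. *)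
Record frag := Frag {
  fQ : finType;
  f0 : fQ;
  fd : fQ -> G -> (fQ + bool) * G * bool }.

Definition tape := (seq G * G * seq G)%type.

Definition move (t : tape) (a : G) (dir : bool) : tape :=
  let: (l, h, r) := t in
  if dir then (a :: l, head bl r, behead r) else (behead l, head bl l, a :: r).

Definition mk (l r : seq G) : tape := (l, head bl r, behead r).

Inductive fsteps (Q : Type) (d : Q -> G -> (Q + bool) * G * bool) :
    nat -> (Q + bool) * tape -> (Q + bool) * tape -> Prop :=
| fsteps0 c : fsteps d 0 c c
| fstepsS n q t c :
    fsteps d n ((d q t.1.2).1.1, move t (d q t.1.2).1.2 (d q t.1.2).2) c ->
    fsteps d n.+1 (inl q, t) c.

Lemma fsteps_trans Q (d : Q -> G -> (Q + bool) * G * bool) m n a b c :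
  fsteps d m a b -> fsteps d n b c -> fsteps d (m + n) a c.
Proof.
elim=> [//|{a b}m' q t b' _ IH] H; rewrite addSn; apply: fstepsS; exact: IH.
Qed.

(** Composition only renames states: [phi] places the states of a component inside the compound and
    [psi] says where its two exits lead. *)
Lemma fsteps_embed Q Q' (d : Q -> G -> (Q + bool) * G * bool)
    (d' : Q' -> G -> (Q' + bool) * G * bool) (phi : Q -> Q') (psi : bool -> Q' + bool) :
  (forall q g, d' (phi q) g =
     (match (d q g).1.1 with inl q' => inl (phi q') | inr b => psi b end,
      (d q g).1.2, (d q g).2)) ->
  forall n q t b t', fsteps d n (inl q, t) (inr b, t') ->
  fsteps d' n (inl (phi q), t) (psi b, t').
Proof.
move=> H n q t b t' E.
have F c c' : fsteps d n c c' ->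
  fsteps d' n (match c.1 with inl q' => inl (phi q') | inr b => psi b end, c.2)
              (match c'.1 with inl q' => inl (phi q') | inr b => psi b end, c'.2).
  elim=> [c0|m q0 t0 c0 _ IH]; first exact: fsteps0.
  by apply: fstepsS; rewrite H.
exact: (F _ _ E).
Qed.

(** The unit of computation is a sweep: a Mealy machine crosses the nonblank word from left to
    right, may append one symbol at its end, and the head returns to the first cell. [WLoop P Q]
    alternates [P] and [Q] until [P] answers true or [Q] answers false. *)
Inductive wp : Type :=
| Sw (Q : finType) (q0 : Q) (st : Q -> G -> Q * G) (fin : Q -> bool * option G)
| WIf of wp & wp & wp
| WLoop of wp & wp.

Definition fSw (Q : finType) (q0 : Q) (st : Q -> G -> Q * G) (fin : Q -> bool * option G) : frag :=
  @Frag (Q + bool)%type (inl q0) (fun x g =>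
    match x with
    | inl q => if g == bl then (inl (inr (fin q).1), odflt bl (fin q).2, false)
               else (inl (inl (st q g).1), (st q g).2, true)
    | inr b => if g == bl then (inr b, bl, true) else (inl (inr b), g, false)
    end).

Definition fIf (A B D : frag) : frag :=
  @Frag (fQ A + (fQ B + fQ D))%type (inl (f0 A)) (fun x g =>
    match x with
    | inl q => (match (fd q g).1.1 with
                | inl q' => inl (inl q')
                | inr b => inl (inr (if b then inl (f0 B) else inr (f0 D)))
                end, (fd q g).1.2, (fd q g).2)
    | inr (inl q) => (match (fd q g).1.1 with
                | inl q' => inl (inr (inl q')) | inr b => inr b end,
                (fd q g).1.2, (fd q g).2)
    | inr (inr q) => (match (fd q g).1.1 with
                | inl q' => inl (inr (inr q')) | inr b => inr b end,
                (fd q g).1.2, (fd q g).2)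
    end).

Definition fLoop (A B : frag) : frag :=
  @Frag (fQ A + fQ B)%type (inl (f0 A)) (fun x g =>
    match x with
    | inl q => (match (fd q g).1.1 with
                | inl q' => inl (inl q')
                | inr b => if b then inr true else inl (inr (f0 B))
                end, (fd q g).1.2, (fd q g).2)
    | inr q => (match (fd q g).1.1 with
                | inl q' => inl (inr q')
                | inr b => if b then inl (inl (f0 A)) else inr false
                end, (fd q g).1.2, (fd q g).2)
    end).

Fixpoint fcmp (P : wp) : frag :=
  match P with
  | Sw Q q0 st fin => fSw q0 st fin
  | WIf P1 P2 P3 => fIf (fcmp P1) (fcmp P2) (fcmp P3)
  | WLoop P1 P2 => fLoop (fcmp P1) (fcmp P2)
  end.

Fixpoint mealy (Q : Type) (st : Q -> G -> Q * G) (q : Q) (u : seq G) : Q * seq G :=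
  if u is g :: u' then
    ((mealy st (st q g).1 u').1, (st q g).2 :: (mealy st (st q g).1 u').2)
  else (q, [::]).

Definition nb (u : seq G) := all (predC1 bl) u.

Lemma size_mealy Q (st : Q -> G -> Q * G) u q : size (mealy st q u).2 = size u.
Proof. by elim: u q => //= g u IH q; rewrite IH. Qed.

(* The last argument counts sweeps. *)
Inductive wrun : wp -> seq G -> bool -> seq G -> nat -> Prop :=
| wrun_Sw Q q0 st fin u v :
    v = (mealy st q0 u).2 ++ seq_of_opt (fin (mealy st q0 u).1).2 -> nb v ->
    wrun (@Sw Q q0 st fin) u (fin (mealy st q0 u).1).1 v 1
| wrun_If P1 P2 P3 u b v m b' w n :
    wrun P1 u b v m -> wrun (if b then P2 else P3) v b' w n ->
    wrun (WIf P1 P2 P3) u b' w (m + n)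
| wrun_LoopT P1 P2 u v n : wrun P1 u true v n -> wrun (WLoop P1 P2) u true v n
| wrun_LoopF P1 P2 u v n w m :
    wrun P1 u false v n -> wrun P2 v false w m -> wrun (WLoop P1 P2) u false w (n + m)
| wrun_LoopS P1 P2 u v n w m b x l :
    wrun P1 u false v n -> wrun P2 v true w m -> wrun (WLoop P1 P2) w b x l ->
    wrun (WLoop P1 P2) u b x (n + m + l).

(** Tapes are lists in which blanks are explicit, so a word is represented only up to blanks on both
    sides. *)
Definition rep (u : seq G) (t : tape) := exists m m', t = mk (nseq m bl) (u ++ nseq m' bl).

Lemma sweep_forward (Q : finType) q0 st fin u : nb u -> forall q l R,
  fsteps (fd (f:=@fSw Q q0 st fin)) (size u) (inl (inl q), mk l (u ++ R))
   (inl (inl (mealy st q u).1), mk (rev (mealy st q u).2 ++ l) R).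
Proof.
elim: u => [|g u IH] /= nbu q l R; first exact: fsteps0.
case/andP: nbu => ng nbu.
apply: fstepsS => /=; rewrite (negbTE ng) /= rev_cons cat_rcons.
exact: IH.
Qed.

Lemma sweep_back (Q : finType) q0 st fin b l w R : nb w ->
  fsteps (fd (f:=@fSw Q q0 st fin)) (size w)
   (inl (inr b), mk (behead (rev w ++ l)) (head bl (rev w ++ l) :: R))
   (inl (inr b), mk (behead l) (head bl l :: w ++ R)).
Proof.
elim/last_ind: w R => [|w y IH] R; first by move=> _; exact: fsteps0.
rewrite /nb all_rcons => /andP[ny nbw]; rewrite size_rcons rev_rcons /=.
apply: fstepsS => /=; rewrite (negbTE ny) /= cat_rcons.
exact: IH.
Qed.

(** A sweep lengthens the word by at most one symbol, so each of the [n] sweeps crosses at most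
    [size u + n] cells in both directions, with two turning steps. *)
Lemma wrun_fsteps P u b v n : wrun P u b v n -> nb u -> forall t, rep u t ->
  exists T t', [/\ T <= n * (2 * (size u + n) + 2),
    fsteps (fd (f:=fcmp P)) T (inl (f0 (fcmp P)), t) (inr b, t'), rep v t',
    nb v & size v <= size u + n].
Proof.
elim=> {P u b v n}
 [Q q0 st fin u v Ev nbv|P1 P2 P3 u b v m b' w n _ IH1 _ IH2|P1 P2 u v n _ IH
 |P1 P2 u v n w m _ IH1 _ IH2|P1 P2 u v n w m b x l _ IH1 _ IH2 _ IH3] nbu t rt.
- case: rt => m [m' ->]; set v1 := (mealy st q0 u).2 in Ev.
  have sv1 : size v1 = size u by rewrite size_mealy.
  have nbv1 : nb v1 by move: nbv; rewrite Ev /nb all_cat => /andP[].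
  set q1 := (mealy st q0 u).1.
  (* The sweep turns on the first blank, which receives the appended symbol or stays blank. *)
  set R := odflt bl (fin q1).2 :: behead (nseq m' bl).
  exists (size u + (1 + (size v1 + 1))), (mk (bl :: behead (nseq m bl)) (v1 ++ R)).
  split=> //.
  + by rewrite sv1 mul1n; lia.
  + apply: fsteps_trans; first exact: sweep_forward.
    apply: fsteps_trans; last first.
      apply: fsteps_trans; first exact: (@sweep_back Q q0 st fin (fin q1).1 (nseq m bl) v1 R nbv1).
      apply: fstepsS.
      have -> : head bl (nseq m bl) = bl by case: (m).
      by rewrite /= eqxx /=; exact: fsteps0.
    apply: fstepsS => /=.
    have -> : head bl (nseq m' bl) = bl by case: (m').
    by rewrite eqxx /=; exact: fsteps0.
  + have bn p : behead (nseq p bl) = nseq p.-1 bl by case: p.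
    exists m.-1.+1; rewrite Ev /R !bn.
    case: (fin q1).2 => [a|] /=; rewrite -/v1.
      by exists m'.-1; rewrite -catA.
    by exists m'.-1.+1; rewrite cats0.
  + by rewrite Ev size_cat sv1 leq_add2l; case: (_.2).
- have [T1 [t1 [l1 s1 r1 nb1 z1]]] := IH1 nbu t rt.
  have [T2 [t2 [l2 s2 r2 nb2 z2]]] := IH2 nb1 t1 r1.
  exists (T1 + T2), t2; split=> //; last by lia.
    by nia.
  apply: fsteps_trans.
    apply: (fsteps_embed (phi := inl)
       (psi := fun b => inl (inr (if b then inl (f0 (fcmp P2)) else inr (f0 (fcmp P3)))))) s1.
    by [].
  case: b s2 {IH1 IH2 s1} => s2.
    by apply: (fsteps_embed (phi := fun q => inr (inl q)) (psi := inr)) s2.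
  by apply: (fsteps_embed (phi := fun q => inr (inr q)) (psi := inr)) s2.
- have [T1 [t1 [l1 s1 r1 nb1 z1]]] := IH nbu t rt.
  exists T1, t1; split=> //.
  by apply: (fsteps_embed (phi := inl)
     (psi := fun b => if b then inr true else inl (inr (f0 (fcmp P2))))) s1.
- have [T1 [t1 [l1 s1 r1 nb1 z1]]] := IH1 nbu t rt.
  have [T2 [t2 [l2 s2 r2 nb2 z2]]] := IH2 nb1 t1 r1.
  exists (T1 + T2), t2; split=> //; last by lia.
    by nia.
  apply: fsteps_trans.
    by apply: (fsteps_embed (phi := inl)
     (psi := fun b => if b then inr true else inl (inr (f0 (fcmp P2))))) s1.
  by apply: (fsteps_embed (phi := inr)
     (psi := fun b => if b then inl (inl (f0 (fcmp P1))) else inr false)) s2.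
- have [T1 [t1 [l1 s1 r1 nb1 z1]]] := IH1 nbu t rt.
  have [T2 [t2 [l2 s2 r2 nb2 z2]]] := IH2 nb1 t1 r1.
  have [T3 [t3 [l3 s3 r3 nb3 z3]]] := IH3 nb2 t2 r2.
  exists (T1 + T2 + T3), t3; split=> //; last by lia.
    have : T1 <= n * (2 * (size u + (n + m + l)) + 2) by apply: leq_trans l1 _; rewrite leq_mul2l; lia.
    have : T2 <= m * (2 * (size u + (n + m + l)) + 2) by apply: leq_trans l2 _; rewrite leq_mul2l; lia.
    have : T3 <= l * (2 * (size u + (n + m + l)) + 2) by apply: leq_trans l3 _; rewrite leq_mul2l; lia.
    by rewrite !mulnDl; lia.
  apply: fsteps_trans; last exact: s3.
  apply: fsteps_trans.
    by apply: (fsteps_embed (phi := inl)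
     (psi := fun b => if b then inr true else inl (inr (f0 (fcmp P2))))) s1.
  by apply: (fsteps_embed (phi := inr)
     (psi := fun b => if b then inl (inl (f0 (fcmp P1))) else inr false)) s2.
Qed.

End Fragments.

(** * Fragments as Turing machines *)

Section ToTM.
Variable C : finType.
Definition gam := ('I_5 + C)%type.
Definition gbl : gam := inl ord0.

(** The five raw symbols come first, so they keep their numerical values: input and output need no
    recoding, and the blank is 0. *)
Definition genc (g : gam) : 'I_(#|C|.+4.+1) :=
  @unsplit 5 #|C| (match g with inl i => inl i | inr c => inr (enum_rank c) end).

Definition gdec (x : 'I_(#|C|.+4.+1)) : gam :=
  match @split 5 #|C| x with inl i => inl i | inr j => inr (enum_val j) end.

Lemma gencK : cancel genc gdec.
Proof. by case=> [i|c]; rewrite /gdec /genc unsplitK //= enum_rankK. Qed.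

Lemma genc_bl : genc gbl = ord0.
Proof. exact: val_inj. Qed.

Lemma val_genc_inl (i : 'I_5) : val (genc (inl i)) = i.
Proof. by []. Qed.

Lemma genc_raw x : x < 5 -> genc (inl (inord x)) = inord x.
Proof.
move=> lx; apply: val_inj; rewrite val_genc_inl /= !inordK //.
exact: leq_trans lx (leq_addr _ _).
Qed.

Variable F : frag gam.

(** The additional state [None] is the halting state, and both exits lead to it. *)
Definition tm_of : TM :=
  @mkTM #|{: option (fQ F)}| #|C| (enum_rank (Some (f0 F))) (enum_rank None)
   (fun q a => if enum_val q is Some q' then
      (enum_rank (match (fd q' (gdec a)).1.1 with inl p => Some p | inr _ => None end),
       genc (fd q' (gdec a)).1.2, (fd q' (gdec a)).2)
     else (q, a, true)).

Definition conf_of (x : fQ F + bool) (t : tape gam) : config tm_of :=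
  @Config tm_of (enum_rank (match x with inl p => Some p | inr _ => None end))
   (map genc t.1.1) (genc t.1.2) (map genc t.2).

Lemma genc_head r : head (@ord0 (#|C|.+4)) (map genc r) = genc (head gbl r).
Proof. by case: r => //=; rewrite genc_bl. Qed.

Lemma genc_behead r : behead (map genc r) = map genc (behead r).
Proof. by case: r. Qed.

Lemma tm_of_steps n c c' : fsteps gbl (fd (f:=F)) n c c' ->
  iter n (@tm_step tm_of) (conf_of c.1 c.2) = conf_of c'.1 c'.2.
Proof.
elim=> [//|m q [[l h] r] {}c' _ <-]; rewrite iterSr; congr iter.
rewrite {1}/tm_step /= (inj_eq enum_rank_inj) /= enum_rankK /= gencK /=.
by rewrite /conf_of; case: (fd q h) => [[x a] [|]] /=;
   rewrite ?genc_head ?genc_behead.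
Qed.

Lemma tm_of_init inp : all (fun x => x < 5) inp ->
  tm_init tm_of inp = conf_of (inl (f0 F)) (mk gbl [::] [seq inl (inord x) | x <- inp]).
Proof.
move=> /allP H; rewrite /tm_init /conf_of /mk /=.
have -> : [seq inord x | x <- inp] = map genc [seq inl (inord x) | x <- inp] :> seq 'I_(#|C|.+4.+1).
  by rewrite -map_comp; apply/eq_in_map => x /H /genc_raw <-.
by rewrite genc_head genc_behead.
Qed.

Lemma tm_of_output x l o m : all (fun y => 0 < y < 5) o ->
  tm_output (conf_of x (mk gbl l ([seq inl (inord y) | y <- o] ++ nseq m gbl))) = o.
Proof.
move=> /allP H; rewrite /tm_output /conf_of; set s := c_head _ :: c_right _.
have [m' Es] : exists m', s = map genc ([seq inl (inord y) | y <- o] ++ nseq m' gbl).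
  rewrite /s; case: o {H s} => [|y o] /=; last by exists m.
  by exists m.-1.+1; case: m.
have Ef : find (fun a => a == blank tm_of) s = size o.
  rewrite Es map_cat find_cat size_map has_map.
  have -> : has (preim genc (fun a => a == blank tm_of)) [seq inl (inord y) | y <- o] = false.
    apply/hasP => -[g /mapP[y /H /andP[y0 y5] ->]] /= /eqP/(congr1 val) /=.
    by rewrite inordK // => y00; move: y0; rewrite y00.
  rewrite map_nseq genc_bl size_map; case: m' {Es} => [|m']; first by rewrite addn0.
  by rewrite /= addn0.
rewrite Ef Es map_cat take_size_cat ?size_map // -!map_comp.
by apply: map_id_in => y /H /andP[_ y5] /=; rewrite inordK.
Qed.

(* Moves from the first cell to the first raw symbol, where the output starts. *)
Definition fFin : frag gam :=
  @Frag _ bool false (fun q g => if q then (inr true, g, false)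
     else (inl (if g is inl _ then true else false), g, true)).

(** The head moves at every step, so on reading the first raw symbol it necessarily leaves it; the
    second state steps back. *)
Lemma fFin_steps l (cs : seq C) y r m : exists l' m',
  fsteps gbl (fd (f:=fFin)) (size cs + 2)
    (inl false, mk gbl l (map inr cs ++ inl y :: r ++ nseq m gbl))
    (inr true, mk gbl l' (inl y :: r ++ nseq m' gbl)).
Proof.
elim: cs l => [|c cs IH] l.
  exists l; case: r => [|g r].
    exists m.-1.+1; apply: fstepsS; apply: fstepsS.
    by case: m => [|m]; exact: fsteps0.
  by exists m; apply: fstepsS; apply: fstepsS; exact: fsteps0.
have [l' [m' H]] := IH (inr c :: l).
by exists l', m'; rewrite addSn; apply: fstepsS.
Qed.

End ToTM.

(** * Search programs and their compilation *)

(* Programs manipulate named unary relations (tracks) over the positions of a fixed input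
   word and append symbols to a write-only output.  Variables are de Bruijn levels and range
   over positions. [PEx P] runs [P] on successive positions until it returns true; [PWalk v w P Q]
   moves two fresh pointers to the right from [v] and [w] until [P] (success) or [Q] (failure). *)
Inductive prog :=
| PConst of bool
| PSym (x v : nat)
| PTrk (t v : nat)
| PEq (v w : nat)
| PLt (v w : nat)
| PSucc (v w : nat)
| PPut (t v : nat) (b : bool)
| PEmit (x : nat)
| PIf of prog & prog & prog
| PEx of prog
| PWalk (v w : nat) of prog & prog.

(** The number of tracks. In a compiled cell the bits below [KN] hold the tracks, and bit [KN + v]
    marks the position of variable [v]. *)
Definition KN := 10.

Record store := Store { trk : nat -> nat -> bool; out : seq nat }.

Definition put (s : store) t i b :=
  Store (fun t' => if t' == t then fun j => if j == i then b else trk s t j else trk s t') (out s).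

Definition emit (s : store) x := Store (trk s) (rcons (out s) x).

Definition upd (r : nat -> nat) d i := fun v => if v == d then i else r v.

Fixpoint search (f : nat -> store -> bool * store) l s :=
  if l is i :: l' then
    if (f i s).1 then (true, (f i s).2) else search f l' (f i s).2
  else (false, s).

Section Sem.
Variables (N : nat) (a : nat -> nat).

Fixpoint walk (f g : nat -> nat -> store -> bool * store) fuel i j s :=
  if fuel is fuel'.+1 then
    if (f i j s).1 then (true, (f i j s).2) else
    if (g i j (f i j s).2).1 then (false, (g i j (f i j s).2).2) else
    if (i.+1 < N) && (j.+1 < N) then walk f g fuel' i.+1 j.+1 (g i j (f i j s).2).2
    else (false, (g i j (f i j s).2).2)
  else (false, s).

(** Variables out of scope, absent tracks and symbols outside 1 to 4 get harmless meanings, so that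
    programs need no typing condition. *)
Fixpoint sem d P (r : nat -> nat) (s : store) : bool * store :=
  match P with
  | PConst b => (b, s)
  | PSym x v => ((v < d) && (a (r v) == x), s)
  | PTrk t v => ([&& t < KN, v < d & trk s t (r v)], s)
  | PEq v w => ([&& v < d, w < d & r v == r w], s)
  | PLt v w => ([&& v < d, w < d & r v < r w], s)
  | PSucc v w => ([&& v < d, w < d & (r v).+1 == r w], s)
  | PPut t v b => (true, if (t < KN) && (v < d) then put s t (r v) b else s)
  | PEmit x => (true, if 0 < x < 5 then emit s x else s)
  | PIf P1 P2 P3 => let: (b, s') := sem d P1 r s in sem d (if b then P2 else P3) r s'
  | PEx P1 => search (fun i => sem d.+1 P1 (upd r d i)) (iota 0 N) s
  | PWalk v w P1 P2 =>
      if (v < d) && (w < d) then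
        walk (fun i j => sem d.+2 P1 (upd (upd r d i) d.+1 j))
             (fun i j => sem d.+2 P2 (upd (upd r d i) d.+1 j)) N (r v) (r w) s
      else (false, s)
  end.

End Sem.

(** The largest number of variables in scope at once; it fixes how many pointer bits a cell
    needs. *)
Fixpoint lev d P : nat :=
  match P with
  | PIf P1 P2 P3 => maxn (lev d P1) (maxn (lev d P2) (lev d P3))
  | PEx P1 => maxn d.+1 (lev d.+1 P1)
  | PWalk v w P1 P2 => maxn d.+2 (maxn (lev d.+2 P1) (lev d.+2 P2))
  | _ => d
  end.

(** Bounds the number of sweeps of the compiled program on a word of length [N]. *)
Fixpoint cost (N : nat) P : nat :=
  match P with
  | PIf P1 P2 P3 => cost N P1 + (cost N P2 + cost N P3)
  | PEx P1 => 1 + N * (cost N P1 + 1)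
  | PWalk v w P1 P2 => 3 + N * (cost N P1 + cost N P2 + 3)
  | _ => 1
  end.

(** * Compilation of search programs into sweeps *)

Section Compile.
Variable K : nat.
Definition cellT := ('I_5 * {ffun 'I_K.+1 -> bool})%type.
Let G := gam cellT.

Definition bit t (c : cellT) := c.2 (inord t).
Definition setb t b (c : cellT) : cellT :=
  (c.1, [ffun t' => if t' == inord t then b else c.2 t']).

Definition swp (Q : finType) (q0 : Q) (f : Q -> cellT -> Q * cellT) (fin : Q -> bool * option G) : wp G :=
  Sw q0 (fun q g => if g is inr c then ((f q c).1, inr (f q c).2) else (q, g)) fin.

Definition constw b := swp b (fun q c => (q, c)) (fun q => (q, None)).
Definition tstw p := swp false (fun q c => (q || p c, c)) (fun q => (q, None)).
Definition mapw f := swp tt (fun q c => (tt, f c)) (fun _ => (true, None)).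
Definition ltw t t' := swp (false, false)
  (fun q c => (q.1 || bit t c, q.2 || q.1 && bit t' c, c)) (fun q => (q.2, None)).
Definition succw t t' := swp (false, false)
  (fun q c => (bit t c, q.2 || q.1 && bit t' c, c)) (fun q => (q.2, None)).
Definition emitw x := swp tt (fun q c => (q, c)) (fun _ => (true, Some (inl (inord x)))).
Definition initw t := swp false (fun q c => (true, setb t (~~ q) c)) (fun _ => (true, None)).
(** The state carries the bit of the previous cell, which shifts the pointer by one. A bit still
    carried at the end means that the pointer has left the word. *)
Definition advw t := swp false (fun q c => (bit t c, setb t q c)) (fun q => (~~ q, None)).

Fixpoint cmpP d P : wp G :=
  match P with
  | PConst b => constw b
  | PSym x v => if v < d then tstw (fun c => bit (KN + v) c && (c.1 == x :> nat)) else constw false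
  | PTrk t v => if (t < KN) && (v < d) then tstw (fun c => bit (KN + v) c && bit t c)
                else constw false
  | PEq v w => if (v < d) && (w < d) then tstw (fun c => bit (KN + v) c && bit (KN + w) c)
               else constw false
  | PLt v w => if (v < d) && (w < d) then ltw (KN + v) (KN + w) else constw false
  | PSucc v w => if (v < d) && (w < d) then succw (KN + v) (KN + w) else constw false
  | PPut t v b => if (t < KN) && (v < d) then
                    mapw (fun c => if bit (KN + v) c then setb t b c else c)
                  else constw true
  | PEmit x => if 0 < x < 5 then emitw x else constw true
  | PIf P1 P2 P3 => WIf (cmpP d P1) (cmpP d P2) (cmpP d P3)
  | PEx P1 => WIf (initw (KN + d)) (WLoop (cmpP d.+1 P1) (advw (KN + d))) (constw true)
  | PWalk v w P1 P2 =>
      if (v < d) && (w < d) then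
        WIf (mapw (fun c => setb (KN + d) (bit (KN + v) c) c))
         (WIf (mapw (fun c => setb (KN + d.+1) (bit (KN + w) c) c))
           (WLoop (cmpP d.+2 P1)
              (WIf (cmpP d.+2 P2) (constw false)
                 (WIf (advw (KN + d)) (advw (KN + d.+1)) (constw false))))
           (constw true)) (constw true)
      else constw false
  end.

Variables (N : nat) (a : nat -> nat).
Hypothesis N0 : 0 < N.
Hypothesis aok : forall i, i < N -> 0 < a i < 5.

Definition cell (Y : nat -> nat -> bool) i : cellT :=
  (inord (a i), [ffun t : 'I_K.+1 => Y t i]).

Definition tapeW Y (o : seq nat) : seq G :=
  [seq inr (cell Y i) | i <- iota 0 N] ++ [seq inl (inord x) | x <- o].

Lemma bit_cell Y i t : t <= K -> bit t (cell Y i) = Y t i.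
Proof. by move=> tK; rewrite /bit ffunE inordK. Qed.

Lemma eq_cell Y Y' i : (forall t, t <= K -> Y t i = Y' t i) -> cell Y i = cell Y' i.
Proof. by move=> H; congr pair; apply/ffunP => t; rewrite !ffunE H // -ltnS. Qed.

Definition updY (Y : nat -> nat -> bool) t (f : nat -> bool) := fun t' i => if t' == t then f i else Y t' i.

Lemma setb_cell Y t f i : t <= K -> setb t (f i) (cell Y i) = cell (updY Y t f) i.
Proof.
move=> tK; congr pair; apply/ffunP => t'; rewrite !ffunE /updY -val_eqE /= inordK //.
Qed.

Lemma mealy_tape Q (f : Q -> cellT -> Q * cellT) (sg : nat -> Q) Y Y' o :
  (forall i, i < N -> f (sg i) (cell Y i) = (sg i.+1, cell Y' i)) ->
  mealy (fun q (g : G) => if g is inr c then ((f q c).1, inr (f q c).2) else (q, g)) (sg 0) (tapeW Y o)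
   = (sg N, tapeW Y' o).
Proof.
move=> H; rewrite /tapeW.
have Ho q : mealy (fun q (g : G) => if g is inr c then ((f q c).1, inr (f q c).2) else (q, g)) q
   [seq inl (inord x) | x <- o] = (q, [seq inl (inord x) | x <- o]).
  by elim: o => //= x o ->.
have Hc m i : i + m <= N -> mealy (fun q (g : G) => if g is inr c then ((f q c).1, inr (f q c).2) else (q, g)) (sg i)
   ([seq inr (cell Y j) | j <- iota i m] ++ [seq inl (inord x) | x <- o])
  = (sg (i + m), [seq inr (cell Y' j) | j <- iota i m] ++ [seq inl (inord x) | x <- o]).
  elim: m i => [|m IH] i im /=; first by rewrite Ho addn0.
  by rewrite H /= ?IH ?addSnnS //; lia.
exact: (Hc N 0).
Qed.

Definition ook (o : seq nat) := all (fun x => 0 < x < 5) o.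

Lemma nb_tapeW Y o : ook o -> nb (gbl cellT) (tapeW Y o).
Proof.
move=> /allP H; rewrite /nb all_cat; apply/andP; split; apply/allP => g /mapP[x].
  by move=> _ ->.
move=> /H /andP[x0 x5] ->; apply/eqP => -[] /(congr1 val) /=.
by rewrite inordK // => E; rewrite E in x0.
Qed.

Lemma run_swp (Q : finType) (f : Q -> cellT -> Q * cellT) (sg : nat -> Q) Y Y' fin o b e q0 :
  (forall i, i < N -> f (sg i) (cell Y i) = (sg i.+1, cell Y' i)) -> q0 = sg 0 ->
  ook (o ++ e) -> fin (sg N) = (b, if e is x :: _ then Some (inl (inord x)) else None) -> size e <= 1 ->
  wrun (gbl cellT) (swp q0 f fin) (tapeW Y o) b (tapeW Y' (o ++ e)) 1.
Proof.
move=> H -> ok Ef se.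
have E := mealy_tape o H.
have := @wrun_Sw _ (gbl cellT) Q (sg 0)
  (fun q (g : G) => if g is inr c then ((f q c).1, inr (f q c).2) else (q, g)) fin
  (tapeW Y o) (tapeW Y' (o ++ e)).
rewrite E /= Ef /=; apply; last exact: nb_tapeW.
by case: e se {ok Ef} => [|x [|]] //= _; rewrite ?cats0 // /tapeW map_cat -catA.
Qed.

Lemma run_swp0 (Q : finType) (f : Q -> cellT -> Q * cellT) (sg : nat -> Q) Y Y' fin o b q0 :
  (forall i, i < N -> f (sg i) (cell Y i) = (sg i.+1, cell Y' i)) -> q0 = sg 0 ->
  ook o -> fin (sg N) = (b, None) ->
  wrun (gbl cellT) (swp q0 f fin) (tapeW Y o) b (tapeW Y' o) 1.
Proof.
move=> H E0 ok Ef; rewrite -{2}[o]cats0.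
by apply: (@run_swp _ f sg Y Y' fin o b [::] q0) => //; rewrite cats0.
Qed.

Lemma run_constw Y o b : ook o -> wrun (gbl cellT) (constw b) (tapeW Y o) b (tapeW Y o) 1.
Proof. by move=> ok; apply: (run_swp0 (sg := fun=> b)). Qed.

Lemma run_tstw Y o p (i0 : nat) v : ook o -> i0 < N ->
  (forall i, i < N -> p (cell Y i) = (i == i0) && v) ->
  wrun (gbl cellT) (tstw p) (tapeW Y o) v (tapeW Y o) 1.
Proof.
move=> ok l0 H; apply: (run_swp0 (sg := fun i => (i0 < i) && v)) => // [i iN|].
  congr pair; rewrite H //; case: v {H}; rewrite ?andbT ?andbF //; lia.
by rewrite l0.
Qed.

Lemma run_mapw Y Y' f o : ook o -> (forall i, i < N -> f (cell Y i) = cell Y' i) ->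
  wrun (gbl cellT) (mapw f) (tapeW Y o) true (tapeW Y' o) 1.
Proof. by move=> ok H; apply: (run_swp0 (sg := fun=> tt)) => // i /H ->. Qed.

(** Pointer bits of levels from [d] on are left free, so loops need not erase their pointers when
    they end. *)
Definition represents d (r : nat -> nat) (s : store) Y :=
  [/\ forall t i, t < KN -> i < N -> Y t i = trk s t i,
      forall v i, v < d -> i < N -> Y (KN + v) i = (i == r v),
      forall v, v < d -> r v < N & ook (out s)].

Lemma represents_sub d r s Y i : represents d.+1 (upd r d i) s Y -> represents d r s Y.
Proof.
case=> H1 H2 H3 H4; split=> // [v j vd jN|v vd].
  by rewrite H2 ?(leqW vd) // /upd (ltn_eqF vd).
by have := H3 v (leqW vd); rewrite /upd (ltn_eqF vd).
Qed.

Lemma represents_scratch d r s Y v f : represents d r s Y -> d <= v -> represents d r s (updY Y (KN + v) f).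
Proof.
case=> H1 H2 H3 H4 dv; split=> // [t j tK jN|w j wd jN].
  by rewrite /updY ifF ?H1 //; lia.
by rewrite /updY ifF ?H2 //; lia.
Qed.

Lemma represents_ext d r s Y i f : represents d r s Y -> i < N -> (forall j, j < N -> f j = (j == i)) ->
  represents d.+1 (upd r d i) s (updY Y (KN + d) f).
Proof.
case=> H1 H2 H3 H4 iN Hf; split=> // [t j tK jN|v j|v].
- rewrite /updY ifF ?H1 //; lia.
- rewrite ltnS leq_eqVlt /updY /upd eqn_add2l.
  by case: eqVneq => [_|_] /= vd jN; [exact: Hf | exact: H2].
- by rewrite ltnS leq_eqVlt /upd; case: eqVneq => //= _ /H3.
Qed.

Lemma run_advw Y o t i : t <= K -> ook o -> i < N -> (forall j, j < N -> Y t j = (j == i)) ->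
  wrun (gbl cellT) (advw t) (tapeW Y o) (i.+1 < N)
    (tapeW (updY Y t (fun j => j == i.+1)) o) 1.
Proof.
move=> tK ok iN HY; apply: (run_swp0 (sg := fun j => j == i.+1)) => // [j jN|].
  by rewrite -setb_cell // bit_cell // HY // eqSS.
by congr pair; lia.
Qed.

Lemma cmpP_correct P d r s Y : lev d P + KN <= K.+1 -> represents d r s Y ->
  exists Y' n, [/\ wrun (gbl cellT) (cmpP d P) (tapeW Y (out s)) (sem N a d P r s).1
                     (tapeW Y' (out (sem N a d P r s).2)) n,
    n <= cost N P & represents d r (sem N a d P r s).2 Y'].
Proof.
elim: P d r s Y => [b|x v|t v|v w|v w|v w|t v b|x|P1 IH1 P2 IH2 P3 IH3|P1 IH1|v w P1 IH1 P2 IH2]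
  d r s Y; rewrite [lev _ _]/=.
- move=> _ R; exists Y, 1; split=> //; case: R => *; exact: run_constw.
- move=> lK R; exists Y, 1; split=> //=; case: R => H1 H2 H3 H4; case: ifP => vd; last exact: run_constw.
  apply: (run_tstw (i0 := r v)) => // [|i iN]; first exact: H3.
  rewrite bit_cell ?H2 //; last by lia.
  case: (i =P r v) => //= ->; rewrite inordK //; by case/andP: (aok (H3 _ vd)).
- move=> lK R; exists Y, 1; split=> //=; case: R => H1 H2 H3 H4.
  case: (ltnP t KN) => tK /=; last exact: run_constw.
  case: ifP => vd; last exact: run_constw.
  apply: (run_tstw (i0 := r v)) => // [|i iN]; first exact: H3.
  rewrite !bit_cell ?H2 ?H1 //; try lia.
  by case: (i =P r v) => //= ->.
- move=> lK R; exists Y, 1; split=> //=; case: R => H1 H2 H3 H4.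
  case: (ltnP v d) => vd /=; last exact: run_constw.
  case: ifP => wd; last exact: run_constw.
  apply: (run_tstw (i0 := r v)) => // [|i iN]; first exact: H3.
  by rewrite !bit_cell ?H2 //; lia.
- move=> lK R; exists Y, 1; split=> //=; case: R => H1 H2 H3 H4.
  case: (ltnP v d) => vd /=; last exact: run_constw.
  case: ifP => wd; last exact: run_constw.
  have Hv := H3 _ vd; have Hw := H3 _ wd.
  apply: (run_swp0 (sg := fun i => (r v < i, (r v < r w) && (r w < i)))) => // [i iN||].
    rewrite /= !bit_cell ?H2 //; try lia.
    by congr pair; congr pair; lia.
    by rewrite andbF.
  by rewrite /= Hw andbT.
- move=> lK R; exists Y, 1; split=> //=; case: R => H1 H2 H3 H4.
  case: (ltnP v d) => vd /=; last exact: run_constw.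
  case: ifP => wd; last exact: run_constw.
  have Hv := H3 _ vd; have Hw := H3 _ wd.
  apply: (run_swp0 (sg := fun i => ((r v).+1 == i, ((r v).+1 == r w) && (r w < i)))) => // [i iN||].
    rewrite /= !bit_cell ?H2 //; try lia.
    by congr pair; congr pair; lia.
    by rewrite andbF.
  by rewrite /= Hw andbT.
- move=> lK R; case: (R) => H1 H2 H3 H4 /=.
  case: (ltnP t KN) => tK /=; last by exists Y, 1; split=> //; exact: run_constw.
  case: ifP => vd; last by exists Y, 1; split=> //; exact: run_constw.
  exists (updY Y t (fun i => if i == r v then b else Y t i)), 1; split=> //.
    apply: run_mapw => // i iN; rewrite bit_cell ?H2 //; last by lia.
    have Ht : t <= K by lia.
    have := @setb_cell Y t (fun i => if i == r v then b else Y t i) i Ht.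
    case: eqP => // ne _; apply: eq_cell => t' t'K; rewrite /updY; case: eqP => // ->; by case: eqP.
  split=> // [t' i t'K iN|v' i v'd iN].
    by rewrite /updY /=; case: (t' =P t) => [_|_]; rewrite H1.
  by rewrite /updY ifF ?H2 //; lia.
- move=> lK R; exists Y, 1; split=> //=; case: R => H1 H2 H3 H4.
    case: ifP => x5; last exact: run_constw.
    rewrite /emit /= -cats1.
    apply: (run_swp (sg := fun=> tt)) => //.
    by rewrite /ook all_cat [all _ [:: x]]/= x5 !andbT.
  case: ifP => x5; split=> //=.
  by rewrite /ook all_rcons x5.
- move=> lK R.
  have [|Y1 [n1 [W1 c1 R1]]] := IH1 d r s Y _ R; first by lia.
  rewrite /=; case E: (sem N a d P1 r s) W1 R1 => [b s1] /= W1 R1.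
  case: b E W1 => E W1.
    have [|Y2 [n2 [W2 c2 R2]]] := IH2 d r s1 Y1 _ R1; first by lia.
    exists Y2, (n1 + n2); split=> //; last by lia.
    by apply: wrun_If W1 _.
  have [|Y2 [n2 [W2 c2 R2]]] := IH3 d r s1 Y1 _ R1; first by lia.
  exists Y2, (n1 + n2); split=> //; last by lia.
  by apply: wrun_If W1 _.
- move=> lK R.
  set f := fun i => sem N a d.+1 P1 (upd r d i).
  (* [m] positions remain from [i] on. It is positive because the compiled loop runs its body before
     it tests for the end of the word. *)
  have L m : forall i s Y, 0 < m -> i + m = N -> represents d.+1 (upd r d i) s Y ->
    exists Y' n, [/\ wrun (gbl cellT) (WLoop (cmpP d.+1 P1) (advw (KN + d))) (tapeW Y (out s))
        (search f (iota i m) s).1 (tapeW Y' (out (search f (iota i m) s).2)) n,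
        n <= m * (cost N P1 + 1) & represents d r (search f (iota i m) s).2 Y'].
    elim: m => // m IH i s1 Y1 _ im R1 /=.
    have [|Y2 [n2 [W2 c2 R2]]] := IH1 d.+1 (upd r d i) s1 Y1 _ R1; first by lia.
    rewrite -/(f i s1) in W2 R2; case E: (f i s1) W2 R2 => [b s2] /= W2 R2.
    case: b E W2 => E W2.
      exists Y2, n2; split; [exact: wrun_LoopT | by nia | exact: represents_sub R2].
    have iN : i < N by lia.
    have HY j : j < N -> Y2 (KN + d) j = (j == i).
      by case: R2 => _ H2 _ _ jN; rewrite H2 // /upd eqxx.
    have ok2 : ook (out s2) by case: R2.
    have WA := @run_advw Y2 (out s2) (KN + d) i ltac:(lia) ok2 iN HY.
    case: (posnP m) => m0.
      rewrite m0 /=; exists (updY Y2 (KN + d) (fun j => j == i.+1)), (n2 + 1); split.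
      - by apply: wrun_LoopF W2 _; move: WA; have -> : (i.+1 < N) = false by lia.
      - by nia.
      - exact: represents_scratch (represents_sub R2) _.
    have R3 : represents d.+1 (upd r d i.+1) s2 (updY Y2 (KN + d) (fun j => j == i.+1)).
      apply: represents_ext => //; first exact: represents_sub R2.
      by lia.
    have [|Y3 [n3 [W3 c3 R4]]] := IH i.+1 s2 _ m0 _ R3; first by lia.
    exists Y3, (n2 + 1 + n3); split=> //; last by nia.
    apply: wrun_LoopS W2 _ W3.
    by move: WA; have -> : (i.+1 < N) = true by lia.
  have R0 : represents d.+1 (upd r d 0) s (updY Y (KN + d) (fun j => j == 0)) by apply: represents_ext.
  have [Y1 [n1 [W1 c1 R1]]] := L N 0 s _ N0 (add0n N) R0.
  exists Y1, (1 + n1); split=> //.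
  apply: (wrun_If (b := true) (v := tapeW (updY Y (KN + d) (fun j => j == 0)) (out s))) W1.
  apply: (run_swp0 (sg := fun j => 0 < j)) => // [j jN|]; last by case: R.
  by rewrite -setb_cell ?lt0n ?negbK //; lia.
- move=> lK R /=.
  case: ifP => vw; last by exists Y, 1; split=> //; case: R => *; exact: run_constw.
  case/andP: vw => vd wd.
  set f := fun i j => sem N a d.+2 P1 (upd (upd r d i) d.+1 j).
  set g := fun i j => sem N a d.+2 P2 (upd (upd r d i) d.+1 j).
  (* [i + m >= N] ensures that the end of the word stops the walk before the fuel is spent. *)
  have L m : forall i j s Y, 0 < m -> i + m >= N -> i < N -> j < N ->
    represents d.+2 (upd (upd r d i) d.+1 j) s Y ->
    exists Y' n, [/\ wrun (gbl cellT) (WLoop (cmpP d.+2 P1)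
              (WIf (cmpP d.+2 P2) (constw false)
                 (WIf (advw (KN + d)) (advw (KN + d.+1)) (constw false)))) (tapeW Y (out s))
        (walk N f g m i j s).1 (tapeW Y' (out (walk N f g m i j s).2)) n,
        n <= m * (cost N P1 + cost N P2 + 3) & represents d r (walk N f g m i j s).2 Y'].
    elim: m => // m IH i j s1 Y1 _ im iN jN R1 /=.
    have [|Y2 [n2 [W2 c2 R2]]] := IH1 d.+2 _ s1 Y1 _ R1; first by lia.
    rewrite -/(f i j s1) in W2 R2; case E: (f i j s1) W2 R2 => [b s2] /= W2 R2.
    case: b E W2 => E W2.
      exists Y2, n2; split; [exact: wrun_LoopT | by nia | exact: represents_sub (represents_sub R2)].
    have [|Y3 [n3 [W3 c3 R3]]] := IH2 d.+2 _ s2 Y2 _ R2; first by lia.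
    rewrite -/(g i j s2) in W3 R3; case E': (g i j s2) W3 R3 => [b s3] /= W3 R3.
    have ok3 : ook (out s3) by case: R3.
    case: b E' W3 => E' W3.
      exists Y3, (n2 + (n3 + 1)); split; [|by nia | exact: represents_sub (represents_sub R3)].
      by apply: wrun_LoopF W2 _; apply: wrun_If W3 _; exact: run_constw.
    have HY l : l < N -> Y3 (KN + d) l = (l == i).
      by case: R3 => _ H2 _ _ lN; rewrite H2 // /upd (ltn_eqF (ltnSn d)) eqxx.
    have WA := @run_advw Y3 (out s3) (KN + d) i ltac:(lia) ok3 iN HY.
    set Y4 := updY Y3 _ _ in WA.
    have HY4 l : l < N -> Y4 (KN + d.+1) l = (l == j).
      case: R3 => _ H2 _ _ lN; rewrite /Y4 /updY ifF; last by lia.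
      by rewrite H2 // /upd eqxx.
    have WB := @run_advw Y4 (out s3) (KN + d.+1) j ltac:(lia) ok3 jN HY4.
    set Y5 := updY Y4 _ _ in WB.
    have Rb l : represents d r s3 (updY Y3 (KN + d) l) by exact: represents_scratch (represents_sub (represents_sub R3)) _.
    case: (ltnP i.+1 N) WA => iN' WA /=; last first.
      exists Y4, (n2 + (n3 + (1 + 1))); split; [|by nia | exact: Rb].
      apply: wrun_LoopF W2 _; apply: wrun_If W3 _; apply: wrun_If WA _; exact: run_constw.
    case: (ltnP j.+1 N) WB => jN' WB /=; last first.
      exists Y5, (n2 + (n3 + (1 + 1))); split; [|by nia | ].
        by apply: wrun_LoopF W2 _; apply: wrun_If W3 _; apply: wrun_If WA _.
      exact: represents_scratch (Rb _) _.
    have R5 : represents d.+2 (upd (upd r d i.+1) d.+1 j.+1) s3 Y5.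
      apply: represents_ext => //; apply: represents_ext => //; exact: represents_sub (represents_sub R3).
    have [||Y6 [n6 [W6 c6 R6]]] := IH i.+1 j.+1 s3 Y5 _ _ iN' jN' R5; try by lia.
    exists Y6, (n2 + (n3 + (1 + 1)) + n6); split=> //; last by nia.
    by apply: wrun_LoopS W2 _ W6; apply: wrun_If W3 _; apply: wrun_If WA _.
  case: (R) => H1 H2 H3 H4.
  have R0 : represents d.+2 (upd (upd r d (r v)) d.+1 (r w)) s
      (updY (updY Y (KN + d) (Y (KN + v))) (KN + d.+1) (Y (KN + w))).
    apply: represents_ext; [apply: represents_ext => //; first exact: H3 | exact: H3 |].
      by move=> j jN; rewrite H2.
    by move=> j jN; rewrite H2.
  have [|Y1 [n1 [W1 c1 R1]]] := L N (r v) (r w) s _ N0 _ (H3 _ vd) (H3 _ wd) R0; first by lia.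
  exists Y1, (1 + (1 + n1)); split=> //; last by lia.
  apply: (wrun_If (b := true) (v := tapeW (updY Y (KN + d) (Y (KN + v))) (out s))).
    apply: run_mapw => // i iN; rewrite -setb_cell ?bit_cell //; lia.
  apply: (wrun_If (b := true)) W1.
  apply: run_mapw => // i iN; rewrite -[RHS]setb_cell; last by lia.
  rewrite bit_cell; last by lia.
  by rewrite {1}/updY ifF //; lia.
Qed.

End Compile.

(** Powers of [N.+1] instead of [N] keep the form closed under sums and products even at [N = 0]. *)
Definition poly (f : nat -> nat) := exists A D, forall N, f N <= A * N.+1 ^ D.

Lemma poly_const m : poly (fun=> m).
Proof. by exists m, 0 => N; rewrite expn0 muln1. Qed.

Lemma poly_id : poly id.
Proof. by exists 1, 1 => N; rewrite expn1 mul1n. Qed.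

Lemma poly_add f g : poly f -> poly g -> poly (fun N => f N + g N).
Proof.
move=> [A [D Hf]] [B [E Hg]]; exists (A + B), (D + E) => N.
rewrite mulnDl; apply: leq_add.
  by apply: leq_trans (Hf N) _; rewrite leq_mul2l leq_pexp2l ?orbT //; lia.
by apply: leq_trans (Hg N) _; rewrite leq_mul2l leq_pexp2l ?orbT //; lia.
Qed.

Lemma poly_mul f g : poly f -> poly g -> poly (fun N => f N * g N).
Proof.
move=> [A [D Hf]] [B [E Hg]]; exists (A * B), (D + E) => N.
by rewrite expnD mulnACA leq_mul.
Qed.

Lemma poly_cost P : poly (cost ^~ P).
Proof.
elim: P => *; do ?[exact: poly_const].
- exact: poly_add _ (poly_add _ _).
- exact: poly_add (poly_const 1) (poly_mul poly_id (poly_add _ (poly_const 1))).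
- exact: poly_add (poly_const 3) (poly_mul poly_id (poly_add (poly_add _ _) (poly_const 3))).
Qed.

Lemma poly_bound f : poly f -> exists c, forall N, f N <= c * N ^ c + c.
Proof.
(* For positive [N], [N.+1 <= 2 * N] gives the factor [2 ^ D]; one number then serves as
   coefficient, exponent and additive constant. *)
move=> [A [D H]]; exists (A * 2 ^ D + D) => N; apply: leq_trans (H N) _.
case: N => [|N]; first by rewrite exp1n muln1; have := expn_gt0 2 D; nia.
apply: leq_trans (leq_addr _ _).
apply: (@leq_trans (A * 2 ^ D * N.+1 ^ D)).
  by rewrite -mulnA -expnMn leq_mul2l; apply/orP; right; case: (posnP D) => [->|D0]; rewrite ?expn0 // leq_exp2r //; lia.
apply: leq_mul; first exact: leq_addr.
by rewrite leq_pexp2l // leq_addl.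
Qed.

Definition store0 := Store (fun _ _ => false) [::].

(** One preliminary sweep turns the raw input letters into cells with empty tracks, and a last
    fragment brings the head to the first output symbol, which exists because the output is
    nonempty. *)
Theorem tm_of_prog (P : prog) : exists (M : TM) (c : nat), forall inp : seq nat,
  0 < size inp -> all (fun x => 0 < x < 5) inp ->
  let o := out (sem (size inp) (nth 0 inp) 0 P (fun=> 0) store0).2 in
  o != [::] ->
  exists2 t, t <= c * size inp ^ c + c & halts_with M inp t o.
Proof.
pose K := lev 0 P + KN; pose C := cellT K.
pose ini : wp (gam C) := @Sw (gam C) unit tt
  (fun q g => (q, if g is inl x then inr (x, [ffun=> false]) else g)) (fun=> (true, None)).
pose W := WIf ini (cmpP K 0 P) (cmpP K 0 P).
pose F := fIf (fcmp (gbl C) W) (fFin C) (fFin C).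
pose n N := cost N P + 1.
have [|c Hc] := @poly_bound (fun N => n N * (2 * (N + n N) + 2) + (N + 2)).
  have pn : poly n by exact: poly_add (poly_cost P) (poly_const 1).
  apply: poly_add (poly_mul pn (poly_add (poly_mul (poly_const 2) (poly_add poly_id pn)) (poly_const 2))) _.
  exact: poly_add poly_id (poly_const 2).
exists (tm_of F), c => inp N0 ok o o0; set N := size inp.
pose u := [seq (inl (inord x) : gam C) | x <- inp].
have aok i : i < N -> 0 < nth 0 inp i < 5 by move=> iN; exact: (allP ok _ (mem_nth 0 iN)).
pose Y0 := fun _ _ : nat => false.
have nbu : nb (gbl C) u.
  apply/allP => g /mapP[x /(allP ok) /andP[x0 x5] ->]; apply/eqP => -[] /(congr1 val) /=.
  by rewrite inordK // => E; rewrite E in x0.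
have W0 : wrun (gbl C) ini u true (tapeW K N (nth 0 inp) Y0 [::]) 1.
  have E v : (mealy (fun q (g : gam C) => (q, if g is inl x then inr (x, [ffun=> false]) else g)) tt
     [seq inl (inord x) | x <- v]).2 = [seq inr (inord x, [ffun=> false]) | x <- v].
    by elim: v => //= x v ->.
  have Et : tapeW K N (nth 0 inp) Y0 [::] =
    ([seq inr (inord x, [ffun=> false]) | x <- inp] : seq (gam C)).
    rewrite /tapeW cats0 -[in RHS](mkseq_nth 0 inp) /mkseq -map_comp.
    by apply: eq_map => i /=; congr inr; congr pair; apply/ffunP => t; rewrite !ffunE.
  apply: (wrun_Sw (q0 := tt) (fin := fun=> (true, None))); first by rewrite cats0 Et -E.
  exact: nb_tapeW.
have R0 : represents N 0 (fun=> 0) store0 Y0 by [].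
have [|Y1 [n1 [W1 c1 R1]]] := @cmpP_correct K N (nth 0 inp) N0 aok P 0 (fun=> 0) store0 Y0 _ R0.
  by rewrite /K.
rewrite -/o in W1; set b1 := (sem _ _ _ _ _ _).1 in W1.
have W2 : wrun (gbl C) W u b1 (tapeW K N (nth 0 inp) Y1 o) (1 + n1).
  by apply: wrun_If W0 _.
have [|T [t1 [lT S1 [m [m' E1]] nb1 _]]] := wrun_fsteps W2 nbu (t := mk (gbl C) [::] u).
  by exists 0, 0; rewrite cats0.
have oko : ook o by case: R1.
case Eo : o o0 => [//|y o'] _.
have S2 : exists l' m'', fsteps (gbl C) (fd (f := fFin C)) (N + 2) (inl false, t1)
    (inr true, mk (gbl C) l' ([seq inl (inord x) | x <- o] ++ nseq m'' (gbl C))).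
  have [l' [m'' S]] := @fFin_steps C (nseq m (gbl C)) [seq cell K (nth 0 inp) Y1 i | i <- iota 0 N]
     (inord y) [seq inl (inord x) | x <- o'] m'.
  exists l', m''; move: S; rewrite size_map size_iota E1 Eo /tapeW /= -map_comp.
  by rewrite -catA.
case: S2 => l' [m'' S2].
have S3 : fsteps (gbl C) (fd (f := F)) (T + (N + 2)) (inl (f0 F), mk (gbl C) [::] u)
   (inr true, mk (gbl C) l' ([seq inl (inord x) | x <- o] ++ nseq m'' (gbl C))).
  apply: fsteps_trans.
    by apply: (fsteps_embed (phi := inl)
      (psi := fun b => inl (inr (if b then inl (f0 (fFin C)) else inr (f0 (fFin C)))))) S1.
  case: (b1).
    by apply: (fsteps_embed (phi := fun q => inr (inl q)) (psi := inr)) S2.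
  by apply: (fsteps_embed (phi := fun q => inr (inr q)) (psi := inr)) S2.
exists (T + (N + 2)).
  apply: leq_trans (Hc N); rewrite leq_add2r; apply: leq_trans lT _.
  rewrite size_map /n -/N; apply: leq_mul; lia.
rewrite /halts_with tm_of_init; last by apply/allP => x /(allP ok) /andP[].
rewrite (tm_of_steps S3) -Eo; split=> //.
exact: tm_of_output.
Qed.

(** * Harmonic estimates *)

(** The difference of the two sides vanishes at 1 and has derivative [(z - 1)^2 / (z (z + 1)^2)]. *)
Lemma ln_lower y : (1 <= y)%R -> (2 * (y - 1) / (y + 1) <= ln y)%R.
Proof.
move=> y1; case: (Req_dec y 1) => [->|yn1]; first by rewrite ln_1; lra.
pose f := fun z => (ln z - (2 - 4 * (1 / (z + 1))))%R.
pose f' := fun z => (/ z - (0 - 4 * (- 1 / (z + 1) ^ 2)))%R.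
have D c : (1 <= c <= y)%R -> derivable_pt_lim f c (f' c).
  move=> c1; apply: derivable_pt_lim_minus; first by apply: derivable_pt_lim_ln; lra.
  apply: derivable_pt_lim_minus; first exact: derivable_pt_lim_const.
  apply: derivable_pt_lim_scal.
  have -> : (-1 / (c + 1) ^ 2 = (0 * (c + 1) - (1 + 0) * 1) / Rsqr (c + 1))%R by rewrite /Rsqr; field; lra.
  apply: (derivable_pt_lim_div (fun=> 1%R) (fun z => z + 1)%R c 0%R (1 + 0)%R); last by lra.
    exact: derivable_pt_lim_const.
  by apply: derivable_pt_lim_plus; [exact: derivable_pt_lim_id | exact: derivable_pt_lim_const].
have [|c [Ef cy]] := MVT_cor2 f f' 1%R y _ D; first by lra.
have f'0 : (0 <= f' c)%R.
  have -> : f' c = ((c - 1) ^ 2 * / (c * (c + 1) ^ 2))%R by rewrite /f'; field; lra.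
  apply: Rmult_le_pos; first exact: pow2_ge_0.
  by left; apply: Rinv_0_lt_compat; apply: Rmult_lt_0_compat; [lra|apply: pow_lt; lra].
have f1 : f 1%R = 0%R by rewrite /f ln_1; field.
have : (0 <= f y)%R.
  have -> : f y = (f y - f 1%R)%R by rewrite f1; ring.
  by rewrite Ef; apply: Rmult_le_pos; lra.
rewrite /f /Rdiv Rmult_1_l => H.
have -> : (2 * (y - 1) * / (y + 1) = 2 - 4 * / (y + 1))%R by field; lra.
by lra.
Qed.

(** Concavity: the graph of [ln] lies below its tangent at [v]. *)
Lemma ln_tangent u v : (0 < u)%R -> (0 < v)%R -> (ln u <= ln v - 1 + u / v)%R.
Proof.
move=> u0 v0.
have E : ln u = (ln v + ln (u / v))%R.
  rewrite -ln_mult //; first by congr ln; field; lra.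
  exact: Rdiv_lt_0_compat.
have p : (0 < u / v)%R by exact: Rdiv_lt_0_compat.
suff : (ln (u / v) <= u / v - 1)%R by lra.
have := exp_ineq1_le (ln (u / v)); rewrite exp_ln //; lra.
Qed.

Lemma ln_div u v : (0 < u)%R -> (0 < v)%R -> ln (u / v) = (ln u - ln v)%R.
Proof.
move=> u0 v0.
have E : ln u = (ln v + ln (u / v))%R.
  rewrite -ln_mult //; first by congr ln; field; lra.
  exact: Rdiv_lt_0_compat.
by rewrite E; ring.
Qed.

Lemma ln2_lower : (2 / 3 <= ln 2)%R.
Proof. by have := @ln_lower 2; lra. Qed.

(** From [ln (4/3) >= 2/7] and [ln (3/2) >= 2/5]: adding twice the second to the first cancels
    [ln 2] and gives [38/35]. *)
Lemma ln3_lower : (13 / 12 <= ln 3)%R.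
Proof.
have A := @ln_lower (4 / 3); have B := @ln_lower (3 / 2).
rewrite ln_div in A; try lra; rewrite ln_div in B; try lra.
have E4 : ln 4 = (2 * ln 2)%R.
  have -> : (4 = 2 * 2)%R by lra.
  by rewrite ln_mult; lra.
by rewrite E4 in A; lra.
Qed.

Fixpoint har (n : nat) : R := if n is m.+1 then (har m + / INR m.+1)%R else 0%R.

Lemma INRS m : INR m.+1 = (INR m + 1)%R.
Proof. exact: S_INR. Qed.

Lemma INR_ge0 m : (0 <= INR m)%R. Proof. exact: pos_INR. Qed.

(** With [y = (2 p + 3) / (2 p + 1)], [ln_lower] reads exactly [1 / (p + 1) <= ln (2 p + 3) - ln (2
    p + 1)], so the sum telescopes. The constant [1 / 12] is what [ln 3 >= 13 / 12] leaves at
    [m = 1]. *)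
Lemma har_ln m : 0 < m -> (har m <= ln (2 * INR m + 1) - 1 / 12)%R.
Proof.
elim: m => // -[|m] IH _.
  by rewrite [har _]/= [INR 1]/= (_ : 2 * 1 + 1 = 3)%R; [have := ln3_lower; lra|ring].
have {IH} := IH isT; move: m.+1 => p IH.
have p0 := INR_ge0 p.
have -> : har p.+1 = (har p + / INR p.+1)%R by [].
rewrite !INRS.
have L := @ln_lower ((2 * (INR p + 1) + 1) / (2 * INR p + 1)).
rewrite ln_div in L; try lra.
have y1 : (1 <= (2 * (INR p + 1) + 1) / (2 * INR p + 1))%R.
  apply: (Rmult_le_reg_r (2 * INR p + 1)); first lra.
  rewrite /Rdiv Rmult_assoc Rinv_l; lra.
have E : (2 * ((2 * (INR p + 1) + 1) / (2 * INR p + 1) - 1) /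
   ((2 * (INR p + 1) + 1) / (2 * INR p + 1) + 1) = / (INR p + 1))%R by field; lra.
by have := L y1; rewrite E; lra.
Qed.

Lemma har_ge0 m : (0 <= har m)%R.
Proof.
elim: m => [|m IH]; first exact: Rle_refl.
have p0 : (0 < / INR m.+1)%R by apply: Rinv_0_lt_compat; rewrite INRS; have := INR_ge0 m; lra.
by rewrite /= -/(INR m.+1); lra.
Qed.

(** Each of the [j - j'] terms in between is at least [1 / j]. *)
Lemma har_diff j j' : j' <= j -> ((INR j - INR j') * / INR j <= har j - har j')%R.
Proof.
elim: j => [|j IH]; first by case: j' => // _; rewrite /=; lra.
rewrite leq_eqVlt => /orP[/eqP->|]; first by lra.
rewrite ltnS => jj; have {}IH := IH jj.
have j0 := INR_ge0 j.
have e1 : har j.+1 = (har j + / INR j.+1)%R by [].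
rewrite e1 INRS.
have l : (INR j' <= INR j)%R by apply: le_INR; lia.
have p1 : (0 < / (INR j + 1))%R by apply: Rinv_0_lt_compat; lra.
have E : ((INR j + 1 - INR j') * / (INR j + 1) = / (INR j + 1) + (INR j - INR j') * / (INR j + 1))%R by ring.
rewrite E.
suff : ((INR j - INR j') * / (INR j + 1) <= (INR j - INR j') * / INR j)%R by lra.
case: (Req_dec (INR j) 0) => [j00|jn0].
  have : INR j' = INR j by have := INR_ge0 j'; lra.
  by move=> ->; lra.
apply: Rmult_le_compat_l; first lra.
apply: Rinv_le_contravar; lra.
Qed.

(** * Numerical inequalities for the prices per vertex *)

Section Constants.
Variable k : nat.
Hypothesis k2 : 2 <= k.
Definition cK : R := (1 + ln (INR k))%R.
(** Half of the bound in [ineqB] on the excess over [cK]. *)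
Definition xK : R := (/ (2 * (INR k + 1)))%R.
Local Notation K := (INR k).

Lemma K2 : (2 <= K)%R. Proof. by have := le_INR 2 k; rewrite /=; apply; lia. Qed.

Lemma k2or3 : k = 2 \/ (3 <= K)%R.
Proof.
move: k2; rewrite leq_eqVlt => /orP[/eqP<-|l]; first by left.
right; have := le_INR 3 k; rewrite /= => H.
by have := H ltac:(lia); lra.
Qed.

Lemma xK_pos : (0 < xK)%R.
Proof. by apply: Rinv_0_lt_compat; have := K2; lra. Qed.

Lemma xK_eq : (xK * (2 * (K + 1)) = 1)%R.
Proof. by rewrite /xK; field; have := K2; lra. Qed.

Lemma xK_le : (xK <= 1 / 6)%R.
Proof.
have := xK_eq; have := K2; have := xK_pos => a b c; nra.
Qed.

Lemma cK_2 : (5 / 3 <= cK)%R.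
Proof.
have : (ln 2 <= ln K)%R.
  case: (Req_dec K 2) => [->|n2]; first lra.
  by left; apply: ln_increasing; have := K2; lra.
have := ln2_lower; rewrite /cK; lra.
Qed.

Lemma cK_3 : (3 <= K)%R -> (2 + 1 / 12 <= cK)%R.
Proof.
move=> k3; have : (ln 3 <= ln K)%R.
  case: (Req_dec K 3) => [->|n2]; first lra.
  by left; apply: ln_increasing; lra.
have := ln3_lower; rewrite /cK; lra.
Qed.

(** An equality at [K = 3]; this is the loss that the [1 / 12] of [har_ln] absorbs. *)
Lemma inv_small : (3 <= K)%R -> (/ K - / (K + 1) <= 1 / 12)%R.
Proof.
move=> k3.
have -> : (/ K - / (K + 1) = / (K * (K + 1)))%R by field; lra.
have -> : (1 / 12 = / 12)%R by lra.
apply: Rinv_le_contravar; nra.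
Qed.

Lemma K_case2 : k = 2 -> K = 2%R. Proof. by move=> ->; rewrite /=; lra. Qed.

(** Price [2 / (K + 1)], at which an untouched site needs no deposit. For [K >= 3] and [m > 0],
    [har_ln] and the tangents of [ln] at [K + 1] and [K] make the terms in [m] cancel and leave
    [cK + (1 / K - 1 / (K + 1)) - 1 / 12]; the cases [m = 0] and [k = 2] are numerical. *)
Lemma ineqA m : m < k -> (2 * (K - INR m) / (K + 1) + har m <= cK)%R.
Proof.
move=> mk; have KK := K2; have m0 := INR_ge0 m.
case: (posnP m) => [->|mp].
  rewrite [INR 0]/= [har 0]/=.
  have -> : (2 * (K - 0) / (K + 1) + 0 = 2 - 2 / (K + 1))%R by field; lra.
  case: k2or3 => [/K_case2 ->|k3]; first by have := cK_2; lra.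
  have := cK_3 k3; have : (0 < / (K + 1))%R by apply: Rinv_0_lt_compat; lra.
  by rewrite /Rdiv; lra.
case: k2or3 => [k2'|k3].
  have -> : m = 1 by lia.
  by rewrite K_case2 // [har 1]/= [INR 1]/=; have := cK_2; lra.
have H := har_ln mp.
have T := @ln_tangent (2 * INR m + 1) (K + 1) ltac:(lra) ltac:(lra).
have T2 := @ln_tangent (K + 1) K ltac:(lra) ltac:(lra).
have := inv_small k3; rewrite /cK.
have -> : (2 * (K - INR m) / (K + 1) = 2 - (2 * INR m + 1) / (K + 1) - / (K + 1))%R by field; lra.
have E : ((K + 1) / K = 1 + / K)%R by field; lra.
by rewrite E in T2; lra.
Qed.

Lemma ineqB' m : 0 < m -> (3 <= K)%R -> (2 * (K - INR m) / K + har m <= cK + / K - 1 / 12)%R.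
Proof.
move=> mp k3; have m0 := INR_ge0 m; have H := har_ln mp.
have T := @ln_tangent (2 * INR m + 1) K ltac:(lra) ltac:(lra).
have -> : (2 * (K - INR m) / K = 2 - (2 * INR m + 1) / K + / K)%R by field; lra.
by rewrite /cK; lra.
Qed.

Lemma x2E : (2 * xK = / (K + 1))%R.
Proof. by rewrite /xK; field; have := K2; lra. Qed.

(** Price [2 / K], that of an untouched site without helpful neighbours: the excess is covered by
    the deposits on its two links. *)
Lemma ineqB m : m < k -> (2 * (K - INR m) / K + har m <= cK + 2 * xK)%R.
Proof.
move=> mk; have KK := K2; rewrite x2E.
have p : (0 < / (K + 1))%R by apply: Rinv_0_lt_compat; lra.
case: (posnP m) => [->|mp].
  rewrite [INR 0]/= [har 0]/=.
  have -> : (2 * (K - 0) / K + 0 = 2)%R by field; lra.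
  case: k2or3 => [/K_case2 ->|k3]; first by have := cK_2; lra.
  by have := cK_3 k3; lra.
case: k2or3 => [k2'|k3].
  have -> : m = 1 by lia.
  by rewrite K_case2 // [har 1]/= [INR 1]/=; have := cK_2; lra.
have := ineqB' mp k3; have := inv_small k3; lra.
Qed.

(** Price [3 / (2 K)], from two consecutive untouched sites: a single deposit suffices. *)
Lemma ineqC m : 0 < m < k -> (3 * (K - INR m) / (2 * K) + har m <= cK + xK)%R.
Proof.
case/andP=> mp mk; have KK := K2; have xp := xK_pos.
case: k2or3 => [k2'|k3].
  have -> : m = 1 by lia.
  have := xK_eq; rewrite K_case2 // [har 1]/= [INR 1]/=; have := cK_2; lra.
have := ineqA mk.
suff : (3 * (K - INR m) / (2 * K) <= 2 * (K - INR m) / (K + 1))%R by lra.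
have q : (INR m <= K)%R by apply: le_INR; lia.
apply: (Rmult_le_reg_r (2 * K * (K + 1))); first by nra.
have -> : (3 * (K - INR m) / (2 * K) * (2 * K * (K + 1)) = 3 * (K - INR m) * (K + 1))%R by field; lra.
have -> : (2 * (K - INR m) / (K + 1) * (2 * K * (K + 1)) = 4 * (K - INR m) * K)%R by field; lra.
nra.
Qed.

(** For a touched site whose last [j] vertices get covered and which then makes up to two deposits.
    The price [2 / (K + j)] is at most [1 / j], so [j - 1] vertices are paid by the terms of [har j]
    after the first; the first term, 1, pays [3 / (K + 1)], the price of the remaining vertex and
    both deposits. *)
Lemma ineqE j : 0 < j < k -> (2 * INR j / (K + INR j) <= har j - 2 * xK)%R.
Proof.
case/andP=> jp jk; have KK := K2; rewrite x2E.
have lj : (INR j + 1 <= K)%R by rewrite -INRS; apply: le_INR; lia.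
have j1 : (1 <= INR j)%R by have := le_INR 1 j; rewrite /=; apply; lia.
have D := @har_diff j 1 jp; rewrite [har 1]/= [INR 1]/= in D.
have i1 : (0 < / (K + 1))%R by apply: Rinv_0_lt_compat; lra.
have i2 : (/ (K + INR j) <= / (K + 1))%R by apply: Rinv_le_contravar; lra.
have i3 : (/ (K + 1) <= / 3)%R by apply: Rinv_le_contravar; lra.
have i4 : ((INR j - 1) * (2 * / (K + INR j)) <= (INR j - 1) * / INR j)%R.
  apply: Rmult_le_compat_l; first lra.
  have -> : (2 * / (K + INR j) = / ((K + INR j) / 2))%R by field; lra.
  apply: Rinv_le_contravar; lra.
have -> : (2 * INR j / (K + INR j) = (INR j - 1) * (2 * / (K + INR j)) + 2 * / (K + INR j))%R by field; lra.
lra.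
Qed.

(** For an untouched site covered entirely by one move, which then makes one deposit, or two in
    [ineqD2]. *)
Lemma ineqD1 : (3 / 2 <= cK - xK)%R.
Proof. have := cK_2; have := xK_le; lra. Qed.
Lemma ineqD2 : (4 / 3 <= cK - 2 * xK)%R.
Proof. have := cK_2; have := xK_le; lra. Qed.

(** For a site that meets an earlier one: it has at most [K - 1] own vertices, its initial value is
    lower by [xK], and it deposits [xK] on its right link when it runs out. [ineqN1] is the case
    without deposit. *)
Lemma ineqN2 : (2 * (K - 1) / K <= cK - 2 * xK)%R.
Proof.
have KK := K2; have xl := xK_le.
have -> : (2 * (K - 1) / K = 2 - 2 / K)%R by field; lra.
have p : (/ (K + 1) <= / K)%R by apply: Rinv_le_contravar; lra.
have p2 : (0 < / (K + 1))%R by apply: Rinv_0_lt_compat; lra.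
case: k2or3 => [/K_case2 ->|k3]; first by have := cK_2; lra.
have := cK_3 k3; rewrite x2E /Rdiv; lra.
Qed.

Lemma ineqN1 a m : m <= a -> a < k -> (2 * (INR a - INR m) / K + har m <= cK - xK)%R.
Proof.
move=> ma ak; have KK := K2; have xp := xK_pos.
have la : (INR a + 1 <= K)%R by rewrite -INRS; apply: le_INR; lia.
have ik : (0 < / K)%R by apply: Rinv_0_lt_compat; lra.
have H : (2 * (INR a - INR m) / K <= 2 * (K - 1 - INR m) / K)%R.
  by rewrite /Rdiv; apply: Rmult_le_compat_r; lra.
case: (posnP m) => [m0|mp].
  move: H; rewrite m0 [INR 0]/= [har 0]/= !Rminus_0_r; have := ineqN2; lra.
case: k2or3 => [k2'|k3].
  have [-> ->] : m = 1 /\ a = 1 by lia.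
  by rewrite [har 1]/= [INR 1]/=; have := ineqD1; lra.
have := ineqB' mp k3.
have -> : (2 * (K - INR m) / K = 2 * (K - 1 - INR m) / K + 2 / K)%R by field; lra.
have p : (/ (K + 1) <= / K)%R by apply: Rinv_le_contravar; lra.
have := x2E; rewrite /Rdiv in H *; lra.
Qed.

End Constants.

(** * The drop of the potential at a single site *)

Section LocalDrop.
Variable k : nat.
Hypothesis k2 : 2 <= k.
Local Notation K := (INR k).
Local Notation c := (cK k).
Local Notation x := (xK k).

(* A site is a pair (untouched?, number of its own vertices still uncovered). *)
Definition site := (bool * nat)%type.
(** A deposit held for the untouched end of a link, whose other end can no longer contribute
    vertices to a competing move. *)
Definition chg (F : bool) (a b : site) : R :=
  if F && (a.1 && ~~ b.1 && (b.2 == 0) || ~~ a.1 && (a.2 == 0) && b.1) then x else 0%R.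
(** [F] says that the site is disjoint from all earlier ones, [FR] that the same holds for its right
    neighbour. Without a right link an untouched site owns an [x], as if an exhausted neighbour had
    deposited it; the [- x] of the first site of a run of links balances the [+ x] of its last. *)
Definition base (F FR : bool) (a : site) : R :=
  if a.1 then ((if F then c else c - x) + (if FR then 0 else x))%R else har a.2.

Lemma rate_le (e p q d : R) : (0 < p)%R -> (0 <= d)%R -> (p * e <= q)%R -> (d * e <= q * d / p)%R.
Proof.
move=> p0 d0 H; have -> : (q * d / p = d * (q * / p))%R by rewrite /Rdiv; ring.
apply: Rmult_le_compat_l => //; apply: (Rmult_le_reg_l p) => //.
by have -> : (p * (q * / p) = q)%R by field; lra.
Qed.

Local Ltac bsimp := rewrite /= ?andbF ?andbT ?orbF /= ?andbF ?andbT ?orbF /=.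

(** [e] is the cost per newly covered vertex of the chosen move. Sites are updated from left to
    right, so the left neighbour enters with its new state [bL] and the right one with its old state
    [aR]. Each upper bound involving [e] says that one, two or three consecutive sites are not a
    better move: the vertices they offer, times [e], cost at most their number, plus one if all are
    untouched. *)
Lemma local_drop (F FR : bool) (aL bL a b aR : site) (e : R) :
  (0 < e)%R ->
  b.2 <= a.2 -> (b.1 -> a.1) -> (a.1 -> b.1 -> a.2 = b.2) ->
  (~~ aL.1 -> ~~ bL.1 /\ bL.2 <= aL.2) -> (bL.1 -> aL.1) ->
  (a.1 -> F -> a.2 = k) -> (~~ b.1 -> b.2 < k) -> (~~ F -> a.2 < k) -> (~~ a.1 -> a.2 < k) ->
  (~~ a.1 -> INR a.2 * e <= 1)%R ->
  (a.1 -> K * e <= 2)%R ->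
  (~~ a.1 -> FR -> aR.1 -> (K + INR a.2) * e <= 2)%R ->
  (~~ a.1 -> F -> aL.1 -> (K + INR a.2) * e <= 2)%R ->
  (a.1 -> F -> ~~ aL.1 -> (K + INR aL.2) * e <= 2)%R ->
  (a.1 -> F -> FR -> ~~ aR.1 -> (K + INR aR.2) * e <= 2)%R ->
  (a.1 -> F -> aL.1 -> 2 * K * e <= 3)%R ->
  (a.1 -> F -> FR -> aR.1 -> 2 * K * e <= 3)%R ->
  (a.1 -> F -> aL.1 -> FR -> aR.1 -> 3 * K * e <= 4)%R ->
  (a.1 -> F -> ~~ aL.1 -> FR -> aR.1 -> (2 * K + INR aL.2) * e <= 3)%R ->
  (a.1 -> F -> aL.1 -> FR -> ~~ aR.1 -> (2 * K + INR aR.2) * e <= 3)%R ->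
  ((INR a.2 - INR b.2) * e <=
   base F FR a - base F FR b + (chg F bL a - chg F bL b) + (chg FR a aR - chg FR b aR))%R.
Proof.
case: aL bL a b aR => [uL rL0] [uL' rL] [ua ra] [ub rb] [uR rR] /=.
move=> e0 rba uba eqab mL mL' rak rbk ranf rat h1 h2 h5r h5l hl hr hll hrr h3 hlr hrl.
have KK := K2 k2; have xp := xK_pos k2.
have rb0 := INR_ge0 rb; have ra0 := INR_ge0 ra.
have rle : (INR rb <= INR ra)%R by apply: le_INR; lia.
have one r : 0 < r -> (1 <= INR r)%R by move=> r0; have := le_INR 1 r; rewrite /=; apply; lia.
case: ua uba eqab rak rat h1 h2 h5r h5l hl hr hll hrr h3 hlr hrl => /= uba eqab rak rat h1 h2 h5r h5l hl hr hll hrr h3 hlr hrl; last first.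
  (* A touched site: the harmonic decrease pays for the covered vertices, and [ineqE] also for the
     deposits if no vertex is left. *)
  have -> : ub = false by case: (ub) uba => // H; have := H isT.
  have {}rat := rat isT; have {}h1 := h1 isT.
  case: (ltngtP rb ra) rba => // [lt _|-> _]; last by lra.
  have D := har_diff (ltnW lt).
  have ra1 := one ra ltac:(lia).
  have S : ((INR ra - INR rb) * e <= har ra - har rb)%R.
    apply: Rle_trans D.
    have := @rate_le e (INR ra) 1 (INR ra - INR rb); rewrite /Rdiv => H.
    by have := H ltac:(lra) ltac:(lra) h1; lra.
  rewrite /base /chg /= ?andbF /=.
  have ran0 : (ra == 0) = false by lia.
  rewrite ran0 ?andbF /= ?andbF /=.
  case: (posnP rb) => rbp; last first.
    by bsimp; lra.
  rewrite rbp [har 0]/= [INR 0]/= Rminus_0_r in S *.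
  have EE := @ineqE k k2 ra ltac:(lia).
  have T : ((K + INR ra) * e <= 2)%R -> (INR ra * e <= har ra - 2 * x)%R.
    move=> H; have := @rate_le e (K + INR ra) 2 (INR ra) ltac:(lra) ltac:(lra) H; lra.
  case: F h5l {ranf rak hl hll hrr h3 hlr hrl hr} => /= h5l.
    case: uL' {mL} mL' => /= mL'.
      have := T (h5l isT isT (mL' isT)); do ?case: ifP => _; lra.
    case: FR h5r => /= h5r; last by do ?case: ifP => _; lra.
    case: uR h5r => /= h5r; last by rewrite ?andbF /=; lra.
    by have := T (h5r isT isT isT); rewrite ?andbF /=; lra.
  case: FR h5r => /= h5r; last by lra.
  case: uR h5r => /= h5r; last by lra.
  by have := T (h5r isT isT isT); lra.
have {}h2 := h2 isT.
case: ub eqab uba rbk => /= eqab uba rbk.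
  by rewrite (eqab isT isT); lra.
have {}rbk := rbk isT.
have rbK : (INR rb <= K)%R by apply: le_INR; lia.
case: F rak ranf h5l hl hr hll hrr h3 hlr hrl => /= rak ranf h5l hl hr hll hrr h3 hlr hrl; last first.
  (* A site that meets an earlier one: fewer than [k] own vertices and no left link. *)
  have {}ranf := ranf isT.
  have Q : ((INR ra - INR rb) * e <= c - x - har rb)%R.
    have := @ineqN1 k k2 ra rb rba ranf.
    by have := @rate_le e K 2 (INR ra - INR rb) ltac:(lra) ltac:(lra) h2; lra.
  have lra_ : (INR ra + 1 <= K)%R by rewrite -INRS; apply: le_INR; lia.
  have Q0 : (INR ra * e <= c - 2 * x)%R.
    have := ineqN2 k2.
    have := @rate_le e K 2 (K - 1) ltac:(lra) ltac:(lra) h2.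
    by have : (INR ra * e <= (K - 1) * e)%R by [apply: Rmult_le_compat_r; lra]; lra.
  rewrite /base /chg /=.
  case: FR {h5r hr hrr h3 hlr hrl} => /=; last by lra.
  case: uR => /=; case: (rb =P 0) => [E|_]; rewrite ?orbF /= ?andbF /=.
  - by rewrite E [har 0]/= [INR 0]/= Rminus_0_r; lra.
  - by lra.
  - by do ?case: ifP => _; lra.
  - by do ?case: ifP => _; lra.
rewrite (rak isT isT) {h5l}; rewrite /base /chg /=.
have d0 : (0 <= K - INR rb)%R by lra.
(* Prices for a full site that becomes touched: [QA] needs no deposit, [QC] uses one and [QB] two.
   [QG] and [QH] reduce longer segments to the price of [QA]. *)
have QA : ((K + 1) * e <= 2)%R -> ((K - INR rb) * e + har rb <= c)%R.
  by move=> H; have := @rate_le e (K + 1) 2 (K - INR rb) ltac:(lra) d0 H; have := ineqA k2 rbk; lra.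
have QB : ((K - INR rb) * e + har rb <= c + 2 * x)%R.
  by have := @rate_le e K 2 (K - INR rb) ltac:(lra) d0 h2; have := ineqB k2 rbk; lra.
have QC : 0 < rb -> (2 * K * e <= 3)%R -> ((K - INR rb) * e + har rb <= c + x)%R.
  move=> rb1 H; have := @rate_le e (2 * K) 3 (K - INR rb) ltac:(lra) d0 H.
  by have := @ineqC k k2 rb ltac:(lia); lra.
have QG : ((2 * K + 1) * e <= 3)%R -> ((K + 1) * e <= 2)%R by nra.
have QH : (3 * K * e <= 4)%R -> ((K + 1) * e <= 2)%R by nra.
have D1 := ineqD1 k2; have D2 := ineqD2 k2.
have zL : ~~ uL -> rL0 = 0 -> uL' = false /\ rL = 0.
  by move=> H E; have [] := mL H; rewrite E; case: (uL') => // _; lia.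
have tL : ~~ uL -> uL' = false by move=> H; have [] := mL H; case: (uL').
have one' r : r != 0 -> (1 <= INR r)%R by move=> H; apply: one; lia.
have mono p r q (ee := e) : (1 <= INR r)%R -> ((p + INR r) * e <= q)%R -> ((p + 1) * e <= q)%R by nra.
case: FR h5r hr hrr h3 hlr hrl => /= h5r hr hrr h3 hlr hrl; last first.
  (* right end of a block: behaves as a completely covered neighbour *)
  case: uL mL' zL tL hl hll {hlr hrl h3 mL} => /= mL' zL tL hl hll.
    case: (posnP rb) => rbp.
      rewrite rbp; bsimp; rewrite Rminus_0_r.
      by have := hll isT isT isT; do ?case: ifP => _; lra.
    have := QC rbp (hll isT isT isT).
    by bsimp; do ?case: ifP => _; lra.
  rewrite (tL isT) /= ?andbF ?andbT /=.
  case: (rL0 =P 0) => [E|/eqP E]; first by have [_ ->] := zL isT E; rewrite /=; lra.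
  have := QA (mono _ _ _ (one' _ E) (hl isT isT isT)).
  by do ?case: ifP => _; lra.
case: uR {h5r} hr hrr h3 hlr hrl => /= hr hrr h3 hlr hrl; last first.
  case: uL mL' zL tL hl hll {hlr h3 mL} hrl => /= mL' zL tL hl hll hrl.
    case: (posnP rb) => rbp.
      rewrite rbp; bsimp; rewrite Rminus_0_r.
      by have := hll isT isT isT; do ?case: ifP => _; lra.
    bsimp.
    case: (rR =P 0) => [E|/eqP E].
      by have := QC rbp (hll isT isT isT); do ?case: ifP => _; lra.
    by have := QA (QG (mono _ _ _ (one' _ E) (hrl isT isT isT isT isT))); do ?case: ifP => _; lra.
  rewrite (tL isT) /= ?andbF ?andbT /=.
  case: (rL0 =P 0) => [E|/eqP E].
    have [_ ->] := zL isT E; rewrite /=.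
    case: (rR =P 0) => [E'|/eqP E'] /=; first by lra.
    by have := QA (mono _ _ _ (one' _ E') (hr isT isT isT isT)); lra.
  by have := QA (mono _ _ _ (one' _ E) (hl isT isT isT)); do ?case: ifP => _; lra.
case: uL mL' zL tL hl hll {mL} h3 hlr hrl => /= mL' zL tL hl hll h3 hlr hrl.
  have H3 := h3 isT isT isT isT isT.
  case: (posnP rb) => rbp.
    rewrite rbp; bsimp; rewrite Rminus_0_r.
    by do ?case: ifP => _; lra.
  by bsimp; have := QA (QH H3); do ?case: ifP => _; lra.
rewrite (tL isT) /= ?andbF ?andbT /=.
have H2 := hrr isT isT isT isT.
case: (rL0 =P 0) => [E|/eqP E].
  have [_ ->] := zL isT E; rewrite /=.
  case: (posnP rb) => rbp.
    by rewrite rbp; bsimp; rewrite Rminus_0_r; lra.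
  by have := QC rbp H2; lra.
have H := QG (mono _ _ _ (one' _ E) (hlr isT isT isT isT isT)).
case: (posnP rb) => rbp.
  rewrite rbp; bsimp; rewrite Rminus_0_r.
  by do ?case: ifP => _; lra.
by have := QA H; do ?case: ifP => _; lra.
Qed.

End LocalDrop.

(** * The potential of an optimal walk *)

Section Moves.
Variables (n : nat) (E : {set {set 'I_n}}).
Implicit Types (S : {set 'I_n}) (p : seq {set 'I_n}).

Definition jpath p := [/\ 0 < size p <= 4, {subset p <= E} &
  forall i, i.+1 < size p -> adjacent E (nth set0 p i) (nth set0 p i.+1)].
Definition ucov p : {set 'I_n} := \bigcup_(e <- p) e.

Lemma ucovP (x : 'I_n) p : reflect (exists2 e, e \in p & x \in e) (x \in ucov p).
Proof.
rewrite /ucov; elim: p => [|e p IH].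
  by rewrite big_nil inE; constructor => -[].
rewrite big_cons inE; apply: (iffP orP) => [[xe|/IH[e' ep xe]]|[e']].
- by exists e; rewrite ?mem_head.
- by exists e' => //; rewrite inE ep orbT.
- by rewrite inE => /orP[/eqP->|ep] xe; [left|right; apply/IH; exists e'].
Qed.

Definition touches S (e : {set 'I_n}) := ~~ [disjoint e & S].
Definition mcost S p := size p + ~~ has (touches S) p.
Definition gain S p := #|ucov p :\: S|.

(** [g] bounds the gain from below and [c] the cost from above, because the program tests only such
    one-sided conditions; no competitor has a ratio above [g / c]. *)
Definition best S p g c := [/\ jpath p, 0 < g <= gain S p, mcost S p <= c &
  forall p', jpath p' -> gain S p' * c <= g * mcost S p'].

Lemma mcost_gt0 S p : jpath p -> 0 < mcost S p.
Proof. by case=> /andP[p0 _] _ _; rewrite /mcost addn_gt0 p0. Qed.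
End Moves.

Section Potential.
Variables (n : nat) (E : {set {set 'I_n}}) (k h : nat) (o : nat -> {set 'I_n}).
Hypothesis k2 : 2 <= k.
Hypothesis oE : forall t, t <= h -> o t \in E.
Hypothesis ok : forall t, t <= h -> #|o t| = k.
Hypothesis oadj : forall t, t < h -> adjacent E (o t) (o t.+1).
Hypothesis ospan : forall x, exists2 t, t <= h & x \in o t.
Implicit Types (S : {set 'I_n}).

(** Each vertex is assigned to the site where the walk first meets it, so that none is paid for
    twice. *)
Definition own t : {set 'I_n} := o t :\: \bigcup_(s < t) o s.
Definition full t := (0 < t) && (own t == o t).
Definition st S t : site := ([disjoint o t & S], #|own t :\: S|).
Definition linkR t := (t < h) && full t.+1.

Fixpoint rsum (f : nat -> R) m : R := if m is m'.+1 then (rsum f m' + f m)%R else 0%R.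

(** The sum runs over the sites 1 to [h]; site 0 is the initial hyperedge and enters only through
    its link to site 1. *)
Definition Phi S : R := rsum (fun t =>
  (base k (full t) (linkR t) (st S t) + chg k (full t) (st S t.-1) (st S t))%R) h.

Lemma rsum_le f g m : (forall t, 0 < t <= m -> (f t <= g t)%R) -> (rsum f m <= rsum g m)%R.
Proof.
elim: m => [|m IH] H /=; first by lra.
have := H m.+1 ltac:(lia); have : (rsum f m <= rsum g m)%R by apply: IH => t tm; apply: H; lia.
lra.
Qed.

Lemma rsum_scal f e m : rsum (fun t => (f t * e)%R) m = (rsum f m * e)%R.
Proof. by elim: m => [|m IH] /=; rewrite ?IH; ring. Qed.

Lemma own_sub t : own t \subset o t. Proof. exact: subsetDl. Qed.

Lemma own_disj s t : s < t -> [disjoint o s & own t].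
Proof.
move=> st; rewrite disjoint_sym disjoint_subset; apply/subsetP => x; rewrite !inE => /andP[H _].
by apply: contra H => xs; apply/bigcupP; exists (Ordinal st).
Qed.

Lemma own_full t : full t -> own t = o t. Proof. by case/andP=> _ /eqP. Qed.

Lemma own_lt t : 0 < t <= h -> ~~ full t -> #|own t| < k.
Proof.
case/andP=> t0 th; rewrite /full t0 /= => nf; rewrite -(ok th).
by apply: proper_card; rewrite properEneq nf own_sub.
Qed.

(** The first visit to a vertex of [D] does not happen at time 0, since [D] avoids [o 0]. *)
Lemma own_cover (D : {set 'I_n}) : [disjoint o 0 & D] -> D \subset \bigcup_(i < h) own i.+1.
Proof.
move=> d0; apply/subsetP => x xD.
have [t th xt] := ospan x.
have ex : exists t, (t <= h) && (x \in o t) by exists t; rewrite th xt.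
case: (ex_minnP ex) => m /andP[mh xm] mn.
case: m mh xm mn => [|m] mh xm mn.
  by move: d0; rewrite disjoint_subset => /subsetP/(_ x xm); rewrite inE xD.
apply/bigcupP; exists (Ordinal mh) => //=; rewrite !inE xm andbT.
apply/bigcupP => -[s _ xs]; have sm := ltn_ord s.
have := mn s; rewrite xs andbT => H; have := H ltac:(lia); lia.
Qed.

Lemma disj_card (S A : {set 'I_n}) : [disjoint A & S] -> #|A :\: S| = #|A|.
Proof. by move=> /setDidPl ->. Qed.

Lemma seg_jpath s m : m <= 2 -> s + m <= h -> jpath E (map o (iota s m.+1)).
Proof.
move=> m2 sm; split.
- by rewrite size_map size_iota; lia.
- by move=> e /mapP[t]; rewrite mem_iota => tt ->; apply: oE; lia.
- move=> i; rewrite size_map size_iota => im.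
  rewrite !(nth_map 0) ?size_iota; try lia.
  by rewrite !nth_iota ?addnS; [apply: oadj| |]; lia.
Qed.

(** Own vertices of a site lie in no earlier hyperedge, so they add to what the preceding part of
    the segment covers; only the first hyperedge counts with all its vertices. *)
Lemma seg_gain S s m : #|o s :\: S| + \sum_(i < m) #|own (s + i.+1) :\: S| <= gain S (map o (iota s m.+1)).
Proof.
elim: m => [|m IH]; rewrite /gain /ucov.
  by rewrite big_ord0 addn0 /= big_seq1.
have E1 : iota s m.+2 = rcons (iota s m.+1) (s + m.+1).
  by rewrite -[in LHS](addn1 m.+1) iotaD -cats1.
pose A := ucov (map o (iota s m.+1)).
have -> : \bigcup_(e <- map o (iota s m.+2)) e = A :|: o (s + m.+1).
  by rewrite E1 map_rcons -cats1 big_cat big_seq1.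
rewrite big_ord_recr addnA.
apply: (@leq_trans (#|A :\: S| + #|own (s + m.+1) :\: S|)).
  by rewrite leq_add2r; exact: IH.
rewrite -cardsUI.
have -> : (A :\: S) :&: (own (s + m.+1) :\: S) = set0.
  apply/setP => x; rewrite !inE; apply/negP => /andP[/andP[_ /ucovP[e /mapP[t]]]].
  rewrite mem_iota => tm -> xt /andP[_ /andP[H _]].
  case/negP: H; apply/bigcupP; have lt : t < s + m.+1 by lia.
  by exists (Ordinal lt).
rewrite cards0 addn0; apply: subset_leq_card; rewrite setDUl.
by apply: setUS; apply: setSD; exact: own_sub.
Qed.

Lemma st0 S1 : o 0 \subset S1 -> st S1 0 = (false, 0).
Proof.
move=> H; congr pair; last first.
  by apply/eqP; rewrite cards_eq0 setD_eq0; apply: subset_trans (own_sub 0) H.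
apply/negP => /disjoint_setI0 E0.
have : o 0 = set0 by rewrite -E0; apply/esym/setIidPl.
by move=> E1; have := ok (leq0n h); rewrite E1 cards0; lia.
Qed.

Lemma touched_rem S1 t : 0 < t <= h -> ~~ (st S1 t).1 -> (st S1 t).2 < k.
Proof.
move=> /andP[t0 th] u; rewrite -(ok th); apply: leq_ltn_trans (_ : #|o t :\: S1| < _).
  by apply: subset_leq_card; apply: setSD; exact: own_sub.
apply: proper_card; rewrite properEneq subsetDl andbT.
by apply: contra u => /eqP/setDidPl.
Qed.

(** * Comparison of a move with segments of the walk *)

Section Drop.
Variables (S D : {set 'I_n}) (e : R).
Hypothesis S0 : o 0 \subset S.
Hypothesis e0 : (0 < e)%R.
Hypothesis dens : forall p, jpath E p -> (INR (gain S p) * e <= INR (mcost S p))%R.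
Hypothesis DS : [disjoint D & S].

Let a t := st S t.
Let b t := st (S :|: D) t.

Lemma st_mono t : (b t).2 <= (a t).2 /\ ((b t).1 -> (a t).1).
Proof.
split; first by apply: subset_leq_card; apply: setDS; exact: subsetUl.
by apply: disjointWr; exact: subsetUl.
Qed.

Lemma seg_rate s m r : m <= 2 -> s + m <= h -> (r <= #|o s :\: S| + \sum_(i < m) (a (s + i.+1)).2) ->
  (INR r * e <= INR (m.+1 + ~~ has (fun t => ~~ (a t).1) (iota s m.+1)))%R.
Proof.
move=> m2 sm rl.
have := dens (seg_jpath m2 sm); rewrite /mcost size_map size_iota has_map.
have -> : has (preim o (touches S)) (iota s m.+1) = has (fun t => ~~ (a t).1) (iota s m.+1) by [].
apply: Rle_trans; apply: Rmult_le_compat_r; first lra.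
apply: le_INR; apply/leP; exact: leq_trans rl (seg_gain _ _ _).
Qed.

Lemma untouched_card t : t <= h -> (a t).1 -> #|o t :\: S| = k.
Proof. by move=> th u; rewrite disj_card // ok. Qed.

Lemma rem_le_card t : (a t).2 <= #|o t :\: S|.
Proof. by apply: subset_leq_card; apply: setSD; exact: own_sub. Qed.

Lemma untouched_full t : t <= h -> (a t).1 -> full t -> (a t).2 = k.
Proof. by move=> th u f; rewrite /a /st /= own_full // untouched_card. Qed.

(** The bounds on [e] required by [local_drop] come from the segments of one to three sites around
    [t], which are admissible moves and hence not denser than the chosen one. *)
Lemma site_drop t : 0 < t <= h ->
  ((INR (a t).2 - INR (b t).2) * e <=
   base k (full t) (linkR t) (a t) - base k (full t) (linkR t) (b t)
   + (chg k (full t) (b t.-1) (a t) - chg k (full t) (b t.-1) (b t))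
   + (chg k (linkR t) (a t) (a t.+1) - chg k (linkR t) (b t) (a t.+1)))%R.
Proof.
case/andP=> t0 th.
have [m1 m2] := st_mono t; have [m3 m4] := st_mono t.-1.
have Et : t = t.-1.+1 by lia.
have tp : t.-1 <= h by lia.
(* A segment of [m + 1] hyperedges costs [m + 2] in any case, and [m + 1] if one of them is
   touched. *)
have R1 r m s : m <= 2 -> s + m <= h -> r <= #|o s :\: S| + \sum_(i < m) (a (s + i.+1)).2 ->
   (INR r * e <= INR m + 2)%R /\
   (forall t', s <= t' <= s + m -> ~~ (a t').1 -> (INR r * e <= INR m + 1)%R).
  move=> q1 q2 q3; have := seg_rate q1 q2 q3; rewrite plus_INR INRS.
  case Eh: has; rewrite [INR (nat_of_bool _)]/= => H; split; try lra; first by move=> *; lra.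
  move=> t' tt ut; case: (negP (negbT Eh)); apply/hasP; exists t' => //.
  by rewrite mem_iota; lia.
have s2 : \sum_(i < 2) (a (t.-1 + i.+1)).2 = (a t).2 + (a t.+1).2.
  rewrite big_ord_recl big_ord1 addn1 -Et; congr (_ + (a _).2).
  by rewrite lift0 /=; lia.
have i0 : INR 0 = 0%R by []; have i1 : INR 1 = 1%R by [].
have i2 : INR 2 = 2%R by rewrite /=; lra.
apply: (local_drop k2 (aL := a t.-1)) => //.
- move=> u u'; rewrite /a /b /st /=.
  by rewrite (disj_card (disjointWl (own_sub t) u)) (disj_card (disjointWl (own_sub t) u')).
- by move=> u; split=> //; apply: contra u => /m4.
- by move=> u f; exact: untouched_full.
- by move=> u; apply: touched_rem => //; rewrite t0.
- move=> nf; apply: leq_ltn_trans (own_lt (t := t) _ nf); last by rewrite t0.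
  by apply: subset_leq_card; exact: subsetDl.
- by move=> u; apply: touched_rem => //; rewrite t0.
- move=> u; have [||_ H] := R1 (a t).2 0 t isT; rewrite ?addn0 //.
    by rewrite big_ord0 addn0 rem_le_card.
  by have := H t ltac:(lia) u; lra.
- move=> u; have [||H _] := R1 k 0 t isT; rewrite ?addn0 //.
    by rewrite big_ord0 addn0 untouched_card.
  by lra.
- move=> u /andP[th1 f] uR.
  have [||_ H] := R1 (k + (a t).2) 1 t isT; rewrite ?addn1 //.
    by rewrite big_ord1 addn1 (untouched_full th1 uR f) addnC leq_add2r rem_le_card.
  by have := H t ltac:(lia) u; rewrite plus_INR; lra.
- move=> u f uL.
  have [||_ H] := R1 (k + (a t).2) 1 t.-1 isT; rewrite ?addn1 -?Et //.
    by rewrite big_ord1 addn1 -Et untouched_card.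
  by have := H t ltac:(lia) u; rewrite plus_INR; lra.
- move=> u f uL.
  have [||_ H] := R1 (k + (a t.-1).2) 1 t.-1 isT; rewrite ?addn1 -?Et //.
    by rewrite big_ord1 addn1 -Et (untouched_full th u f) addnC leq_add2r rem_le_card.
  by have := H t.-1 ltac:(lia) uL; rewrite plus_INR; lra.
- move=> u f /andP[th1 f'] uR.
  have [||_ H] := R1 (k + (a t.+1).2) 1 t isT; rewrite ?addn1 //.
    by rewrite big_ord1 addn1 untouched_card.
  by have := H t.+1 ltac:(lia) uR; rewrite plus_INR; lra.
- move=> u f uL.
  have [||H _] := R1 (k + k) 1 t.-1 isT; rewrite ?addn1 -?Et //.
    by rewrite big_ord1 addn1 -Et (untouched_full th u f) untouched_card.
  by move: H; rewrite plus_INR; lra.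
- move=> u f /andP[th1 f'] uR.
  have [||H _] := R1 (k + k) 1 t isT; rewrite ?addn1 //.
    by rewrite big_ord1 addn1 (untouched_full th1 uR f') untouched_card.
  by move: H; rewrite plus_INR; lra.
- move=> u f uL /andP[th1 f'] uR.
  have [||H _] := R1 (k + (k + k)) 2 t.-1 isT; rewrite ?addn2 -?Et //.
    rewrite s2.
    by rewrite (untouched_full th u f) (untouched_full th1 uR f') untouched_card.
  by move: H; rewrite !plus_INR; lra.
- move=> u f uL /andP[th1 f'] uR.
  have [||_ H] := R1 (k + k + (a t.-1).2) 2 t.-1 isT; rewrite ?addn2 -?Et //.
    rewrite s2.
    rewrite (untouched_full th u f) (untouched_full th1 uR f') addnC leq_add2r.
    exact: rem_le_card.
  by have := H t.-1 ltac:(lia) uL; rewrite !plus_INR; lra.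
- move=> u f uL /andP[th1 f'] uR.
  have [||_ H] := R1 (k + k + (a t.+1).2) 2 t.-1 isT; rewrite ?addn2 -?Et //.
    rewrite s2.
    by rewrite (untouched_full th u f) untouched_card // addnA.
  by have := H t.+1 ltac:(lia) uR; rewrite !plus_INR; lra.
Qed.

Lemma Phi_drop : (INR #|D| * e <= Phi S - Phi (S :|: D))%R.
Proof.
have E0 : a 0 = b 0.
  by rewrite /a /b !st0 //; apply: subset_trans S0 (subsetUl _ _).
pose dd t := (base k (full t) (linkR t) (a t) - base k (full t) (linkR t) (b t)
   + (chg k (full t) (b t.-1) (a t) - chg k (full t) (b t.-1) (b t))
   + (chg k (linkR t) (a t) (a t.+1) - chg k (linkR t) (b t) (a t.+1)))%R.
pose ph (z : nat -> site) t := (base k (full t) (linkR t) (z t) + chg k (full t) (z t.-1) (z t))%R.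
(* With the sites updated one after another, only the link between [m] and [m.+1], half updated,
   fails to telescope; at [h] there is no right link and its term vanishes. *)
have tel m : m <= h -> rsum dd m = (rsum (ph a) m - rsum (ph b) m +
   (chg k (linkR m) (a m) (a m.+1) - chg k (linkR m) (b m) (a m.+1)))%R.
  elim: m => [|m IH] mh /=; first by rewrite E0; ring.
  rewrite IH ?(ltnW mh) // /dd /ph /=.
  have -> : linkR m = full m.+1 by rewrite /linkR mh.
  by ring.
have L : (rsum (fun t => (INR (a t).2 - INR (b t).2) * e) h <= rsum dd h)%R.
  by apply: rsum_le => t th; exact: site_drop.
have C : (INR #|D| <= rsum (fun t => INR (a t).2 - INR (b t).2) h)%R.
  have -> : rsum (fun t => INR (a t).2 - INR (b t).2)%R h = INR (\sum_(i < h) #|own i.+1 :&: D|).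
    elim: (h) => [|m IH] /=; first by rewrite big_ord0.
    rewrite IH big_ord_recr plus_INR; congr Rplus.
    rewrite /a /b /st /= -minus_INR; last first.
      by apply/leP; apply: subset_leq_card; apply: setDS; exact: subsetUl.
    congr INR; rewrite -(cardsID D (own m.+1 :\: S)) (setDDl (own m.+1) S D).
    have -> : (own m.+1 :\: S) :&: D = own m.+1 :&: D.
      apply/setP => y; rewrite !inE; case yD: (y \in D); rewrite ?andbF // !andbT.
      by rewrite (disjointFr DS yD).
    exact: addnK.
  apply: le_INR; apply/leP.
  have sub : D \subset \bigcup_(i < h) (own i.+1 :&: D).
    rewrite -big_distrl /= subsetI subxx andbT; apply: own_cover.
    by rewrite disjoint_sym; apply: disjointWr S0 DS.
  apply: leq_trans (subset_leq_card sub) _.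
  elim/big_rec2: _ => [|i m A _ IH]; first by rewrite cards0.
  by apply: leq_trans (leq_card_setU _ _) _; rewrite leq_add2l.
have F : linkR h = false by rewrite /linkR ltnn.
have z u v : chg k false u v = 0%R by [].
rewrite rsum_scal in L; rewrite tel // F !z in L.
change (INR #|D| * e <= rsum (ph a) h - rsum (ph b) h)%R.
have : (INR #|D| * e <= rsum (fun t => INR (a t).2 - INR (b t).2) h * e)%R.
  by apply: Rmult_le_compat_r; lra.
lra.
Qed.

End Drop.

Lemma best_drop S p g c : o 0 \subset S -> best E S p g c ->
  (INR c <= Phi S - Phi (S :|: ucov p))%R.
Proof.
move=> S0 [jp /andP[g0 gl] cl opt].
have c0 : 0 < c by apply: leq_trans cl; exact: mcost_gt0 jp.
have G0 : (0 < INR g)%R by apply: lt_0_INR; lia.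
have C0 : (0 < INR c)%R by apply: lt_0_INR; lia.
(* The price per vertex of the chosen move; its optimality is exactly the density hypothesis on all
   paths. *)
pose e := (INR c / INR g)%R.
have e0 : (0 < e)%R by apply: Rdiv_lt_0_compat.
have dens q : jpath E q -> (INR (gain S q) * e <= INR (mcost S q))%R.
  move=> jq; have := opt _ jq => /leP/le_INR; rewrite !mult_INR => H.
  apply: (Rmult_le_reg_r (INR g)) => //.
  have -> : (INR (gain S q) * e * INR g = INR (gain S q) * INR c)%R by rewrite /e; field; lra.
  lra.
have dis : [disjoint ucov p :\: S & S] by rewrite disjoint_subset; apply/subsetP => y; rewrite !inE => /andP[].
have := Phi_drop S0 e0 dens dis.
have -> : S :|: (ucov p :\: S) = S :|: ucov p.
  by apply/setP => x; rewrite !inE; case: (x \in S).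
have : (INR g * e <= INR #|ucov p :\: S| * e)%R.
  by apply: Rmult_le_compat_r; [lra|apply: le_INR; apply/leP].
have -> : (INR g * e = INR c)%R by rewrite /e; field; lra.
lra.
Qed.

Lemma chg_ge0 F u v : (0 <= chg k F u v)%R.
Proof. by rewrite /chg; have := xK_pos k2; case: ifP => _; lra. Qed.

Lemma Phi_ge0 S : (0 <= Phi S)%R.
Proof.
rewrite /Phi; elim: (h) => [|m IH] /=; first lra.
have := chg_ge0 (full m.+1) (st S m) (st S m.+1).
suff : (0 <= base k (full m.+1) (linkR m.+1) (st S m.+1))%R by lra.
rewrite /base; case: ifP => _; last exact: har_ge0.
have := xK_pos k2; have := ineqD1 k2; do 2!case: ifP => _; lra.
Qed.

(** The corrections [x] of a run of links cancel. What remains is one [x] for the end of the last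
    run and one for the run beginning at site 0, which contributes no [- x]. *)
Lemma Phi_init : (Phi (o 0) <= cK k * INR h + 2 * xK k)%R.
Proof.
have xp := xK_pos k2; have d1 := ineqD1 k2; have xl := xK_le k2.
pose z t := ~~ (st (o 0) t).1 && ((st (o 0) t).2 == 0).
have z0 : z 0 by rewrite /z st0.
pose f := fun t => (base k (full t) (linkR t) (st (o 0) t) + chg k (full t) (st (o 0) t.-1) (st (o 0) t))%R.
(* The subtracted term makes room for the deposit that an exhausted site [m] holds if [m.+1] is
   full, since a full site is disjoint from [o 0] and therefore untouched. *)
have step m : m <= h -> (rsum f m <= cK k * INR m + xK k + (if linkR m then 0 else xK k)
   - (if z m then xK k else 0))%R.
  elim: m => [|m IH] mh; first by rewrite z0 /=; case: ifP => _; lra.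
  have {}IH := IH (ltnW mh).
  have -> : rsum f m.+1 = (rsum f m + f m.+1)%R by [].
  rewrite INRS Rmult_plus_distr_l Rmult_1_r.
  have lm : linkR m = full m.+1 by rewrite /linkR mh.
  rewrite lm in IH; move: (rsum f m) IH => q IH; rewrite /f -pred_Sn.
  case fm: (full m.+1) IH => IH.
    have u : (st (o 0) m.+1).1 by rewrite /= disjoint_sym -(own_full fm); exact: own_disj.
    have zm : z m.+1 = false by rewrite /z u.
    rewrite zm /base /chg u andbF !andbT -/(z m) /=.
    by case: (z m) IH => IH; lra.
  have -> : chg k false (st (o 0) m) (st (o 0) m.+1) = 0%R by [].
  rewrite /base /z; case u: (st (o 0) m.+1).1.
    by rewrite /=; case: ifP IH => _ IH; lra.
  rewrite [~~ false]/= andTb.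
  have rk : (st (o 0) m.+1).2 < k by apply: touched_rem; rewrite ?u ?mh.
  case: ((st (o 0) m.+1).2 =P 0) => [->|_].
    by rewrite [har 0]/=; do 2!case: ifP IH => _ IH; do ?case: ifP => _; lra.
  have := @ineqN1 k k2 _ _ (leqnn (st (o 0) m.+1).2) rk.
  rewrite Rminus_diag /Rdiv Rmult_0_r Rmult_0_l Rplus_0_l => hl.
  by case: ifP IH => _ IH; do ?case: ifP => _; lra.
have := step h (leqnn h); rewrite -[rsum f h]/(Phi (o 0)).
by do 2!case: ifP => _; lra.
Qed.

End Potential.

(** * Positions in the encoded graph *)

Definition isbit (x : nat) := (x == 1) || (x == 2).

Lemma bin_bits m : all isbit (bin m).
Proof. by apply/allP => x /mapP[i _ ->]; rewrite /isbit; case: odd. Qed.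

Lemma size_bin m : size (bin m) = (trunc_log 2 m).+1.
Proof. by rewrite size_map size_iota. Qed.

Definition unbin (l : seq nat) := foldr (fun b acc => (b == 2) + 2 * acc) 0 l.

(** Little-endian binary: the first [L] digits determine the number modulo [2 ^ L]. *)
Lemma binK : cancel bin unbin.
Proof.
move=> m; rewrite /bin.
have H L p : unbin [seq (odd (p %/ 2 ^ i) : nat).+1 | i <- iota 0 L] = p %% 2 ^ L.
  elim: L p => [|L IH] p; first by rewrite /= modn1.
  have E1 : iota 1 L = map (addn 1) (iota 0 L) by rewrite -iotaDl.
  rewrite [iota 0 L.+1]/= map_cons [LHS]/= E1 -map_comp.
  have -> : [seq ((fun i => (odd (p %/ 2 ^ i) : nat).+1) \o addn 1) i | i <- iota 0 L]
     = [seq (odd (p %/ 2 %/ 2 ^ i) : nat).+1 | i <- iota 0 L].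
    by apply: eq_map => i /=; rewrite expnS divnMA.
  rewrite -/(unbin _) IH expn0 divn1 expnS.
  have -> : ((odd p : nat).+1 == 2) = odd p by case: odd.
  have q0 : 0 < 2 ^ L by rewrite expn_gt0.
  have E2 : p = odd p + 2 * (p %/ 2) by rewrite divn2 mul2n odd_double_half.
  have := divn_eq (p %/ 2) (2 ^ L) => E3.
  have lt := ltn_pmod (p %/ 2) q0.
  have Ep : p = p %/ 2 %/ 2 ^ L * (2 * 2 ^ L) + (odd p + 2 * ((p %/ 2) %% 2 ^ L)).
    by rewrite mulnCA mulnC -mulnA (mulnC 2) addnCA; lia.
  rewrite [RHS](congr1 (modn ^~ _) Ep) modnMDl [RHS]modn_small //.
  move: lt; move: ((p %/ 2) %% 2 ^ L)%N (2 ^ L)%N => v M; case: odd; rewrite /=; lia.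
by rewrite H modn_small // trunc_log_ltn.
Qed.

#[local] Opaque bin.

Definition enc_verts n (l : seq 'I_n) : seq nat := flatten [seq bin (val i) ++ [:: 3] | i <- l].

Lemma enc_verts_cons n (x : 'I_n) l : enc_verts (x :: l) = bin x ++ 3 :: enc_verts l.
Proof. by rewrite /enc_verts /= -catA. Qed.

Lemma enc_verts_cat n (l1 l2 : seq 'I_n) : enc_verts (l1 ++ l2) = enc_verts l1 ++ enc_verts l2.
Proof. by rewrite /enc_verts map_cat flatten_cat. Qed.

Lemma enc_edges_cons n (e : {set 'I_n}) l : enc_edges (e :: l) = enc_set e ++ 4 :: enc_edges l.
Proof. by rewrite /enc_edges /= -catA. Qed.

Lemma enc_edges_cat n (l1 l2 : seq {set 'I_n}) : enc_edges (l1 ++ l2) = enc_edges l1 ++ enc_edges l2.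
Proof. by rewrite /enc_edges map_cat flatten_cat. Qed.

Lemma last_enc_edges n (l : seq {set 'I_n}) : last 4 (enc_edges l) = 4.
Proof. by elim: l => // e l IH; rewrite enc_edges_cons last_cat. Qed.

Lemma enc_verts_no4 n (l : seq 'I_n) : 4 \notin enc_verts l.
Proof.
elim: l => // x l IH; rewrite enc_verts_cons mem_cat inE /= negb_or IH andbT.
by apply/negP => /(allP (bin_bits x)).
Qed.

(** Names and vertex separators contain no 4, so each 4 closes a hyperedge. *)
Lemma four_pos n (s : seq {set 'I_n}) i : nth 0 (enc_edges s) i = 4 ->
  exists s1 e s2, s = s1 ++ e :: s2 /\ i = size (enc_edges s1) + size (enc_set e).
Proof.
elim: s i => [|e s IH] i; first by rewrite nth_nil.
rewrite enc_edges_cons nth_cat; case: ltnP => li.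
  by move=> E; have := enc_verts_no4 (enum e); rewrite -E mem_nth.
case: (posnP (i - size (enc_set e))) => [i0|ip].
  by move=> _; exists [::], e, s; rewrite /= add0n; split=> //; lia.
rewrite -(prednK ip) /= => /IH[s1 [e' [s2 [-> E]]]].
exists (e :: s1), e', s2; split=> //; rewrite enc_edges_cons size_cat /=; lia.
Qed.

Lemma vert_pos n (l : seq 'I_n) q : isbit (nth 0 (enc_verts l) q) ->
  (0 < q -> ~~ isbit (nth 0 (enc_verts l) q.-1)) ->
  exists l1 x l2, l = l1 ++ x :: l2 /\ q = size (enc_verts l1).
Proof.
elim: l q => [|x l IH] q; first by rewrite nth_nil.
case: (posnP q) => [->|q0]; first by exists [::], x, l.
rewrite enc_verts_cons !nth_cat => b1 /(_ isT).
case: (ltnP q.-1 (size (bin x))) => l1.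
  by rewrite (allP (bin_bits x)) // mem_nth.
move: b1; have -> : q < size (bin x) = false by lia.
have Eq : q - size (bin x) = (q - size (bin x)).-1.+1 by lia.
rewrite Eq /= => b1 b2.
have [|l1' [y [l2 [-> E]]]] := IH _ b1.
  move=> p; move: b2; have -> : q.-1 - size (bin x) = (q - size (bin x)).-1.-1.+1 by lia.
  by [].
exists (x :: l1'), y, l2; split=> //; rewrite enc_verts_cons size_cat /=; lia.
Qed.

Lemma split_index (T : eqType) (s : seq T) y : y \in s ->
  s = take (index y s) s ++ y :: drop (index y s).+1 s.
Proof. by move=> ys; rewrite -drop_index // cat_take_drop. Qed.

Section Positions.
Variables (n : nat) (E : {set {set 'I_n}}).
Local Notation W := (enc_graph E).
Local Notation N := (size W).
Local Notation sym := (nth 0 W).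
Implicit Types (e : {set 'I_n}) (x : 'I_n).

Definition pre e := bin n ++ 4 :: enc_edges (take (index e (enum E)) (enum E)).
Definition epos e := size (pre e) + size (enc_set e).
Definition vpre e x := enc_verts (take (index x (enum e)) (enum e)).
Definition vpos e x := size (pre e) + size (vpre e x).

Lemma word_split e : e \in E -> exists r, W = pre e ++ enc_set e ++ 4 :: r.
Proof.
rewrite -mem_enum => eE; exists (enc_edges (drop (index e (enum E)).+1 (enum E))).
by rewrite /enc_graph [in LHS](split_index eE) enc_edges_cat enc_edges_cons /pre -!catA.
Qed.

Lemma set_split e x : x \in e -> exists r, enc_set e = vpre e x ++ bin x ++ 3 :: r.
Proof.
rewrite -mem_enum => xe; exists (enc_verts (drop (index x (enum e)).+1 (enum e))).
by rewrite -enc_verts_cons -enc_verts_cat -split_index.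
Qed.

Lemma sym_set e i : e \in E -> i < size (enc_set e) -> sym (size (pre e) + i) = nth 0 (enc_set e) i.
Proof.
by move=> /word_split[r ->] li; rewrite nth_cat ltnNge leq_addr /= addKn nth_cat li.
Qed.

Lemma sym_epos e : e \in E -> sym (epos e) = 4.
Proof.
move=> /word_split[r ->]; rewrite /epos nth_cat ltnNge leq_addr /= addKn nth_cat ltnn subnn //.
Qed.

Lemma epos_lt e : e \in E -> epos e < N.
Proof. by move=> /word_split[r ->]; rewrite /epos size_cat (size_cat (enc_set e)) ltn_add2l -[X in X < _]addn0 ltn_add2l. Qed.

Lemma pre_gt0 e : 0 < size (pre e).
Proof. by rewrite size_cat /=; lia. Qed.

Lemma sym_prev e : e \in E -> sym (size (pre e)).-1 = 4.
Proof.
move=> eE; case/word_split: (eE) => r ->; rewrite nth_cat.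
have p0 := pre_gt0 e; have -> : (size (pre e)).-1 < size (pre e) by lia.
rewrite nth_last.
have -> : last 0 (pre e) = last 4 (enc_edges (take (index e (enum E)) (enum E))) by rewrite last_cat.
by rewrite last_enc_edges.
Qed.

(** The first 4 of the word ends the number of vertices; every later one closes a hyperedge. *)
Lemma isblkP i : i < N -> reflect (exists2 e, e \in E & i = epos e)
  ((sym i == 4) && has (fun j => (sym j == 4) && (j < i)) (iota 0 N)).
Proof.
move=> iN; apply: (iffP andP) => [[/eqP s4 /hasP[j _ /andP[/eqP j4 ji]]]|[e eE ->]].
  have bl p : p < size (bin n) -> sym p <> 4.
    move=> pb; rewrite /enc_graph nth_cat pb => E4.
    by have := allP (bin_bits n) _ (mem_nth 0 pb); rewrite E4.
  have jb : size (bin n) <= j by case: ltnP => // /bl.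
  move: s4; rewrite /enc_graph nth_cat ifF; last by lia.
  have -> : i - size (bin n) = (i - (size (bin n)).+1).+1 by lia.
  move=> /four_pos[s1 [e [s2 [Es Ei]]]].
  have eE : e \in E by rewrite -mem_enum Es mem_cat mem_head orbT.
  exists e => //; rewrite /epos /pre size_cat /=.
  have -> : take (index e (enum E)) (enum E) = s1.
    have u := enum_uniq E; rewrite Es in u *.
    have ns1 : e \notin s1.
      by move: u; rewrite cat_uniq /= negb_or => /and3P[_ /andP[]].
    by rewrite index_cat (negbTE ns1) /= eqxx addn0 take_size_cat.
  lia.
rewrite sym_epos //; split=> //; apply/hasP; exists (size (pre e)).-1.
  by rewrite mem_iota /=; have := epos_lt eE; rewrite /epos; have := pre_gt0 e; lia.
by rewrite sym_prev //= /epos; have := pre_gt0 e; lia.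
Qed.

Lemma no4 e i : e \in E -> size (pre e) <= i < epos e -> sym i <> 4.
Proof.
move=> eE /andP[i1 i2] s4.
have l : i - size (pre e) < size (enc_set e) by rewrite /epos in i2; lia.
have := mem_nth 0 l; rewrite -sym_set // subnKC // s4.
exact/negP/(enc_verts_no4 (enum e)).
Qed.

Lemma vpos_word e x : e \in E -> x \in e -> exists r, W = (pre e ++ vpre e x) ++ bin x ++ 3 :: r.
Proof.
move=> /word_split[r ->] /set_split[r' ->]; exists (r' ++ 4 :: r).
by rewrite -!catA.
Qed.

Lemma vpos_lt e x : e \in E -> x \in e -> vpos e x < epos e.
Proof.
move=> eE /set_split[r Er]; rewrite /vpos /epos Er !size_cat size_bin /=; lia.
Qed.

Definition vstart p := isbit (sym p) && has (fun r => (r.+1 == p) && ~~ isbit (sym r)) (iota 0 N).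

(** A name starts at a bit preceded by a non-bit, and belongs to the hyperedge closed by the next 4
    to its right. *)
Lemma inblkP e p : e \in E -> p < N -> reflect (exists2 x, x \in e & p = vpos e x)
  [&& vstart p, p < epos e & ~~ has (fun c => [&& sym c == 4, p < c & c < epos e]) (iota 0 N)].
Proof.
move=> eE pN; have pe := epos_lt eE; have p0 := pre_gt0 e.
have pp : size (pre e) <= epos e by exact: leq_addr.
apply: (iffP and3P) => [[/andP[b /hasP[r _ /andP[/eqP rp nr]]] lp /hasPn H]|[x xe ->]].
  have lp' : size (pre e) <= p.
    rewrite leqNgt; apply/negP => l.
    have pne : p <> (size (pre e)).-1 by move=> Ep; move: b; rewrite Ep sym_prev.
    have q : (size (pre e)).-1 \in iota 0 N by rewrite mem_iota /=; lia.
    have := H _ q; rewrite sym_prev // => /negP; apply.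
    by apply/and3P; split=> //; lia.
  have lq : p - size (pre e) < size (enc_set e) by rewrite /epos in lp; lia.
  have [||l1 [x [l2 [El Eq]]]] := @vert_pos n (enum e) (p - size (pre e)).
  - by rewrite -[enc_verts _]/(enc_set e) -sym_set ?subnKC.
  - move=> q0; rewrite -[enc_verts _]/(enc_set e) -sym_set //; last by lia.
    by have -> : size (pre e) + (p - size (pre e)).-1 = r by lia.
  exists x; first by rewrite -mem_enum El mem_cat mem_head orbT.
  rewrite /vpos /vpre.
  have -> : take (index x (enum e)) (enum e) = l1; last by lia.
  have u := enum_uniq e; rewrite El in u *.
  have ns1 : x \notin l1.
    by move: u; rewrite cat_uniq /= negb_or => /and3P[_ /andP[]].
  by rewrite index_cat (negbTE ns1) /= eqxx addn0 take_size_cat.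
have lv := vpos_lt eE xe.
split=> //; last first.
  apply/hasPn => c _; apply/and3P => -[/eqP c4 c1 c2].
  by apply: (no4 eE _ c4); rewrite /vpos in c1; lia.
apply/andP; split.
  have [r ->] := vpos_word eE xe.
  rewrite /vpos -size_cat nth_cat ltnn subnn nth_cat size_bin /=.
  by rewrite (allP (bin_bits x)) // mem_nth // size_bin.
apply/hasP; exists (vpos e x).-1.
  by rewrite mem_iota /vpos; rewrite /vpos in lv; lia.
apply/andP; split; first by rewrite /vpos; lia.
(* The preceding symbol is the 4 before the block, or the separator 3 of the previous name. *)
case E0 : (take (index x (enum e)) (enum e)) => [|y l].
  by rewrite /vpos /vpre E0 addn0 sym_prev.
have [r ->] := vpos_word eE xe.
have [v Ev] : exists v, vpre e x = rcons v 3.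
  rewrite /vpre E0 lastI -cats1 enc_verts_cat enc_verts_cons.
  exists (enc_verts (belast y l) ++ bin (last y l)).
  by rewrite -cats1 -catA.
have -> : (vpos e x).-1 = size (pre e ++ v) by rewrite /vpos Ev size_rcons size_cat; lia.
have -> : (pre e ++ vpre e x) ++ bin x ++ 3 :: r = (pre e ++ v) ++ 3 :: (bin x ++ 3 :: r).
  by rewrite Ev -cats1 -!catA.
by rewrite nth_cat ltnn subnn.
Qed.

(** Blocks contain no 4 and are preceded by one, so blocks with a common end have a common
    beginning; the length of the prefix then determines the index of the hyperedge. *)
Lemma epos_inj : {in E &, injective epos}.
Proof.
move=> e e' eE eE' Ep.
apply/eqP; case: eqP => // ne; exfalso.
wlog lt : e e' eE eE' Ep ne / size (pre e) <= size (pre e').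
  move=> H; case/orP: (leq_total (size (pre e)) (size (pre e'))) => l; first exact: (H e e').
  by apply: (H e' e) => // E0; apply: ne.
have [r Wr] := word_split eE; have [r' Wr'] := word_split eE'.
case: (ltngtP (size (pre e)) (size (pre e'))) lt => // [lt _|Es _].
  have : sym (size (pre e')).-1 <> 4 by apply: (no4 eE); rewrite Ep /epos; lia.
  by rewrite sym_prev.
have Ei : index e (enum E) = index e' (enum E).
  have sz i j : i <= j -> j <= size (enum E) -> i < j ->
      size (enc_edges (take i (enum E))) < size (enc_edges (take j (enum E))).
    move=> _ js ij; have := cat_take_drop i (take j (enum E)); rewrite (take_takel _ (ltnW ij)) => <-.
    rewrite enc_edges_cat size_cat.
    case Ed: (drop i _) => [|z l]; last by rewrite enc_edges_cons size_cat /=; lia.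
    by have := congr1 size Ed; rewrite size_drop size_takel //=; lia.
  move: Es; rewrite /pre !size_cat /= => Es.
  have m1 : index e (enum E) <= size (enum E) by exact: index_size.
  have m2 : index e' (enum E) <= size (enum E) by exact: index_size.
  case: (ltngtP (index e (enum E)) (index e' (enum E))) => // l.
    by move: Es => /addnI[] Es; have := sz _ _ (ltnW l) m2 l; rewrite Es ltnn.
  by move: Es => /addnI[] Es; have := sz _ _ (ltnW l) m1 l; rewrite Es ltnn.
by apply: ne; rewrite -(nth_index set0 (s := enum E) (x := e)) ?mem_enum // Ei nth_index ?mem_enum.
Qed.

(** The default 3 of [nth] equals the terminator in the word, so the formula still holds at
    [i = size (bin x)]. *)
Lemma vpos_sym e x i : e \in E -> x \in e -> i <= size (bin x) ->
  sym (vpos e x + i) = nth 3 (bin x) i.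
Proof.
move=> eE xe li; have [r ->] := vpos_word eE xe.
rewrite /vpos -size_cat nth_cat ltnNge leq_addr /= addKn nth_cat.
case: ltnP => l; first exact: set_nth_default.
have -> : i = size (bin x) by apply/eqP; rewrite eqn_leq li l.
by rewrite subnn [RHS]nth_default.
Qed.

Lemma vpos_end e x : e \in E -> x \in e -> vpos e x + size (bin x) < N.
Proof.
move=> eE xe; have [r ->] := vpos_word eE xe.
by rewrite size_cat (size_cat (bin x)) /vpos -size_cat ltn_add2l -[X in X < _]addn0 ltn_add2l.
Qed.

End Positions.

(** * Formulas over the encoded graph *)

(** In all formulas [d] is the number of variables in scope, hence the index of the next bound
    variable. *)
Definition pAnd P Q := PIf P Q (PConst false).
Definition pOr P Q := PIf P (PConst true) Q.
Definition pNot P := PIf P (PConst false) (PConst true).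
Definition pSeq P Q := PIf P Q Q.
(** The answer false keeps an enclosing [PEx] from stopping, so [PEx (pDo P)] is a loop over all
    positions. *)
Definition pDo P := pSeq P (PConst false).

Definition fBit v := pOr (PSym 1 v) (PSym 2 v).
Definition fVst d v := pAnd (fBit v) (PEx (pAnd (PSucc d v) (pNot (fBit d)))).
Definition fIn d v b := pAnd (fVst d v) (pAnd (PLt v b)
  (pNot (PEx (pAnd (PSym 4 d) (pAnd (PLt v d) (PLt d b)))))).
Definition fBlk d b := pAnd (PSym 4 b) (PEx (pAnd (PSym 4 d) (PLt d b))).
Definition fExB d P := PEx (pAnd (fBlk d.+1 d) P).
Definition fExV d b P := PEx (pAnd (fIn d.+1 d b) P).
Definition fForB d P := PEx (pDo (pAnd (fBlk d.+1 d) P)).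
Definition fEqSym v w := foldr (fun x P => pOr (pAnd (PSym x v) (PSym x w)) P) (PConst false) (iota 1 4).
Definition fSame d v w := PWalk v w (pAnd (PSym 3 d) (PSym 3 d.+1)) (pNot (fEqSym d d.+1)).
Definition fMem d v b := fExV d b (fSame d.+1 v d).
Definition fMeets d b c := fExV d b (fMem d.+1 d c).
Definition fLinked d v w := fExB d (pAnd (fMem d.+1 v d) (fMem d.+1 w d)).
Definition fNotin d v vs := foldr (fun w P => pAnd (pNot (fSame d v w)) P) (PConst true) vs.
(** The bijection is guessed as a list of linked pairs; [vs] and [ws] hold the vertices already used
    on the two sides. *)
Fixpoint fJump m d b c vs ws :=
  if m is m'.+1 then
    fExV d b (pAnd (fNotin d.+1 d vs) (fExV d.+1 c (pAnd (fNotin d.+2 d.+1 ws)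
      (pAnd (fLinked d.+2 d d.+1) (fJump m' d.+2 b c (d :: vs) (d.+1 :: ws))))))
  else PConst true.
Definition fAdj k d b c := pOr (fMeets d b c) (fJump k d b c [::] [::]).
Definition fCov d t v := fExB d (pAnd (PTrk t d) (fMem d.+1 v d)).
Definition fTouch d t b := fExV d b (fCov d.+1 t d).
Definition fAny (f : nat -> prog) bs := foldr (fun b P => pOr (f b) P) (PConst false) bs.
Fixpoint fGain g d t bs vs :=
  if g is g'.+1 then
    fAny (fun b => fExV d b (pAnd (pNot (fCov d.+1 t d)) (pAnd (fNotin d.+1 d vs)
      (fGain g' d.+1 t bs (d :: vs))))) bs
  else PConst true.
Fixpoint fPath k d bs :=
  if bs is b :: bs' then
    pAnd (if bs' is c :: _ then fAdj k d b c else PConst true) (fPath k d bs')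
  else PConst true.
Definition pPuts t bs := foldr (fun b P => pSeq (PPut t b true) P) (PConst true) bs.
Fixpoint fMove k m (acc : bool) g d t bs :=
  if m is m'.+1 then fExB d (fMove k m' acc g d.+1 t (rcons bs d))
  else pAnd (fPath k d bs) (pAnd (if acc then fAny (fTouch d t) bs else PConst true)
    (pAnd (fGain g d t bs [::]) (pPuts t bs))).

(** * Correctness of the formulas *)

Section Logic.
Variables (n : nat) (E : {set {set 'I_n}}).
Local Notation W := (enc_graph E).
Local Notation N := (size W).
Local Notation sym := (nth 0 W).
Local Notation sm := (sem N sym).
Implicit Types (e : {set 'I_n}) (x y : 'I_n) (s : store) (r : nat -> nat) (d : nat).

Lemma word_ok : all (fun z => 0 < z < 5) W.
Proof.
have B m : all (fun z => 0 < z < 5) (bin m).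
  by apply: sub_all (bin_bits m) => x /orP[] /eqP->.
have V (l : seq 'I_n) : all (fun z => 0 < z < 5) (enc_verts l).
  by elim: l => // x l IH; rewrite enc_verts_cons all_cat B /=.
have D (l : seq {set 'I_n}) : all (fun z => 0 < z < 5) (enc_edges l).
  by elim: l => // e l IH; rewrite enc_edges_cons all_cat V /=.
by rewrite /enc_graph all_cat B /= D.
Qed.

#[local] Opaque enc_graph.

Definition dec d P r s (phi : Prop) := exists2 b : bool, (b <-> phi) & sm d P r s = (b, s).

(* success with a new store satisfying [Q], or failure with the store unchanged *)
Definition spec d P r s (F : Prop) (Q : store -> Prop) :=
  (exists2 s', sm d P r s = (true, s') & Q s') \/ (sm d P r s = (false, s) /\ F).

Lemma dec_iff d P r s (phi psi : Prop) : (phi <-> psi) -> dec d P r s phi -> dec d P r s psi.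
Proof. by move=> h [b H Eb]; exists b => //; exact: iff_trans H h. Qed.

Lemma dec_const d b r s : dec d (PConst b) r s b.
Proof. by exists b. Qed.

Lemma dec_sym d v z r s : v < d -> dec d (PSym z v) r s (sym (r v) = z).
Proof. by move=> vd; exists (sym (r v) == z); [split=> /eqP | rewrite /= vd]. Qed.

Lemma dec_trk d v t r s : t < KN -> v < d -> dec d (PTrk t v) r s (trk s t (r v)).
Proof. by move=> tK vd; exists (trk s t (r v)); rewrite //= tK vd. Qed.

Lemma dec_lt d v w r s : v < d -> w < d -> dec d (PLt v w) r s (r v < r w).
Proof. by move=> vd wd; exists (r v < r w); rewrite //= vd wd. Qed.

Lemma dec_succ d v w r s : v < d -> w < d -> dec d (PSucc v w) r s ((r v).+1 = r w).
Proof. by move=> vd wd; exists ((r v).+1 == r w); [split=> /eqP | rewrite /= vd wd]. Qed.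

Lemma dec_and d P Q r s (phi psi : Prop) : dec d P r s phi -> (phi -> dec d Q r s psi) ->
  dec d (pAnd P Q) r s (phi /\ psi).
Proof.
move=> [b H Eb] HQ; case: b H Eb => H Eb.
  have p := H.1 isT; have [b' H' Eb'] := HQ p; exists b'; last by rewrite /= Eb.
  by split=> [/H'|[_ /H']].
by exists false; [split=> // -[/H.2] | rewrite /= Eb].
Qed.

Lemma dec_or d P Q r s (phi psi : Prop) : dec d P r s phi -> dec d Q r s psi ->
  dec d (pOr P Q) r s (phi \/ psi).
Proof.
move=> [b H Eb] [b' H' Eb']; case: b H Eb => H Eb.
  by exists true; [split=> // _; left; exact: H.1 | rewrite /= Eb].
exists b'; last by rewrite /= Eb.
by split=> [/H'|[/H.2|/H']] //; right.
Qed.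

Lemma dec_not d P r s (phi : Prop) : dec d P r s phi -> dec d (pNot P) r s (~ phi).
Proof.
move=> [b H Eb]; exists (~~ b); last by rewrite /= Eb; case: (b).
by split=> [/negP h1 /H.2|h1] //; apply/negP => /H.1.
Qed.

Lemma dec_ex d P r s (phi : nat -> Prop) :
  (forall i, i < N -> dec d.+1 P (upd r d i) s (phi i)) ->
  dec d (PEx P) r s (exists2 i, i < N & phi i).
Proof.
move=> H.
suff [b Hb Eb] : exists2 b : bool, (b <-> exists2 i, i \in iota 0 N & phi i) &
   search (fun i => sm d.+1 P (upd r d i)) (iota 0 N) s = (b, s).
  exists b => //; apply: iff_trans Hb _.
  by split=> -[i iN p]; exists i; rewrite ?mem_iota // in iN *.
have : forall i, i \in iota 0 N -> dec d.+1 P (upd r d i) s (phi i).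
  by move=> i; rewrite mem_iota => /H.
elim: (iota 0 N) => [|i l IH] {}H; first by exists false => //; split=> // -[].
have [b Hb Eb] := H i (mem_head _ _); rewrite /= Eb.
case: b Hb Eb => Hb Eb /=.
  by exists true => //; split=> // _; exists i; [exact: mem_head | exact: Hb.1].
have [j jl|b' Hb' ->] := IH; first by apply: H; rewrite inE jl orbT.
exists b' => //; apply: iff_trans Hb' _; split=> [[j jl p]|[j]].
  by exists j => //; rewrite inE jl orbT.
by rewrite inE => /orP[/eqP-> /Hb.2|jl p] //; exists j.
Qed.

Lemma spec_iff d P r s F F' R : (F <-> F') -> spec d P r s F R -> spec d P r s F' R.
Proof. by move=> [h _] [H|[Ef HF]]; [left | right; split=> //; exact: h]. Qed.

Lemma spec_and d P Q r s phi F R : dec d P r s phi -> (phi -> spec d Q r s F R) ->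
  spec d (pAnd P Q) r s (phi -> F) R.
Proof.
move=> [b H Eb] HQ; case: b H Eb => H Eb; last first.
  by right; rewrite /= Eb; split=> // /H.2.
case: (HQ (H.1 isT)) => [[s' Es' Rs']|[Es' HF]].
  by left; exists s' => //; rewrite /= Eb.
by right; rewrite /= Eb; split.
Qed.

Lemma spec_ex d P r s (F : nat -> Prop) R :
  (forall i, i < N -> spec d.+1 P (upd r d i) s (F i) R) ->
  spec d (PEx P) r s (forall i, i < N -> F i) R.
Proof.
move=> H.
have : forall i, i \in iota 0 N -> spec d.+1 P (upd r d i) s (F i) R.
  by move=> i; rewrite mem_iota => /H.
move=> {}H; apply: (@spec_iff _ _ _ _ (forall i, i \in iota 0 N -> F i)).
  by split=> G i; [move=> iN; apply: G; rewrite mem_iota | rewrite mem_iota => /G].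
rewrite /spec /=; elim: (iota 0 N) H => [|i l IH] H; first by right; split=> // i.
case: (H i (mem_head _ _)) => [[s' Es' Rs']|[Es' HF]].
  by left; exists s' => //; rewrite /= Es'.
rewrite /= Es' /=; case: IH => [j jl|[s' Es'' Rs']|[Es'' HF']].
- by apply: H; rewrite inE jl orbT.
- by left; exists s'.
- by right; split=> // j; rewrite inE => /orP[/eqP->|/HF'].
Qed.

Lemma sm_seq d P Q r s : sm d (pSeq P Q) r s = sm d Q r (sm d P r s).2.
Proof. by rewrite /=; case: (sm d P r s) => -[]. Qed.

Lemma search_cons f i l s : search f (i :: l) s =
  if (f i s).1 then (true, (f i s).2) else search f l (f i s).2.
Proof. by []. Qed.

Lemma loop_inv d P r s (I : nat -> store -> Prop) : I 0 s ->
  (forall i s, i < N -> I i s -> I i.+1 (sm d.+1 P (upd r d i) s).2) ->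
  exists2 s', sm d (PEx (pDo P)) r s = (false, s') & I N s'.
Proof.
move=> I0 IS.
have L m : forall i s, i + m = N -> I i s -> exists2 s',
   search (fun i => sm d.+1 (pDo P) (upd r d i)) (iota i m) s = (false, s') & I N s'.
  elim: m => [|m IH] i s1; first by rewrite addn0 => -> I1; exists s1.
  move=> im I1; have do_ : sm d.+1 (pDo P) (upd r d i) s1 = (false, (sm d.+1 P (upd r d i) s1).2).
    by rewrite /pDo sm_seq.
  rewrite -[iota _ _]/(i :: iota i.+1 m) search_cons do_.
  by apply: IH; [lia|apply: IS => //; lia].
exact: (L N 0 s).
Qed.

Lemma upd_lt r d i v : v < d -> upd r d i v = r v.
Proof. by move=> vd; rewrite /upd (ltn_eqF vd). Qed.
Lemma upd_eq r d i : upd r d i d = i.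
Proof. by rewrite /upd eqxx. Qed.

Definition blk d r b e := [/\ b < d, e \in E & r b = epos E e].
Definition vert d r v x := v < d /\ exists e, [/\ e \in E, x \in e & r v = vpos E e x].

Lemma blk_up d r b e i : blk d r b e -> blk d.+1 (upd r d i) b e.
Proof. by case=> bd eE rb; split=> //; [exact: leqW | rewrite upd_lt]. Qed.
Lemma blk_new d r e : e \in E -> blk d.+1 (upd r d (epos E e)) d e.
Proof. by move=> eE; split=> //; rewrite upd_eq. Qed.
Lemma vert_up d r v x i : vert d r v x -> vert d.+1 (upd r d i) v x.
Proof. by case=> vd [e [eE xe rv]]; split; [exact: leqW | exists e; rewrite upd_lt]. Qed.
Lemma vert_new d r e x : e \in E -> x \in e -> vert d.+1 (upd r d (vpos E e x)) d x.
Proof. by move=> eE xe; split=> //; exists e; rewrite upd_eq. Qed.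

Lemma dec_fBlk d b r s : b < d -> r b < N -> dec d (fBlk d b) r s (exists2 e, e \in E & r b = epos E e).
Proof.
move=> bd rN; apply: dec_iff; last first.
  apply: dec_and => [|_]; first exact: dec_sym.
  apply: dec_ex => i iN; apply: dec_and => [|_]; first by apply: dec_sym.
  by apply: dec_lt => //; exact: leqW.
split=> [[s4 [i iN [s4' lt]]]|H].
  apply/isblkP => //; rewrite s4 eqxx /=; apply/hasP; exists i; first by rewrite mem_iota.
  by rewrite upd_eq ?upd_lt // in s4' lt; rewrite s4' eqxx.
have := introT (isblkP rN) H => /andP[/eqP s4 /hasP[i]]; rewrite mem_iota => iN /andP[/eqP si li].
by split=> //; exists i => //; rewrite upd_eq upd_lt.
Qed.

Lemma dec_fBit d v r s : v < d -> dec d (fBit v) r s (isbit (sym (r v))).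
Proof.
move=> vd; apply: dec_iff (dec_or (dec_sym 1 _ _ vd) (dec_sym 2 _ _ vd)).
by rewrite /isbit; split=> [[->|->]|/orP[/eqP|/eqP]] //; [left|right].
Qed.

Lemma dec_fVst d v r s : v < d -> dec d (fVst d v) r s (vstart E (r v)).
Proof.
move=> vd; apply: dec_iff; last first.
  apply: dec_and => [|_]; first exact: dec_fBit.
  apply: dec_ex => i iN; apply: dec_and => [|_]; first by apply: dec_succ => //; exact: leqW.
  by apply: dec_not; exact: dec_fBit.
split=> [[b [i iN [h1 h2]]]|/andP[b /hasP[i]]].
  rewrite /vstart b; apply/hasP; exists i; first by rewrite mem_iota.
  by rewrite upd_eq ?upd_lt // in h1 h2; rewrite h1 eqxx; apply/negP.
rewrite mem_iota => iN /andP[/eqP h1 /negP h2]; split=> //.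
by exists i => //; rewrite upd_eq upd_lt.
Qed.

Lemma dec_fIn d v b r s e : v < d -> r v < N -> blk d r b e ->
  dec d (fIn d v b) r s (exists2 x, x \in e & r v = vpos E e x).
Proof.
move=> vd vN [bd eE rb]; apply: dec_iff; last first.
  apply: dec_and => [|_]; first exact: dec_fVst.
  apply: dec_and => [|_]; first exact: dec_lt.
  apply: dec_not; apply: dec_ex => i iN; apply: dec_and => [|_]; first exact: dec_sym.
  by apply: dec_and => [|_]; apply: dec_lt => //; exact: leqW.
rewrite rb; split=> [[h1 [h2 h3]]|H].
  apply/inblkP => //; rewrite h1 h2 /=; apply/hasP => -[i]; rewrite mem_iota => iN /and3P[/eqP s4 l1 l2].
  by apply: h3; exists i => //; rewrite upd_eq !upd_lt // rb.
have := introT (inblkP eE vN) H => /and3P[h1 h2 /hasPn h3]; split=> //; split=> // -[i iN].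
rewrite upd_eq !upd_lt // rb => -[s4 [l1 l2]]; have := h3 i; rewrite mem_iota s4 eqxx l1 l2 /=.
by move/(_ iN).
Qed.

Lemma vpos_ltN e x : e \in E -> x \in e -> vpos E e x < N.
Proof. by move=> eE xe; apply: ltn_trans (vpos_lt eE xe) (epos_lt eE). Qed.

Lemma dec_fExB d P r s (phi : {set 'I_n} -> Prop) :
  (forall e, e \in E -> dec d.+1 P (upd r d (epos E e)) s (phi e)) ->
  dec d (fExB d P) r s (exists2 e, e \in E & phi e).
Proof.
move=> H; apply: (@dec_iff _ _ _ _ (exists2 i, i < N & (exists2 e, e \in E & i = epos E e) /\
    (exists e, [/\ e \in E, i = epos E e & phi e]))).
  split=> [[i iN [_ [e [eE _ p]]]]|[e eE p]]; first by exists e.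
  by exists (epos E e); [exact: epos_lt | split; [exists e | exists e; split]].
apply: dec_ex => i iN; apply: dec_and.
  have := @dec_fBlk d.+1 d (upd r d i) s (ltnSn d); rewrite upd_eq; exact.
move=> [e eE Ei]; apply: (@dec_iff _ _ _ _ (phi e)); last by rewrite Ei; exact: H.
split=> [p|[e' [eE' Ei' p]]]; first by exists e.
by have -> : e = e' by exact: epos_inj eE eE' (etrans (esym Ei) Ei').
Qed.

Lemma spec_fExB d P r s (F : {set 'I_n} -> Prop) R :
  (forall e, e \in E -> spec d.+1 P (upd r d (epos E e)) s (F e) R) ->
  spec d (fExB d P) r s (forall e, e \in E -> F e) R.
Proof.
move=> H.
apply: (@spec_iff _ _ _ _
   (forall i, i < N -> (exists2 e, e \in E & i = epos E e) -> forall e, e \in E -> i = epos E e -> F e)).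
  apply: iff_sym; split=> [G i iN _ e eE _|G e eE]; first exact: G.
  by apply: (G (epos E e)) => //; [exact: epos_lt | exists e].
apply: spec_ex => i iN; apply: spec_and.
  have := @dec_fBlk d.+1 d (upd r d i) s (ltnSn d); rewrite upd_eq; exact.
move=> [e eE Ei].
apply: (@spec_iff _ _ _ _ (F e)); last by rewrite Ei; exact: H.
split=> [G e' eE' Ei'|G]; last exact: G.
by have <- : e = e' by exact: epos_inj eE eE' (etrans (esym Ei) Ei').
Qed.

(** Both names are read from the same position up to the first 3, so they have the same length and
    the same bits. *)
Lemma vpos_inj e e' x y : e \in E -> e' \in E -> x \in e -> y \in e' ->
  vpos E e x = vpos E e' y -> x = y.
Proof.
move=> eE eE' xe ye Ev.
have bits z i : i < size (bin z) -> nth 3 (bin z) i <> 3.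
  by move=> li E3; have := allP (bin_bits z) _ (mem_nth 3 li); rewrite E3.
have sz : size (bin x) = size (bin y).
  case: (ltngtP (size (bin x)) (size (bin y))) => // l.
    by have := bits _ _ l; rewrite -(vpos_sym eE' ye) ?(ltnW l) // -Ev (vpos_sym eE xe) // nth_default.
  by have := bits _ _ l; rewrite -(vpos_sym eE xe) ?(ltnW l) // Ev (vpos_sym eE' ye) // nth_default.
apply: val_inj; apply: (can_inj binK); apply: (eq_from_nth (x0 := 3)) => // i li.
by rewrite -(vpos_sym eE xe) ?(ltnW li) // Ev (vpos_sym eE' ye) // -sz ltnW.
Qed.

Lemma dec_fExV d b P r s e (phi : 'I_n -> Prop) : blk d r b e ->
  (forall x, x \in e -> dec d.+1 P (upd r d (vpos E e x)) s (phi x)) ->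
  dec d (fExV d b P) r s (exists2 x, x \in e & phi x).
Proof.
move=> B H; case: (B) => bd eE rb.
apply: (@dec_iff _ _ _ _ (exists2 i, i < N & (exists2 x, x \in e & i = vpos E e x) /\
    (exists x, [/\ x \in e, i = vpos E e x & phi x]))).
  split=> [[i iN [_ [x [xe _ p]]]]|[x xe p]]; first by exists x.
  by exists (vpos E e x); [exact: vpos_ltN | split; [exists x | exists x; split]].
apply: dec_ex => i iN; apply: dec_and.
  have := @dec_fIn d.+1 d b (upd r d i) s e (ltnSn d); rewrite upd_eq; apply=> //.
  exact: blk_up.
move=> [x xe Ei]; apply: (@dec_iff _ _ _ _ (phi x)); last by rewrite Ei; exact: H.
split=> [p|[y [ye Ei' p]]]; first by exists x.
by have -> : x = y by exact: (vpos_inj eE eE xe ye (etrans (esym Ei) Ei')).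
Qed.

Lemma dec_fEqSym d v w r s : v < d -> w < d -> r v < N ->
  dec d (fEqSym v w) r s (sym (r v) = sym (r w)).
Proof.
move=> vd wd vN; apply: dec_iff; last first.
  have A z := dec_and (dec_sym z r s vd) (fun _ => dec_sym z r s wd).
  exact: dec_or (A 1) (dec_or (A 2) (dec_or (A 3) (dec_or (A 4) (dec_const _ false _ _)))).
have := allP word_ok _ (mem_nth 0 vN); move: (sym (r v)) (sym (r w)) => p q pb.
split=> [[[-> ->]|[[-> ->]|[[-> ->]|[[-> ->]|]]]] //|<-].
by case: p pb => [|[|[|[|[|p]]]]] // _; do ?[by left | right].
Qed.

(** Names consist of bits and end with 3, so two pointers moving in step reach a 3 together exactly
    when the names agree; any mismatch, a different length included, stops the walk. *)
Lemma dec_fSame d v w r s x y : vert d r v x -> vert d r w y -> dec d (fSame d v w) r s (x = y).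
Proof.
move=> [vd [e [eE xe rv]]] [wd [e' [eE' ye rw]]].
exists (bin x == bin y).
  by split=> [/eqP/(can_inj binK)/val_inj|->].
pose f i j := sm d.+2 (pAnd (PSym 3 d) (PSym 3 d.+1)) (upd (upd r d i) d.+1 j).
pose g i j := sm d.+2 (pNot (fEqSym d d.+1)) (upd (upd r d i) d.+1 j).
have -> : sm d (fSame d v w) r s = walk N f g N (r v) (r w) s by rewrite /= vd wd.
have fE i j s1 : i < N -> j < N -> f i j s1 = ((sym i == 3) && (sym j == 3), s1).
  move=> iN jN; have := @dec_and d.+2 _ _ (upd (upd r d i) d.+1 j) s1 _ _
    (dec_sym 3 _ _ (leqnSn d.+1)) (fun _ => dec_sym 3 _ _ (ltnSn d.+1)).
  rewrite upd_eq upd_lt // upd_eq /f => -[b H ->]; congr pair.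
  by apply/idP/andP => [/H[-> ->]|[/eqP h1 /eqP h2]] //; apply/H.
have gE i j s1 : i < N -> j < N -> g i j s1 = (sym i != sym j, s1).
  move=> iN jN.
  have [|b H Eb] := dec_not (@dec_fEqSym d.+2 d d.+1 (upd (upd r d i) d.+1 j) s1 (leqnSn d.+1) (ltnSn d.+1) _).
    by rewrite upd_lt // upd_eq.
  rewrite /g Eb; congr pair; rewrite upd_eq upd_lt // upd_eq in H.
  by apply/idP/idP => [/H/eqP|/eqP/H].
have bits z i : i < size (bin z) -> nth 3 (bin z) i <> 3.
  by move=> li E3; have := allP (bin_bits z) _ (mem_nth 3 li); rewrite E3.
have xN := vpos_end eE xe; have yN := vpos_end eE' ye.
have L fuel m : m <= size (bin x) -> m <= size (bin y) -> take m (bin x) = take m (bin y) ->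
   size (bin x) < fuel + m ->
   walk N f g fuel (vpos E e x + m) (vpos E e' y + m) s = (bin x == bin y, s).
  elim: fuel m => [|fuel IH] m mx my Et lf; first by lia.
  rewrite /= fE ?gE; try lia; rewrite /= !vpos_sym //.
  case: (ltnP m (size (bin x))) => lx; last first.
    have Em : m = size (bin x) by lia.
    rewrite [nth 3 (bin x) m]nth_default // eqxx /=.
    case: (ltnP m (size (bin y))) => ly.
      have /eqP/negbTE -> := bits _ _ ly.
      rewrite eq_sym; have /eqP/negbTE -> := bits _ _ ly; congr pair.
      by apply/esym/eqP => Exy; rewrite Exy in Em; lia.
    rewrite nth_default // eqxx; congr pair; apply/esym/eqP.
    by move: Et; rewrite !take_oversize.
  have /eqP/negbTE -> := bits _ _ lx; rewrite /=.
  case: eqP => [En|ne]; last first.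
    by congr pair; apply/esym/eqP => Exy; apply: ne; rewrite Exy.
  have ly : m < size (bin y).
    rewrite ltnNge; apply/negP => ly; rewrite [nth 3 (bin y) m]nth_default // in En.
    exact: bits lx En.
  rewrite ifT; last by lia.
  rewrite -!addnS; apply: IH => //; last by lia.
  by rewrite !(take_nth 3) // Et En.
rewrite rv rw; have := L N 0; rewrite !addn0; apply=> //; lia.
Qed.

Lemma dec_fMem d v b r s x e : vert d r v x -> blk d r b e -> dec d (fMem d v b) r s (x \in e).
Proof.
move=> V B; apply: dec_iff; last first.
  apply: (dec_fExV B) => y ye; apply: dec_fSame; first exact: vert_up V.
  by case: B => _ eE _; exact: vert_new.
by split=> [[y ye ->]|xe] //; exists x.
Qed.

Lemma dec_fMeets d b c r s e e' : blk d r b e -> blk d r c e' -> dec d (fMeets d b c) r s (meets e e').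
Proof.
move=> B B'; apply: dec_iff; last first.
  apply: (dec_fExV B) => y ye; apply: dec_fMem; last exact: blk_up B'.
  by case: B => _ eE _; exact: vert_new.
by split=> [[y ye ye']|/existsP[y /andP[ye ye']]]; [apply/existsP; exists y; rewrite ye|exists y].
Qed.

Definition linked x y := exists2 g, g \in E & (x \in g) && (y \in g).

Lemma dec_fLinked d v w r s x y : vert d r v x -> vert d r w y -> dec d (fLinked d v w) r s (linked x y).
Proof.
move=> V V'; apply: dec_iff; last first.
  apply: dec_fExB => e eE; apply: dec_and => [|_].
    by apply: dec_fMem; [exact: (vert_up _ V) | exact: blk_new].
  by apply: dec_fMem; [exact: (vert_up _ V') | exact: blk_new].
by split=> [[g gE [xg yg]]|[g gE /andP[xg yg]]]; exists g => //; rewrite xg.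
Qed.

Fixpoint verts d r (vs : seq nat) (xs : seq 'I_n) : Prop :=
  match vs, xs with
  | v :: vs', x :: xs' => vert d r v x /\ verts d r vs' xs'
  | [::], [::] => True
  | _, _ => False
  end.

Lemma verts_up d r vs xs i : verts d r vs xs -> verts d.+1 (upd r d i) vs xs.
Proof. by elim: vs xs => [|v vs IH] [|x xs] //= [/(vert_up i) V /IH]. Qed.

Lemma dec_fNotin d v vs r s x xs : vert d r v x -> verts d r vs xs ->
  dec d (fNotin d v vs) r s (x \notin xs).
Proof.
move=> V; elim: vs xs => [|w vs IH] [|y xs] //= => [_|[V' VS]]; first exact: dec_const.
apply: dec_iff (dec_and (dec_not (dec_fSame s V V')) (fun _ => IH _ VS)).
rewrite inE negb_or; split=> [[/eqP -> ->]|/andP[/eqP]] //.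
Qed.

Fixpoint jumpP m (e e' : {set 'I_n}) (xs ys : seq 'I_n) : Prop :=
  if m is m'.+1 then
    exists2 x, x \in e & x \notin xs /\ exists2 y, y \in e' & y \notin ys /\
      (linked x y /\ jumpP m' e e' (x :: xs) (y :: ys))
  else True.

Lemma dec_fJump m d b c vs ws r s e e' xs ys : blk d r b e -> blk d r c e' ->
  verts d r vs xs -> verts d r ws ys -> dec d (fJump m d b c vs ws) r s (jumpP m e e' xs ys).
Proof.
elim: m d vs ws r xs ys => [|m IH] d vs ws r xs ys B B' V V'; first by apply: dec_iff (dec_const _ true _ _).
case: (B) => _ eE _; case: (B') => _ eE' _.
apply: (dec_fExV B) => x xe; apply: dec_and => [|_].
  by apply: dec_fNotin; [exact: vert_new | exact: verts_up].
apply: (dec_fExV (blk_up _ B')) => y ye; apply: dec_and => [|_].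
  by apply: dec_fNotin; [exact: vert_new | do 2!apply: verts_up].
have V1 := vert_up (vpos E e' y) (vert_new d r eE xe).
have V2 := vert_new d.+1 (upd r d (vpos E e x)) eE' ye.
apply: dec_and => [|_]; first exact: dec_fLinked.
apply: IH => //=; [by do 2!apply: blk_up | by do 2!apply: blk_up | | ].
  by split=> //; do 2!apply: verts_up.
by split=> //; do 2!apply: verts_up.
Qed.

(** [k] distinct elements exhaust a [k]-set, so the two lists enumerate [e] and [e'] and matching
    them by index is a bijection. Conversely, a bijection supplies a further pair as long as fewer
    than [k] vertices are used. *)
Lemma jumpP_adj k e e' : #|e| = k -> #|e'| = k -> jumpP k e e' [::] [::] <->
  exists f : 'I_n -> 'I_n, [/\ {in e &, injective f}, f @: e = e' &
        forall x, x \in e -> exists2 g, g \in E & (x \in g) && (f x \in g)].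
Proof.
move=> ck ck'; split.
  suff H m xs ys : jumpP m e e' xs ys -> size xs = size ys -> uniq xs -> uniq ys ->
     {subset xs <= e} -> {subset ys <= e'} -> (forall i, i < size xs -> forall x0 y0, linked (nth x0 xs i) (nth y0 ys i)) ->
     exists xs' ys', [/\ size xs' = size ys', size xs' = m + size xs, uniq xs' /\ uniq ys',
       {subset xs' <= e} /\ {subset ys' <= e'} & forall i, i < size xs' -> forall x0 y0, linked (nth x0 xs' i) (nth y0 ys' i)].
    move=> /H{H}[] // xs [ys [sz szk [ux uy] [sx sy] L]]; rewrite addn0 in szk.
    have Ex x : (x \in xs) = (x \in e).
      have sub : {subset xs <= enum e} by move=> y /sx; rewrite mem_enum.
      have le : size (enum e) <= size xs by rewrite -cardE ck szk.
      by rewrite (uniq_min_size ux sub le).2 mem_enum.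
    have Ey y : (y \in ys) = (y \in e').
      have sub : {subset ys <= enum e'} by move=> z /sy; rewrite mem_enum.
      have le : size (enum e') <= size ys by rewrite -cardE ck' -sz szk.
      by rewrite (uniq_min_size uy sub le).2 mem_enum.
    exists (fun x => nth x ys (index x xs)); split.
    - move=> x y; rewrite -!Ex => xx yx; rewrite (set_nth_default y) -?sz ?index_mem // => /eqP.
      rewrite nth_uniq -?sz ?index_mem // => /eqP Ei.
      by rewrite -(nth_index x xx) Ei nth_index.
    - apply/setP => y; apply/imsetP/idP => [[x]|].
        by rewrite -Ex -Ey => xx ->; rewrite mem_nth // -sz index_mem.
      rewrite -Ey => yy.
      exists (nth y xs (index y ys)); first by rewrite -Ex mem_nth // sz index_mem.
      by rewrite index_uniq ?sz ?index_mem // nth_index.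
    - move=> x; rewrite -Ex => xx.
      by have := L (index x xs) _ x x; rewrite nth_index // index_mem; apply.
  elim: m xs ys => [|m IH] xs ys /= H sz ux uy sx sy L.
    by exists xs, ys; split.
  case: H => x xe [nx [y ye [ny [l J]]]].
  have [|||||| xs' [ys' [h1 h2 h3 h4 h5]]] := IH _ _ J.
  - by rewrite /= sz.
  - by rewrite /= nx.
  - by rewrite /= ny.
  - by move=> z; rewrite inE => /orP[/eqP->|/sx].
  - by move=> z; rewrite inE => /orP[/eqP->|/sy].
  - by case=> [|i] // li x0 y0; exact: L.
  by exists xs', ys'; split=> //; rewrite h2 /= addnS.
case=> f [inj im L].
suff H m xs : m + size xs = k -> uniq xs -> {subset xs <= e} -> jumpP m e e' xs (map f xs).
  by apply: (H k [::]); rewrite ?addn0.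
elim: m xs => [|m IH] xs //= sz ux sx.
have [x xe nx] : exists2 x, x \in e & x \notin xs.
  case: (set_0Vmem (e :\: [set z in xs])) => [E0|[x]]; last first.
    by rewrite !inE => /andP[nx xe]; exists x.
  have : #|e| <= #|[set z in xs]| by apply: subset_leq_card; rewrite -setD_eq0 E0.
  by rewrite cardsE (card_uniqP ux) ck -sz ltnNge leq_addl.
exists x => //; split=> //; exists (f x); first by rewrite -im imset_f.
split.
  apply/mapP => -[z zx Ef]; move: nx; rewrite (inj x z) ?zx //; exact: sx.
split; first exact: L.
apply: (IH (x :: xs)); rewrite /= ?nx //; first by rewrite addnS -addSn.
by move=> z; rewrite inE => /orP[/eqP->|/sx].
Qed.

Variable k : nat.
Hypothesis unif : uniform k E.

Lemma dec_fAdj d b c r s e e' : blk d r b e -> blk d r c e' ->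
  dec d (fAdj k d b c) r s (adjacent E e e').
Proof.
move=> B B'; case: (B) => _ eE _; case: (B') => _ eE' _.
apply: dec_iff (dec_or (dec_fMeets s B B') (dec_fJump (vs := [::]) (ws := [::]) (xs := [::]) (ys := [::]) k s B B' I I)).
by rewrite (jumpP_adj (unif eE) (unif eE')).
Qed.

End Logic.

(** * Reachability and layers *)

Section Reach.
Variables (n : nat) (E : {set {set 'I_n}}).
Implicit Types (T R L : {set {set 'I_n}}) (e f g : {set 'I_n}).

Lemma meets_sym e f : meets e f = meets f e.
Proof. by apply/existsP/existsP => -[x]; rewrite andbC => H; exists x. Qed.

Lemma adjacent_sym e f : adjacent E e f -> adjacent E f e.
Proof.
case=> [m|[h [inj im L]]]; [by left; rewrite meets_sym | right].
have P y : y \in f -> {x | x \in e & h x = y}.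
  by rewrite -im => /imsetP/sig2_eqW[x xe ->]; exists x.
pose h' y := if [pick x in e | h x == y] is Some x then x else y.
have h'P y : y \in f -> h' y \in e /\ h (h' y) = y.
  move=> yf; rewrite /h'; case: pickP => [x /andP[xe /eqP hx]|/=] //.
  by have [x xe hx] := P y yf => /(_ x); rewrite xe hx eqxx.
exists h'; split.
- by move=> y z /h'P[_ h1] /h'P[_ h2] Eh; rewrite -h1 -h2 Eh.
- apply/setP => x; apply/imsetP/idP => [[y /h'P[h1 _] ->]|xe] //.
  have hf : h x \in f by rewrite -im imset_f.
  exists (h x) => //; have [h1 h2] := h'P _ hf.
  exact: esym (inj _ _ h1 xe h2).
- move=> y /h'P[h1 h2]; have [g gE] := L _ h1; rewrite h2 => /andP[a b].
  by exists g => //; rewrite b a.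
Qed.

Inductive reach T e : {set 'I_n} -> Prop :=
| reach0 : e \in T -> reach T e e
| reachS f g : reach T e f -> g \in T -> adjacent E f g -> reach T e g.

Lemma reach_in T e f : reach T e f -> f \in T.
Proof. by elim. Qed.

Lemma reach_trans T e f g : reach T e f -> reach T f g -> reach T e g.
Proof. by move=> H; elim=> // f' g' _ IH gT A; exact: reachS IH gT A. Qed.

Lemma reach_sym T e f : reach T e f -> reach T f e.
Proof.
elim=> [eT|f' g' H IH gT A]; first exact: reach0.
by apply: reach_trans IH; apply: reachS (reach0 gT) (reach_in H) (adjacent_sym A).
Qed.

Lemma reach_mono T T' e f : T \subset T' -> reach T e f -> reach T' e f.
Proof.
move=> /subsetP S; elim=> [eT|f' g' _ IH gT A]; first by apply: reach0; exact: S.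
by apply: reachS IH _ A; exact: S.
Qed.

(** The possible runs of the greedy phase; the number accumulates the cost bounds of the moves. *)
Inductive chain T0 : {set {set 'I_n}} -> nat -> Prop :=
| chain0 : chain T0 T0 0
| chainS T q p w c : chain T0 T q -> best E (cover T) p w c ->
    chain T0 (T :|: [set e in p]) (q + c).

Lemma cover_add T p : cover (T :|: [set e in p]) = cover T :|: ucov p.
Proof.
apply/setP => x; rewrite inE; apply/bigcupP/orP => [[e]|[/bigcupP[e eT xe]|/ucovP[e ep xe]]].
- rewrite !inE => /orP[eT|ep] xe; first by left; apply/bigcupP; exists e.
  by right; apply/ucovP; exists e.
- by exists e => //; rewrite inE eT.
- by exists e => //; rewrite !inE ep orbT.
Qed.

Lemma chain_base T0 T q : chain T0 T q -> T0 \subset T.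
Proof. by elim=> // {}T {}q p w c _ IH _; apply: subset_trans IH (subsetUl _ _). Qed.

(* [R] meets every connected component of [T]; since each non-accessible move pays one more
   than its length, the budget [q] also pays for joining the components. *)
Definition rooted s T R q := [/\ s \in R, R \subset T,
  forall e, e \in T -> exists2 r, r \in R & reach T r e & #|T| + #|R| <= 2 + q].

Lemma jpath_reach p T : jpath E p -> {subset p <= T} -> forall e f, e \in p -> f \in p -> reach T e f.
Proof.
move=> [_ pE adj] pT.
have H i : i < size p -> reach T (nth set0 p 0) (nth set0 p i).
  elim: i => [|i IH] li; first by apply: reach0; apply: pT; exact: mem_nth.
  by apply: reachS (IH (ltnW li)) _ (adj _ li); apply: pT; exact: mem_nth.
move=> e f /(nthP set0)[i li <-] /(nthP set0)[j lj <-].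
by apply: reach_trans (H _ lj); apply: reach_sym; exact: H.
Qed.

(** A move meeting the covered vertices attaches itself to an existing component; otherwise its
    first hyperedge becomes a new root, paid by the surcharge. *)
Lemma chain_rooted s T q : chain [set s] T q -> exists R, rooted s T R q.
Proof.
elim=> [|{}T {}q p w c _ [R [sR RT H C]] [jp gg cl _]].
  exists [set s]; split; rewrite ?set11 ?cards1 //.
  by move=> e; rewrite inE => /eqP->; exists s; rewrite ?set11 //; apply: reach0; rewrite set11.
have sub : T \subset T :|: [set e in p] by exact: subsetUl.
have psub : {subset p <= T :|: [set e in p]} by move=> e ep; rewrite !inE ep orbT.
have cT : #|T :|: [set e in p]| <= #|T| + size p.
  apply: leq_trans (leq_card_setU _ _) _; rewrite leq_add2l cardsE; exact: card_size.
case: (boolP (has (touches (cover T)) p)) => acc.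
  case/hasP: (acc) => e0 e0p; rewrite /touches disjoint_subset => /subsetPn[x xe0].
  rewrite inE negbK => /bigcupP[t tT xt].
  have At : adjacent E t e0 by left; apply/existsP; exists x; rewrite xt.
  exists R; split=> //; first exact: subset_trans RT sub.
    move=> e; rewrite !inE => /orP[/H[r rR rr]|ep]; first by exists r => //; exact: reach_mono sub rr.
    have [r rR rr] := H _ tT; exists r => //.
    apply: reach_trans (jpath_reach jp psub e0p ep).
    by apply: reachS (reach_mono sub rr) (psub _ e0p) At.
  move: cl; rewrite /mcost acc addn0 => cl.
  by apply: leq_trans (leq_add cT (leqnn _)) _; lia.
have p0 : 0 < size p by case: jp => /andP[].
have hp : nth set0 p 0 \in p by exact: mem_nth.
exists (nth set0 p 0 |: R); split.
- by rewrite !inE sR orbT.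
- by rewrite subUset sub1set psub //=; exact: subset_trans RT sub.
- move=> e; rewrite !inE => /orP[/H[r rR rr]|ep].
    by exists r; [rewrite !inE rR orbT | exact: reach_mono sub rr].
  by exists (nth set0 p 0); [rewrite !inE eqxx | exact: jpath_reach jp psub _ _ hp ep].
- have H1 : #|nth set0 p 0 |: R| <= #|[set nth set0 p 0]| + #|R| by exact: leq_card_setU.
  rewrite cards1 in H1; move: cl; rewrite /mcost acc => cl.
  by apply: leq_trans (leq_add cT H1) _; lia.
Qed.

(** Adding [g] merges the component of [t] with that of [s]: one hyperedge more and one root less,
    so the budget stays the same. *)
Lemma rooted_join s T R q g t c x y :
  rooted s T R q -> g \in E -> c \in T -> reach T s c -> x \in c -> x \in g ->
  t \in T -> ~ reach T s t -> y \in t -> y \in g ->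
  exists2 R', rooted s (g |: T) R' q & #|R'| < #|R|.
Proof.
move=> [sR RT H C] gE cT sc xc xg tT nst yt yg.
have [r rR rt] := H _ tT.
have rs : r != s by apply/eqP => E0; apply: nst; rewrite -E0.
have sub : T \subset g |: T by exact: subsetUr.
have gT' : g \in g |: T by rewrite !inE eqxx.
have sg : reach (g |: T) s g.
  apply: reachS (reach_mono sub sc) gT' _; left; apply/existsP; exists x; by rewrite xc.
have sr : reach (g |: T) s r.
  apply: reach_trans (reach_mono sub (reach_sym rt)).
  apply: reachS sg (subsetP sub _ tT) _; left; apply/existsP; exists y; by rewrite yg.
have c1 : #|R :\ r| < #|R| by rewrite [X in _ < X](cardsD1 r) rR.
exists (R :\ r) => //; split.
- by rewrite !inE sR andbT eq_sym.
- apply: subset_trans (subD1set _ _) (subset_trans RT sub).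
- move=> e; rewrite !inE => /orP[/eqP->|eT].
    by exists s => //; rewrite !inE sR andbT eq_sym.
  have [r' r'R re] := H _ eT.
  case: (eqVneq r' r) => [E0|ne]; last by exists r'; [rewrite !inE ne | exact: reach_mono sub re].
  exists s; first by rewrite !inE sR andbT eq_sym.
  by apply: reach_trans sr _; rewrite -E0; exact: reach_mono sub re.
- have H1 : #|g |: T| <= #|[set g]| + #|T| by exact: leq_card_setU.
  rewrite cards1 in H1; apply: leq_trans (leq_add H1 (leqnn _)) _.
  by rewrite (addnC 1) -addnA add1n; apply: leq_trans C; rewrite leq_add2l.
Qed.

Hypothesis conn : hconnected E.

(** On a line-graph path from [e0] to a hyperedge containing [x], the first hyperedge not contained
    in [S] meets its predecessor, which lies in [S]. *)
Lemma crossing (S : {set 'I_n}) e0 x : e0 \in E -> e0 \subset S -> x \notin S ->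
  (exists2 e, e \in E & x \in e) ->
  exists g y z, [/\ g \in E, y \in g, y \in S, z \in g & z \notin S].
Proof.
move=> e0E e0S xS [e eE xe].
have [p [pE pp pl]] := conn e0E eE.
elim: p e0 e0E e0S pE pp pl => [|f p IH] e0 e0E e0S /=.
  by move=> _ _ E0; move/subsetP: e0S => /(_ x); rewrite E0 xe (negbTE xS) => /(_ isT).
move=> /andP[fE pE] /andP[/existsP[y /andP[y0 yf]] pp] pl.
case: (boolP (f \subset S)) => [fS|/subsetPn[z zf zS]]; first exact: (IH f).
by exists f, y, z; split=> //; exact: (subsetP e0S).
Qed.

(** A classical truth value for proofs only; the programs decide adjacency by [fAdj]. *)
Definition adjb e f : bool := if excluded_middle_informative (adjacent E e f) then true else false.
Lemma adjbP e f : reflect (adjacent E e f) (adjb e f).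
Proof. by rewrite /adjb; case: excluded_middle_informative => H; constructor. Qed.

(* A breadth-first layering of the [L]-part of [T] around [s]. *)
Definition layered T s L (lev : {set 'I_n} -> nat) i := [/\ s \in L, L \subset T, lev s = 0,
   forall e, e \in L -> e != s -> exists2 c, c \in L & adjacent E e c /\ lev e = (lev c).+1 &
   (forall e, e \in L -> lev e <= i) /\
   (forall c e, c \in L -> e \in T -> adjacent E e c -> lev c < i -> e \in L /\ lev e <= (lev c).+1)].

Definition closedL T L := forall c e, c \in L -> e \in T -> adjacent E e c -> e \in L.

Definition nextL T L := [set e in T | (e \notin L) && [exists c in L, adjb e c]].

Lemma nextLP T L e : e \in nextL T L <-> [/\ e \in T, e \notin L & exists2 c, c \in L & adjacent E e c].
Proof.
rewrite inE; split=> [/and3P[h1 h2 /existsP[c /andP[cL /adjbP A]]]|[h1 h2 [c cL A]]].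
  by split=> //; exists c.
by rewrite h1 h2; apply/existsP; exists c; rewrite cL; apply/adjbP.
Qed.

(** All neighbours in [T] of layers below [i] are already in [L], so a new hyperedge can only be
    adjacent to layer [i]. *)
Lemma layered_next T s L lev i : layered T s L lev i ->
  layered T s (L :|: nextL T L) (fun e => if e \in L then lev e else i.+1) i.+1.
Proof.
move=> [sL LT l0 par [le cl]]; split.
- by rewrite inE sL.
- rewrite subUset LT; apply/subsetP => e /nextLP[] //.
- by rewrite sL.
- move=> e; rewrite inE; case: (boolP (e \in L)) => /= [eL _ es|eL /nextLP[eT _ [c cL A]] _].
    have [c cL [A El]] := par _ eL es; exists c; first by rewrite inE cL.
    by rewrite cL.
  exists c; first by rewrite inE cL.
  rewrite cL; split=> //.
  case: (ltnP (lev c) i) => lc; first by have [eL' _] := cl _ _ cL eT A lc; rewrite eL' in eL.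
  by congr _.+1; apply/eqP; rewrite eqn_leq lc le.
- split=> [e|c e].
    by rewrite inE; case: (boolP (e \in L)) => [/le/leqW|_ _].
  rewrite inE; case: (boolP (c \in L)) => /= [cL _|cL _]; last by rewrite ltnn.
  move=> eT A lc; case: (boolP (e \in L)) => eL; last first.
    split; first by rewrite inE; apply/orP; right; apply/nextLP; split=> //; exists c.
    case: (ltnP (lev c) i) => lc' //.
    by have [eL' _] := cl _ _ cL eT A lc'; rewrite eL' in eL.
  split; first by rewrite inE eL.
  case: (ltnP (lev c) i) => lc'; first by case: (cl _ _ cL eT A lc').
  by apply: leq_trans (le _ eL) _; exact: leqW.
Qed.

Lemma nextL_closed T L : nextL T L = set0 -> closedL T L.
Proof.
move=> E0 c e cL eT A; apply/negPn/negP => eL.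
have : e \in nextL T L by apply/nextLP; split=> //; exists c.
by rewrite E0 inE.
Qed.

Lemma closed_nextL T L : closedL T L -> nextL T L = set0.
Proof.
move=> cl; apply/setP => e; rewrite [RHS]inE; apply/negP => /nextLP[eT eL [c cL A]].
by rewrite (cl _ _ cL eT A) in eL.
Qed.

Lemma layered_reach T s L lev i : layered T s L lev i -> closedL T L ->
  forall e, e \in L <-> reach T s e.
Proof.
move=> [sL LT l0 par _] cl e; split; last first.
  by elim=> // f g _ fL gT A; apply: cl fL gT (adjacent_sym A).
move: {-1}(lev e) (leqnn (lev e)) => m; elim: m e => [|m IH] e le eL.
  case: (eqVneq e s) => [->|es]; first by apply: reach0; exact: (subsetP LT).
  by have [c _ [_ El]] := par _ eL es; rewrite El in le.
case: (eqVneq e s) => [->|es]; first by apply: reach0; exact: (subsetP LT).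
have [c cL [A El]] := par _ eL es.
apply: reachS (IH c _ cL) (subsetP LT _ eL) (adjacent_sym A).
by rewrite El in le.
Qed.

End Reach.

(** * The greedy phase *)

(* (length, whether a hyperedge must meet the covered vertices, gain); scanning the classes by
   decreasing ratio makes the first feasible one optimal. *)
Definition mclass := (nat * bool * nat)%type.
Definition ccost (c : mclass) := c.1.1 + ~~ c.1.2.
Definition denser (c c' : mclass) := c'.2 * ccost c <= c.2 * ccost c'.
Definition classes k : seq mclass := sort denser
  [seq (m, z.1, z.2) | m <- iota 1 4, z <- [seq (acc, g) | acc <- [:: true; false], g <- iota 1 (4 * k)]].

(* Tracks: 0 the current set of hyperedges and 2 its cardinality in unary, 1 and 3 the same for the
   best set found, 4-6 the layers modulo 3, 7 the next layer, 8 the visited hyperedges and 9 the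
   current one.  A hyperedge is represented by the position of the separator that ends it. *)
Definition pClear d t := PEx (pDo (PPut t d false)).
Definition fFirst k d l :=
  foldr (fun (c : mclass) P => pOr (fMove k c.1.1 c.1.2 c.2 d 0 [::]) P) (PConst false) l.
Definition fStep k d := fFirst k d (classes k).
Definition fGreedy k d := PEx (pDo (fStep k d.+1)).
Definition fLab v := pOr (PTrk 4 v) (pOr (PTrk 5 v) (PTrk 6 v)).
(** The new layer is collected on track 7 before it is labelled, so the labels do not change while
    they are consulted. *)
Definition fRound k d j := pSeq (pClear d 7) (pSeq
  (fForB d (pAnd (pAnd (PTrk 0 d) (pAnd (pNot (fLab d))
     (fExB d.+1 (pAnd (fLab d.+1) (fAdj k d.+2 d d.+1))))) (PPut 7 d true)))
  (fForB d (pAnd (PTrk 7 d) (PPut j d true)))).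
Definition fBFS k d v := pSeq (pClear d 4) (pSeq (pClear d 5) (pSeq (pClear d 6)
  (pSeq (PPut 4 v true)
  (PEx (pDo (pSeq (fRound k d.+1 5) (pSeq (fRound k d.+1 6) (fRound k d.+1 4)))))))).
Definition fCovL d v := fExB d (pAnd (fLab d) (fMem d.+1 v d)).
Definition fCross d := fExB d (pAnd (pAnd (fExV d.+1 d (fCovL d.+2 d.+1))
  (fExV d.+1 d (pNot (fCovL d.+2 d.+1)))) (PPut 0 d true)).
Definition fConnect k d v := PEx (pDo (pSeq (fBFS k d.+1 v) (fCross d.+1))).
(** Unary increment: the leftmost free position is marked. *)
Definition fIncr d := PEx (pAnd (pAnd (pNot (PTrk 2 d))
   (pNot (PEx (pAnd (PLt d.+1 d) (pNot (PTrk 2 d.+1)))))) (PPut 2 d true)).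
Definition fCount d := pSeq (pClear d 2) (fForB d (pAnd (PTrk 0 d) (fIncr d.+1))).
Definition fCopy d t t' := PEx (pDo (PIf (PTrk t d) (PPut t' d true) (PPut t' d false))).
Definition fBetter d := PEx (pAnd (PTrk 3 d) (pNot (PTrk 2 d))).
Definition fTry k d v := pSeq (pClear d 0) (pSeq (PPut 0 v true) (pSeq (fGreedy k d)
  (pSeq (fConnect k d v) (pSeq (fCount d)
  (PIf (fBetter d) (pSeq (fCopy d 0 1) (fCopy d 2 3)) (PConst true)))))).
(** Track 3 starts full, as a count above that of any set of hyperedges, so the first candidate is
    accepted. *)
Definition fSearch k := pSeq (PEx (pDo (PPut 3 0 true))) (pSeq (fForB 0 (fTry k 1 0)) (fCopy 0 1 0)).

Lemma denser_total : total denser.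
Proof. by move=> a b; exact: leq_total. Qed.

(** * Correctness of the greedy phase *)

Section Algo.
Variables (n : nat) (E : {set {set 'I_n}}) (k : nat).
Hypothesis unif : uniform k E.
Hypothesis cov : covers E.
Local Notation W := (enc_graph E).
Local Notation N := (size W).
Local Notation sym := (nth 0 W).
Local Notation sm := (sem N sym).
Local Notation ef d P r s := (sem N sym d P r s).2.
Local Notation dec := (dec E).
Local Notation spec := (spec E).
Local Notation blk := (blk E).
Local Notation vert := (vert E).
Implicit Types (e g : {set 'I_n}) (x y : 'I_n) (s : store) (r : nat -> nat) (d t : nat)
  (T L A B : {set {set 'I_n}}).
#[local] Opaque enc_graph.

Definition TS s t := [set e in E | trk s t (epos E e)].
Definition fr (ts : seq nat) s s' := (forall t, t \notin ts -> trk s' t = trk s t) /\ out s' = out s.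

Lemma fr_trans ts ts1 ts2 s s1 s2 : fr ts1 s s1 -> fr ts2 s1 s2 ->
  {subset ts1 <= ts} -> {subset ts2 <= ts} -> fr ts s s2.
Proof.
move=> [h1 o1] [h2 o2] u1 u2; split; last by rewrite o2.
move=> t nt; rewrite h2; last by apply: contra nt => /u2.
by rewrite h1 //; apply: contra nt => /u1.
Qed.
Lemma fr_put t i b s : fr [:: t] s (put s t i b).
Proof. by split=> // t'; rewrite inE /= => /negbTE ->. Qed.
Lemma TS_fr ts s s' t : fr ts s s' -> t \notin ts -> TS s' t = TS s t.
Proof. by move=> [h _] nt; apply/setP => e; rewrite !inE h. Qed.
Lemma TS_put e s t : e \in E -> TS (put s t (epos E e) true) t = e |: TS s t.
Proof.
move=> eE; apply/setP => f; rewrite !inE /= eqxx.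
case: (boolP (f \in E)) => fE /=; last by case: eqP fE => // ->; rewrite eE.
have -> : (epos E f == epos E e) = (f == e) by apply/eqP/eqP => [/epos_inj|->] //; exact.
by case: eqP.
Qed.
Lemma TS_sub s t : TS s t \subset E.
Proof. by apply/subsetP => e; rewrite inE => /andP[]. Qed.

Lemma ef_seq d P Q r s : ef d (pSeq P Q) r s = ef d Q r (ef d P r s).
Proof. by rewrite sm_seq. Qed.
Lemma ef_put d t v b r s : t < KN -> v < d -> ef d (PPut t v b) r s = put s t (r v) b.
Proof. by move=> tK vd; rewrite /= tK vd. Qed.
Lemma ef_and d P Q r s phi : dec d P r s phi ->
  (phi /\ ef d (pAnd P Q) r s = ef d Q r s) \/ (~ phi /\ ef d (pAnd P Q) r s = s).
Proof.
by move=> [b H Eb]; case: b H Eb => H Eb; [left|right]; split; rewrite /= ?Eb //;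
  [exact: H.1 | move/H.2].
Qed.
Lemma ef_if d P Q Q' r s phi : dec d P r s phi ->
  (phi /\ ef d (PIf P Q Q') r s = ef d Q r s) \/ (~ phi /\ ef d (PIf P Q Q') r s = ef d Q' r s).
Proof.
by move=> [b H Eb]; case: b H Eb => H Eb; [left|right]; split; rewrite /= ?Eb //;
  [exact: H.1 | move/H.2].
Qed.

Lemma ef_loop d P r s (I : nat -> store -> Prop) : I 0 s ->
  (forall i s, i < N -> I i s -> I i.+1 (ef d.+1 P (upd r d i) s)) -> I N (ef d (PEx (pDo P)) r s).
Proof. by move=> I0 IS; have [s' -> ] := loop_inv I0 IS. Qed.

Lemma ef_forB d P r s (I : {set {set 'I_n}} -> store -> Prop) : I set0 s ->
  (forall e A s, e \in E -> e \notin A -> A \subset E -> I A s ->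
     I (e |: A) (ef d.+1 P (upd r d (epos E e)) s)) ->
  I E (ef d (fForB d P) r s).
Proof.
move=> I0 IS.
have EN : [set e in E | epos E e < N] = E.
  by apply/setP => e; rewrite inE; case: (boolP (e \in E)) => //= eE; exact: epos_lt.
rewrite -[X in I X _]EN.
apply: (@ef_loop d _ r s (fun i s => I [set e in E | epos E e < i] s)).
  by rewrite (_ : [set e in E | _] = set0) //; apply/setP => e; rewrite !inE andbF.
move=> i s1 iN I1.
have D : dec d.+1 (fBlk d.+1 d) (upd r d i) s1 (exists2 e, e \in E & i = epos E e).
  by have := @dec_fBlk n E d.+1 d (upd r d i) s1 (ltnSn d); rewrite upd_eq; exact.
case: (ef_and P D) => [[[e eE Ei] ->]|[ne ->]].
  rewrite (_ : [set f in E | epos E f < i.+1] = e |: [set f in E | epos E f < i]).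
    rewrite Ei; apply: IS => //; rewrite -?Ei //.
      by rewrite inE eE Ei ltnn.
    by apply/subsetP => f; rewrite inE => /andP[].
  apply/setP => f; rewrite !inE ltnS leq_eqVlt.
  case: (boolP (f \in E)) => fE /=; last by case: eqP fE => // ->; rewrite eE.
  congr orb; apply/eqP/eqP => [Ef|->] //; exact: (epos_inj fE eE (etrans Ef Ei)).
rewrite (_ : [set f in E | epos E f < i.+1] = [set f in E | epos E f < i]) //.
apply/setP => f; rewrite !inE ltnS leq_eqVlt.
case: (boolP (f \in E)) => fE //=; case: eqP => // Ef; case: ne; by exists f.
Qed.

Lemma dec_TS d b r s t e : t < KN -> blk d r b e -> dec d (PTrk t b) r s (e \in TS s t).
Proof.
move=> tK [bd eE rb]; apply: dec_iff (dec_trk _ _ _ tK bd).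
by rewrite inE eE rb.
Qed.

Lemma ef_clear d r s t : t < KN -> [/\ fr [:: t] s (ef d (pClear d t) r s),
  TS (ef d (pClear d t) r s) t = set0 & forall i, i < N -> trk (ef d (pClear d t) r s) t i = false].
Proof.
move=> tK.
have [h1 h2] : fr [:: t] s (ef d (pClear d t) r s) /\
   (forall i, i < N -> i < N -> trk (ef d (pClear d t) r s) t i = false).
  apply: (@ef_loop d _ r s (fun m s' => fr [:: t] s s' /\ (forall i, i < m -> i < N -> trk s' t i = false))) => //.
  move=> i s1 iN [f1 h1]; rewrite ef_put // upd_eq; split.
    by apply: fr_trans f1 (fr_put _ _ _ _) _ _.
  move=> j; rewrite ltnS leq_eqVlt /= eqxx => /orP[/eqP->|ji jN]; first by rewrite eqxx.
  by case: eqP => // _; exact: h1.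
split=> // [|i iN]; last exact: h2.
by apply/setP => e; rewrite !inE; case: (boolP (e \in E)) => //= eE; rewrite h2 // epos_lt.
Qed.

Lemma dec_fCov d t v r s x : t < KN -> vert d r v x -> dec d (fCov d t v) r s (x \in cover (TS s t)).
Proof.
move=> tK V; apply: dec_iff; last first.
  apply: (@dec_fExB _ _ _ _ _ _ (fun e => e \in TS s t /\ x \in e)) => e eE.
  apply: dec_and => [|_]; first by apply: dec_TS => //; exact: blk_new.
  by apply: dec_fMem; [exact: vert_up V | exact: blk_new].
split=> [[e eE [eT xe]]|/bigcupP[e eT xe]]; first by apply/bigcupP; exists e.
by exists e => //; exact: (subsetP (TS_sub s t)).
Qed.

Lemma dec_fTouch d t b r s e : t < KN -> blk d r b e ->
  dec d (fTouch d t b) r s (touches (cover (TS s t)) e).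
Proof.
move=> tK B; apply: dec_iff; last first.
  apply: (dec_fExV B) => x xe; apply: dec_fCov => //.
  by case: B => _ eE _; exact: vert_new.
rewrite /touches disjoint_subset; split=> [[x xe xS]|/subsetPn[x xe]].
  by apply/subsetPn; exists x => //; rewrite inE negbK.
by rewrite inE negbK => xS; exists x.
Qed.

Fixpoint blks d r (bs : seq nat) (es : seq {set 'I_n}) : Prop :=
  match bs, es with
  | b :: bs', e :: es' => blk d r b e /\ blks d r bs' es'
  | [::], [::] => True
  | _, _ => False
  end.

Lemma blks_up d r bs es i : blks d r bs es -> blks d.+1 (upd r d i) bs es.
Proof. by elim: bs es => [|v vs IH] [|x xs] //= [/(blk_up i) V /IH]. Qed.

Lemma blks_rcons d r bs es b e : blks d r bs es -> blk d r b e -> blks d r (rcons bs b) (rcons es e).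
Proof. by elim: bs es => [|v vs IH] [|x xs] //= [V /IH H] /H. Qed.

Lemma dec_fAny d f bs r s es (phi : {set 'I_n} -> Prop) : blks d r bs es ->
  (forall b e, blk d r b e -> dec d (f b) r s (phi e)) ->
  dec d (fAny f bs) r s (exists2 e, e \in es & phi e).
Proof.
move=> BS H; elim: bs es BS => [|b bs IH] [|e es] //=.
  by move=> _; apply: dec_iff (dec_const _ _ false _ _); split=> // -[].
move=> [B BS]; apply: dec_iff (dec_or (H _ _ B) (IH _ BS)).
split=> [[p|[f' fe p]]|[f']]; first by exists e; rewrite ?mem_head.
  by exists f' => //; rewrite inE fe orbT.
by rewrite inE => /orP[/eqP->|fe] p; [left | right; exists f'].
Qed.

Lemma dec_fGain w d t bs vs r s es xs : t < KN -> blks d r bs es -> verts E d r vs xs ->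
  dec d (fGain w d t bs vs) r s (w <= #|(ucov es :\: cover (TS s t)) :\: [set x in xs]|).
Proof.
move=> tK; elim: w d vs r xs => [|w IH] d vs r xs BS VS.
  by apply: dec_iff (dec_const _ _ true _ _).
set A := ucov es :\: cover (TS s t).
apply: dec_iff; last first.
  apply: (@dec_fAny _ _ _ _ _ _ (fun e => exists2 x, x \in e & x \notin cover (TS s t) /\
      (x \notin xs /\ w <= #|A :\: [set z in x :: xs]|)) BS) => b e B.
  case: (B) => _ eE _; apply: (dec_fExV B) => x xe; apply: dec_and => [|_].
    apply: dec_iff (dec_not (dec_fCov s tK (vert_new d r eE xe))).
    by split=> [/negP|/negP].
  apply: dec_and => [|_]; first by apply: dec_fNotin; [exact: vert_new | exact: verts_up].
  apply: IH; first exact: blks_up.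
  by split; [exact: vert_new | exact: verts_up].
split=> [[e ee [x xe [xS [nx le]]]]|lt].
  have xA : x \in A :\: [set z in xs].
    by rewrite !inE nx xS /=; apply/ucovP; exists e.
  rewrite (cardsD1 x) xA add1n ltnS; apply: leq_trans le _; apply: subset_leq_card.
  by apply/subsetP => z; rewrite !inE negb_or => /andP[/andP[-> ->]] ->.
have /card_gt0P[x xA] : 0 < #|A :\: [set z in xs]| by exact: leq_ltn_trans lt.
move: (xA); rewrite !inE => /and3P[nx xS /ucovP[e ee xe]].
exists e => //; exists x => //; split=> //; split=> //.
move: lt; rewrite (cardsD1 x) xA add1n ltnS => lt; apply: leq_trans lt _.
by apply: subset_leq_card; apply/subsetP => z; rewrite !inE negb_or => /andP[-> /andP[-> ->]].
Qed.

Definition adjs (p : seq {set 'I_n}) :=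
  forall i, i.+1 < size p -> adjacent E (nth set0 p i) (nth set0 p i.+1).

Lemma dec_fPath d bs r s es : blks d r bs es -> dec d (fPath k d bs) r s (adjs es).
Proof.
elim: bs es => [|b bs IH] [|e es] //=.
  by move=> _; apply: dec_iff (dec_const _ _ true _ _).
move=> [B BS].
have D1 : dec d (if bs is c :: _ then fAdj k d b c else PConst true) r s
    (1 < size (e :: es) -> adjacent E e (nth set0 es 0)).
  case: bs es {IH} BS => [|c bs] [|f es] //=.
    by move=> _; apply: dec_iff (dec_const _ _ true _ _).
  by move=> [B' _]; apply: dec_iff (dec_fAdj unif s B B'); split=> // /(_ isT).
apply: dec_iff (dec_and D1 (fun _ => IH _ BS)).
split=> [[h1 h2]|H].
  by case=> [|i] li; [apply: h1; exact: li | apply: h2; exact: li].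
by split=> [l|i li]; [exact: (H 0) | exact: (H i.+1)].
Qed.

Lemma sm_pPuts d t bs r s es : t < KN -> blks d r bs es ->
  exists2 s', sm d (pPuts t bs) r s = (true, s') & TS s' t = TS s t :|: [set e in es] /\ fr [:: t] s s'.
Proof.
move=> tK; elim: bs es s => [|b bs IH] [|e es] //= s.
  by move=> _; exists s => //; split=> //; apply/setP => e; rewrite !inE orbF.
move=> [[bd eE rb] BS]; rewrite tK bd /= rb.
have [s' -> [Ts' f']] := IH _ (put s t (epos E e) true) BS; exists s' => //; split.
  by rewrite Ts' TS_put //; apply/setP => f; rewrite !inE orbA; congr orb; exact: orbC.
exact: fr_trans (fr_put _ _ _ _) f' _ _.
Qed.

Definition legal s m (acc : bool) w (p : seq {set 'I_n}) := [/\ size p = m, {subset p <= E}, adjs p,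
  acc -> has (touches (cover (TS s 0))) p & w <= gain (cover (TS s 0)) p].
Definition added s (p : seq {set 'I_n}) s' := TS s' 0 = TS s 0 :|: [set e in p] /\ fr [:: 0] s s'.

Lemma spec_fMove m acc w d bs r s es : blks d r bs es -> {subset es <= E} ->
  spec d (fMove k m acc w d 0 bs) r s
    (forall p, ~ legal s (size es + m) acc w (es ++ p))
    (fun s' => exists2 p, legal s (size es + m) acc w (es ++ p) & added s (es ++ p) s').
Proof.
elim: m d bs r es => [|m IH] d bs r es BS sE.
  have D1 := dec_fPath s BS.
  have D2 : dec d (if acc then fAny (fTouch d 0) bs else PConst true) r s
     (acc -> has (touches (cover (TS s 0))) es).
    case: acc; last by apply: dec_iff (dec_const _ _ true _ _).
    have D := @dec_fAny d (fTouch d 0) bs r s es (fun e => touches (cover (TS s 0)) e) BS (fun b e H => @dec_fTouch d 0 b r s e isT H).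
    apply: dec_iff D.
    by split=> [H _|/(_ isT)/hasP]; [apply/hasP|].
  have D3 := @dec_fGain w d 0 bs [::] r s es [::] isT BS I.
  apply: spec_iff; last first.
    apply: spec_and D1 _ => h1; apply: spec_and D2 _ => h2; apply: spec_and D3 _ => h3.
    left; have [s' Es' H] := @sm_pPuts d 0 bs r s es isT BS; exists s' => //.
    exists [::]; rewrite cats0 // addn0; split=> //; rewrite /gain.
    by move: h3; rewrite (_ : [set x in [::]] = set0) ?setD0 //; apply/setP => x; rewrite !inE.
  split=> [H p [sz _ a1 a2 a3]|H h1 h2 h3].
    have p0 : p = [::] by apply: size0nil; move: sz; rewrite size_cat; lia.
    rewrite p0 cats0 in a1 a2 a3; apply: (H a1 a2); move: a3; rewrite /gain.
    by rewrite (_ : [set x in [::]] = set0) ?setD0 //; apply/setP => x; rewrite !inE.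
  apply: (H [::]); rewrite cats0 addn0; split=> //; rewrite /gain.
  by move: h3; rewrite (_ : [set x in [::]] = set0) ?setD0 //; apply/setP => x; rewrite !inE.
apply: spec_iff; last first.
  apply: (@spec_fExB _ _ _ _ _ _ (fun e => forall p, ~ legal s (size es + m.+1) acc w (es ++ e :: p))) => e eE.
  have := IH d.+1 (rcons bs d) (upd r d (epos E e)) (rcons es e).
  rewrite size_rcons addSnnS => H.
  have [||[s' Es' [p lp ap]]|[Ef HF]] := H.
  - by apply: blks_rcons; [exact: blks_up | exact: blk_new].
  - by move=> f; rewrite mem_rcons inE => /orP[/eqP->|/sE].
  - by left; exists s' => //; exists (e :: p); rewrite -cat_rcons.
  - by right; split=> // p; rewrite -cat_rcons; exact: HF.
split=> [H p lp|H e eE p]; last exact: H.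
case: p lp => [|e p] lp.
  by case: lp => sz; move: sz; rewrite cats0; lia.
by apply: (H e _ p lp); case: lp => _ sub _ _ _; apply: sub; rewrite mem_cat mem_head orbT.
Qed.

Lemma spec_fFirst d l r s : spec d (fFirst k d l) r s
    (forall c, c \in l -> forall p, ~ legal s c.1.1 c.1.2 c.2 p)
    (fun s' => exists c l1 l2 p, [/\ l = l1 ++ c :: l2,
       forall c', c' \in l1 -> forall p, ~ legal s c'.1.1 c'.1.2 c'.2 p,
       legal s c.1.1 c.1.2 c.2 p & added s p s']).
Proof.
elim: l => [|c l IH]; first by right.
have M : spec d (fMove k c.1.1 c.1.2 c.2 d 0 [::]) r s
    (forall p, ~ legal s c.1.1 c.1.2 c.2 p)
    (fun s' => exists2 p, legal s c.1.1 c.1.2 c.2 p & added s p s').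
  exact: (@spec_fMove c.1.1 c.1.2 c.2 d [::] r s [::] I).
case: M => [[s' Es' [p lp ap]]|[Ef HF]].
  by left; exists s'; [rewrite /= Es' | exists c, [::], l, p].
case: IH => [[s' Es' [c' [l1 [l2 [p [El H1 H2 H3]]]]]]|[Ef' HF']].
  left; exists s'; first by rewrite /= Ef.
  exists c', (c :: l1), l2, p; split=> //; first by rewrite El.
  by move=> c0; rewrite inE => /orP[/eqP->|/H1].
right; split; first by rewrite /= Ef.
by move=> c0; rewrite inE => /orP[/eqP->|/HF'].
Qed.

Lemma gain_le S p : {subset p <= E} -> size p <= 4 -> gain S p <= 4 * k.
Proof.
move=> pE p4; apply: leq_trans (_ : size p * k <= _); last by rewrite leq_mul2r p4 orbT.
apply: leq_trans (subset_leq_card (subsetDl _ _)) _.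
elim: p pE {p4} => [|e p IH] pE; rewrite /ucov ?big_nil ?cards0 // big_cons mulSn.
apply: leq_trans (leq_card_setU _ _) _; apply: leq_add; first by rewrite unif // pE ?mem_head.
by apply: IH => f fp; apply: pE; rewrite inE fp orbT.
Qed.

(** A competing path of positive gain realises its own class. The classes before the accepted one
    are infeasible, so that class is the accepted one or comes later, where ratios are no larger. *)
Lemma spec_fStep d r s : spec d (fStep k d) r s
    (forall p, jpath E p -> gain (cover (TS s 0)) p = 0)
    (fun s' => exists p w c, best E (cover (TS s 0)) p w c /\ added s p s').
Proof.
set S := cover (TS s 0).
have inC m acc w : 0 < m <= 4 -> 0 < w <= 4 * k -> (m, acc, w) \in classes k.
  move=> hm hw; rewrite mem_sort; apply/allpairsPdep.
  exists m, (acc, w); split=> //; first by rewrite mem_iota; lia.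
  by apply/allpairsP; exists (acc, w) => /=; rewrite (mem_iota 1); split=> //; do ?[by case: (acc)]; lia.
have mk p : jpath E p -> 0 < gain S p -> (size p, has (touches S) p, gain S p) \in classes k /\
    legal s (size p) (has (touches S) p) (gain S p) p.
  move=> [sz pE ad] g0; split; last by split.
  by apply: inC => //; rewrite g0 gain_le //; case/andP: sz.
case: (@spec_fFirst d (classes k) r s) => [[s' Es' [c [l1 [l2 [p [El H1 H2 H3]]]]]]|[Ef HF]]; last first.
  right; split=> // p jp; apply/eqP; rewrite eqn0Ngt; apply/negP => g0.
  by have [c1 c2] := mk _ jp g0; exact: (HF _ c1 p c2).
left; exists s' => //; exists p, c.2, (ccost c); split=> //.
have cC : c \in classes k by rewrite El mem_cat mem_head orbT.
have [m0 w0] : 0 < c.1.1 <= 4 /\ 0 < c.2.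
  move: cC; rewrite mem_sort => /allpairsPdep[m [[acc w] [mi /allpairsP[[acc' w'] /= [_ wi [-> ->]]] ->]]].
  by rewrite !mem_iota in mi wi; split=> /=; lia.
case: H2 => sz pE ad ac gl; split=> //.
- by split=> //; rewrite sz.
- by rewrite w0.
- rewrite /mcost sz /ccost leq_add2l; case: (c.1.2) ac => /= ac; last exact: leq_b1.
  by rewrite (ac isT).
move=> p' jp'; case: (posnP (gain S p')) => [->|g0]; first by rewrite mul0n.
have [c1 c2] := mk _ jp' g0.
move: c1; rewrite El mem_cat => /orP[/H1/(_ p' c2) //|].
(* Cross-multiplied ratios compare transitively because the costs in the list are positive. *)
have tr : {in classes k & &, transitive denser}.
  have cp c0 : c0 \in classes k -> 0 < ccost c0.
    rewrite mem_sort => /allpairsPdep[m [[acc w] [mi _ ->]]].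
    by rewrite mem_iota in mi; rewrite /ccost /=; lia.
  move=> c1 c0 c3 /cp p1 /cp p0 /cp p3; rewrite /denser => h1 h2.
  rewrite -(leq_pmul2r p1).
  apply: leq_trans (_ : c1.2 * ccost c3 * ccost c0 <= _).
    by rewrite mulnAC leq_mul2r h2 orbT.
  by rewrite mulnAC [X in _ <= X]mulnAC leq_mul2r h1 orbT.
have so : sorted denser (classes k) by exact: (sort_sorted denser_total).
rewrite inE => /orP[/eqP E0|c2l].
  by rewrite -E0 /= /ccost /= /mcost.
have pw : pairwise denser (classes k) by rewrite -(sorted_pairwise_in tr (allss _)).
have : denser c (size p', has (touches S) p', gain S p').
  move: (pw); rewrite El pairwise_cat /= => /and3P[_ _ /andP[/allP/(_ _ c2l)]].
  by [].
by rewrite /denser.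
Qed.

(** The separators closing hyperedges occupy distinct positions other than 0. *)
Lemma card_EN : #|E| < N.
Proof.
have u : uniq [seq epos E e | e <- enum E].
  by rewrite map_inj_in_uniq ?enum_uniq // => e f; rewrite !mem_enum; exact: epos_inj.
have N0 : 0 < N by rewrite (_ : 0 < N) //; apply: leq_trans (_ : 0 < size (bin n ++ [:: 4] ++ enc_edges (enum E))) _ => //; rewrite size_cat size_bin.
have sub : {subset [seq epos E e | e <- enum E] <= iota 1 N.-1}.
  move=> i /mapP[e]; rewrite mem_enum => eE ->; rewrite mem_iota.
  have := epos_lt eE; have := pre_gt0 E e; rewrite /epos; lia.
by have := uniq_leq_size u sub; rewrite size_map -cardE size_iota -ltnS prednK.
Qed.

(** Every vertex is covered, so its name begins at some position, and the position determines the
    vertex. *)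
Lemma card_nN : n <= N.
Proof.
pose f x := vpos E (odflt set0 [pick e in E | x \in e]) x.
have fP x : exists2 e, e \in E /\ x \in e & f x = vpos E e x.
  rewrite /f; case: pickP => [e /andP[eE xe]|H] /=; first by exists e.
  by have [e eE xe] := cov x; have := H e; rewrite eE xe.
have u : uniq [seq f x | x <- enum 'I_n].
  rewrite map_inj_uniq ?enum_uniq // => x y.
  by have [e [eE xe] ->] := fP x; have [e' [eE' ye] ->] := fP y; exact: vpos_inj.
have sub : {subset [seq f x | x <- enum 'I_n] <= iota 0 N}.
  by move=> i /mapP[x _ ->]; have [e [eE xe] ->] := fP x; rewrite mem_iota /= vpos_ltN.
by have := uniq_leq_size u sub; rewrite size_map size_enum_ord size_iota.
Qed.

(** A successful step covers a new vertex, and [n <= N] rounds are enough. A step fails only if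
    everything is covered, since otherwise a single hyperedge would be a path of positive gain. *)
Lemma ef_greedy d r s : exists q, [/\ chain E (TS s 0) (TS (ef d (fGreedy k d) r s) 0) q,
  cover (TS (ef d (fGreedy k d) r s) 0) = setT & fr [:: 0] s (ef d (fGreedy k d) r s)].
Proof.
have [[q ch] [fs H]] : (exists q, chain E (TS s 0) (TS (ef d (fGreedy k d) r s) 0) q) /\
   (fr [:: 0] s (ef d (fGreedy k d) r s) /\
   (cover (TS (ef d (fGreedy k d) r s) 0) = setT \/ N <= #|cover (TS (ef d (fGreedy k d) r s) 0)|)).
  apply: (@ef_loop d _ r s (fun i s' => (exists q, chain E (TS s 0) (TS s' 0) q) /\
    (fr [:: 0] s s' /\ (cover (TS s' 0) = setT \/ i <= #|cover (TS s' 0)|)))).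
    by split; [exists 0; exact: chain0 | split=> //; right].
  move=> i s1 iN [[q ch] [f1 H]].
  case: (spec_fStep d.+1 (upd r d i) s1) => [[s2 -> [p [w [c [bst [T2 f2]]]]]]|[-> HF]] /=.
    rewrite T2; split; first by exists (q + c); exact: chainS ch bst.
    split; first by apply: fr_trans f1 f2 _ _.
    rewrite cover_add; case: H => [->|H]; first by left; rewrite setTU.
    right; case: bst => _ /andP[w0 wg] _ _.
    have -> : cover (TS s1 0) :|: ucov p = cover (TS s1 0) :|: (ucov p :\: cover (TS s1 0)).
      by apply/setP => x; rewrite !inE; case: (x \in cover _).
    rewrite cardsU (_ : _ :&: _ = set0) ?cards0 ?subn0; last first.
      by apply/setP => x; rewrite !inE; case: (x \in cover _).
    have : 0 < #|ucov p :\: cover (TS s1 0)| by exact: leq_trans w0 wg.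
    move: H; move: #|cover _| #|_ :\: _| => a b; lia.
  split; first by exists q.
  split=> //; left; apply/setP => x; rewrite [RHS]inE; apply/negPn/negP => nx.
  have [e eE xe] := cov x.
  have jp : jpath E [:: e] by split=> // f; rewrite inE => /eqP->.
  have := HF _ jp; apply/eqP; rewrite -lt0n; apply/card_gt0P; exists x.
  by rewrite inE nx; apply/ucovP; exists e; rewrite ?mem_head.
exists q; split=> //; case: H => // H; apply/eqP; rewrite eqEcard subsetT cardsT card_ord.
exact: leq_trans card_nN H.
Qed.

End Algo.

(** * Connecting and selecting *)

Section Search.
Variables (n : nat) (E : {set {set 'I_n}}) (k : nat).
Hypothesis unif : uniform k E.
Hypothesis cov : covers E.
Hypothesis conn : hconnected E.
Hypothesis k0 : 0 < k.
Local Notation W := (enc_graph E).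
Local Notation N := (size W).
Local Notation sym := (nth 0 W).
Local Notation ef d P r s := (sem N sym d P r s).2.
Local Notation dec := (dec E).
Local Notation spec := (spec E).
Local Notation blk := (blk E).
Local Notation vert := (vert E).
Local Notation TS := (TS E).
Implicit Types (e g c : {set 'I_n}) (x y : 'I_n) (s : store) (r : nat -> nat) (d t : nat)
  (T L A B : {set {set 'I_n}}).
#[local] Opaque enc_graph.

Lemma sm_and_true d P Q r s : sem N sym d P r s = (true, s) -> sem N sym d (pAnd P Q) r s = sem N sym d Q r s.
Proof. by move=> H; rewrite /= H. Qed.
Lemma sm_and_false d P Q r s : sem N sym d P r s = (false, s) -> sem N sym d (pAnd P Q) r s = (false, s).
Proof. by move=> H; rewrite /= H. Qed.
Lemma sm_put d t v b r s : t < KN -> v < d -> sem N sym d (PPut t v b) r s = (true, put s t (r v) b).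
Proof. by move=> tK vd; rewrite /= tK vd. Qed.

Definition lab s := TS s 4 :|: TS s 5 :|: TS s 6.

Lemma dec_fLab d b r s e : blk d r b e -> dec d (fLab b) r s (e \in lab s).
Proof.
move=> B; have D t tK := @dec_TS n E d b r s t e tK B.
apply: dec_iff (dec_or (D 4 isT) (dec_or (D 5 isT) (D 6 isT))).
rewrite /lab in_setU (in_setU e); split=> [[->|[->|->]]|/orP[/orP[]|]]; rewrite ?orbT //; tauto.
Qed.

Lemma dec_fNext d r s e : blk d.+1 r d e -> dec d.+1 (pAnd (PTrk 0 d) (pAnd (pNot (fLab d))
     (fExB d.+1 (pAnd (fLab d.+1) (fAdj k d.+2 d d.+1))))) r s (e \in nextL E (TS s 0) (lab s)).
Proof.
move=> B; apply: dec_iff; last first.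
  apply: dec_and => [|_]; first by apply: dec_TS B.
  apply: dec_and => [|_]; first by apply: dec_not; exact: dec_fLab B.
  apply: (@dec_fExB _ _ _ _ _ _ (fun c => c \in lab s /\ adjacent E e c)) => c cE.
  apply: dec_and => [|_]; first by apply: dec_fLab; exact: blk_new.
  by apply: dec_fAdj => //; [exact: blk_up | exact: blk_new].
rewrite nextLP; split=> [[eT [/negP nL [c cE [cL A]]]]|[eT nL [c cL A]]].
  by split=> //; exists c.
split=> //; split; [exact/negP | exists c => //].
by move: cL; rewrite /lab !in_setU => /orP[/orP[]|]; apply: (subsetP (TS_sub E s _)).
Qed.

Lemma ef_round d j r s : j < KN -> j != 7 -> j != 0 ->
  let s' := ef d (fRound k d j) r s in
  fr [:: 7; j] s s' /\ TS s' j = TS s j :|: nextL E (TS s 0) (lab s).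
Proof.
move=> jK j7 j0 s'; rewrite /s' /fRound !ef_seq.
set s1 := ef d (pClear d 7) r s.
have [f1 T1 _] : [/\ fr [:: 7] s s1, TS s1 7 = set0 & forall i, i < N -> trk s1 7 i = false].
  by exact: ef_clear.
have N1 : nextL E (TS s1 0) (lab s1) = nextL E (TS s 0) (lab s).
  by rewrite /lab !(TS_fr E f1).
set s2 := ef d (fForB d (pAnd _ (PPut 7 d true))) r s1.
have [f2 T2] : fr [:: 7] s1 s2 /\ TS s2 7 = nextL E (TS s 0) (lab s) :&: E.
  apply: (@ef_forB n E d _ r s1 (fun A s' => fr [:: 7] s1 s' /\ TS s' 7 = nextL E (TS s 0) (lab s) :&: A)).
    by rewrite setI0.
  move=> e A s3 eE eA AE [f3 T3].
  have N3 : nextL E (TS s3 0) (lab s3) = nextL E (TS s 0) (lab s).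
    by rewrite -N1 /lab !(TS_fr E f3).
  have := @ef_and n E d.+1 _ (PPut 7 d true) _ s3 _ (dec_fNext s3 (blk_new d r eE)).
  rewrite N3 => -[[h ->]|[h ->]].
    rewrite ef_put // upd_eq; split; first exact: fr_trans f3 (fr_put _ _ _ _) _ _.
    rewrite TS_put // T3; apply/setP => f; rewrite !in_setU !in_setI in_setU in_set1.
    by case: eqP => [->|_] //=; rewrite h.
  split=> //; rewrite T3; apply/setP => f; rewrite !in_setI in_setU in_set1.
  by case: eqP => [->|_] //=; rewrite (negbTE eA) andbF; symmetry; apply/negbTE/negP => /andP[].
set s4 := ef d _ r s2.
have [f4 T4] : fr [:: j] s2 s4 /\ TS s4 j = TS s2 j :|: (TS s2 7 :&: E).
  apply: (@ef_forB n E d _ r s2 (fun A s' => fr [:: j] s2 s' /\ TS s' j = TS s2 j :|: (TS s2 7 :&: A))).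
    by rewrite setI0 setU0.
  move=> e A s3 eE eA AE [f3 T3].
  have D := @dec_TS n E d.+1 d _ s3 7 e isT (blk_new d r eE).
  have E7 : TS s3 7 = TS s2 7 by apply: (TS_fr E f3); rewrite inE eq_sym.
  case: (ef_and (PPut j d true) D); rewrite E7 => -[h ->].
    rewrite ef_put // upd_eq; split; first exact: fr_trans f3 (fr_put _ _ _ _) _ _.
    rewrite TS_put // T3; apply/setP => f; rewrite !in_setU !in_setI in_setU in_set1.
    by case: eqP => [->|_] //=; rewrite h orbT.
  split=> //; rewrite T3; apply/setP => f; rewrite !in_setU !in_setI in_setU in_set1.
  by case: eqP => [->|_] //=; rewrite (negbTE eA) (introF idP h).
split.
  apply: fr_trans f1 _ _ _; last first.
  - by move=> t; exact: id.
  - by move=> t; rewrite !inE => /eqP->; rewrite eqxx.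
  apply: fr_trans f2 f4 _ _ => t; rewrite !inE => /eqP->; rewrite eqxx ?orbT //.
rewrite T4 (TS_fr E f2) ?inE // (TS_fr E f1) ?inE //; congr (_ :|: _).
rewrite (setIidPl (TS_sub E s2 7)) T2; apply/setIidPl/subsetP => e /nextLP[eT _ _].
exact: (subsetP (TS_sub E s 0)).
Qed.

(** The disjunction measures progress: as long as [L] is not closed, every round has added a
    hyperedge. *)
Definition bfs T z0 s L lev i := [/\ layered E T z0 L lev i, closedL E T L \/ i < #|L| &
  forall e j, j < 3 -> (e \in TS s (4 + j)) = (e \in L) && (lev e %% 3 == j)].

Lemma bfs_lab T z0 s L lev i : bfs T z0 s L lev i -> lab s = L.
Proof.
case=> _ _ H; apply/setP => e; rewrite /lab !in_setU.
rewrite (H e 0) // (H e 1) // (H e 2) //; case: (e \in L) => //=.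
have H3 : lev e %% 3 < 3 by exact: ltn_pmod.
by case: (lev e %% 3) H3 => [|[|[|]]].
Qed.

Lemma bfs_round T z0 d j r s L lev i : bfs T z0 s L lev i -> TS s 0 = T -> j = i.+1 %% 3 ->
  let s' := ef d (fRound k d (4 + j)) r s in
  fr [:: 4; 5; 6; 7] s s' /\ exists L' lev', bfs T z0 s' L' lev' i.+1.
Proof.
move=> B E0 Ej s'; have j3 : j < 3 by rewrite Ej ltn_pmod.
have [f' T'] : fr [:: 7; 4 + j] s s' /\ TS s' (4 + j) = TS s (4 + j) :|: nextL E (TS s 0) (lab s).
  by apply: ef_round; rewrite ?/KN //; case: (j) j3 => [|[|[|]]].
rewrite (bfs_lab B) E0 in T'; case: B => LY C H.
split.
  case: f' => h1 h2; split=> // t nt; apply: h1; move: nt; rewrite !inE.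
  by case: (j) j3 => [|[|[|]]] //= _; case: (t) => [|[|[|[|[|[|[|[|]]]]]]]].
exists (L :|: nextL E T L), (fun e => if e \in L then lev e else i.+1); split.
- exact: layered_next.
- case: (eqVneq (nextL E T L) set0) => [N0|N0].
    by left; rewrite N0 setU0; exact: nextL_closed.
  right; case: C => [/closed_nextL C|C]; first by rewrite C eqxx in N0.
  have D : L :&: nextL E T L = set0.
    by apply/setP => e; rewrite in_setI in_set0; apply/negP => /andP[eL /nextLP[_ /negP]].
  rewrite cardsU D cards0 subn0; move: N0; rewrite -card_gt0 => N0.
  by move: C N0; move: #|L| #|nextL E T L| => a b; lia.
- move=> e j' j'3; rewrite in_setU; case: (eqVneq j' j) => [->|jj].
    rewrite T' in_setU H //; case: (boolP (e \in L)) => /= eL; last by rewrite -Ej eqxx andbT.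
    case: (boolP (e \in nextL E T L)) => [/nextLP[_ /negP//]|_]; by rewrite orbF.
  rewrite (TS_fr E f'); last by rewrite !inE; lia.
  rewrite H //; case: (boolP (e \in L)) => //= eL.
  by rewrite -Ej [j == j']eq_sym (negbTE jj) andbF.
Qed.

(** The [3 * N] rounds exceed the number of hyperedges, so the layering closes; grouping them by
    three makes the residue of the current level known to the program. *)
Lemma ef_bfs d v r s z0 : blk d r v z0 -> z0 \in TS s 0 ->
  let s' := ef d (fBFS k d v) r s in
  fr [:: 4; 5; 6; 7] s s' /\ exists L lev i, bfs (TS s 0) z0 s' L lev i /\ closedL E (TS s 0) L.
Proof.
move=> [vd sE rv] sT s'; rewrite /s' /fBFS !ef_seq.
set sa := ef d (pClear d 4) r s; set sb := ef d (pClear d 5) r sa; set sc := ef d (pClear d 6) r sb.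
have [fa Ta _] : [/\ fr [:: 4] s sa, TS sa 4 = set0 & forall i, i < N -> trk sa 4 i = false] by exact: ef_clear.
have [fb Tb _] : [/\ fr [:: 5] sa sb, TS sb 5 = set0 & forall i, i < N -> trk sb 5 i = false] by exact: ef_clear.
have [fc Tc _] : [/\ fr [:: 6] sb sc, TS sc 6 = set0 & forall i, i < N -> trk sc 6 i = false] by exact: ef_clear.
rewrite ef_put // rv; set s1 := put sc 4 (epos E z0) true.
have f1 : fr [:: 4] sc s1 by exact: fr_put.
have F : fr [:: 4; 5; 6; 7] s s1.
  apply: (@fr_trans _ [:: 4] [:: 4; 5; 6] s sa) fa _ _ _; last 2 first.
  - by move=> t; rewrite !inE => /eqP->.
  - by move=> t; rewrite !inE => /or3P[] /eqP->.
  apply: (@fr_trans _ [:: 5] [:: 4; 6] sa sb) fb _ _ _; last 2 first.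
  - by move=> t; rewrite !inE => /eqP->.
  - by move=> t; rewrite !inE => /orP[] /eqP->.
  by apply: fr_trans fc f1 _ _ => t; rewrite !inE => /eqP->.
have B0 : bfs (TS s 0) z0 s1 [set z0] (fun=> 0) 0.
  split.
  - split; rewrite ?set11 ?sub1set //; first by move=> e; rewrite in_set1 => /eqP->; rewrite eqxx.
  - by right; rewrite cards1.
  - move=> e [|[|[|]]] // _.
    + by rewrite TS_put // (TS_fr E fc) // (TS_fr E fb) // Ta setU0 andbT.
    + by rewrite (TS_fr E f1) // (TS_fr E fc) // Tb in_set0 andbF.
    + by rewrite (TS_fr E f1) // Tc in_set0 andbF.
set s2 := ef d (PEx _) r s1.
have [f2 [L [lev B]]] : fr [:: 4; 5; 6; 7] s1 s2 /\ exists L lev, bfs (TS s 0) z0 s2 L lev (3 * N).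
  apply: (@ef_loop n E d _ r s1 (fun i s' => fr [:: 4; 5; 6; 7] s1 s' /\
     exists L lev, bfs (TS s 0) z0 s' L lev (3 * i))).
    by split=> //; exists [set z0], (fun=> 0).
  move=> i s3 iN [f3 [L [lev B]]]; rewrite ef_seq ef_seq.
  have T0 s4 : fr [:: 4; 5; 6; 7] s1 s4 -> TS s4 0 = TS s 0.
    by move=> f4; rewrite (TS_fr E f4) // (TS_fr E F).
  have [g1 [L1 [lev1 B1]]] := @bfs_round _ _ d.+1 1 (upd r d i) _ _ _ _ B (T0 _ f3) ltac:(lia).
  have h1 := fr_trans f3 g1 (fun _ => id) (fun _ => id).
  have [g2 [L2 [lev2 B2]]] := @bfs_round _ _ d.+1 2 (upd r d i) _ _ _ _ B1 (T0 _ h1) ltac:(lia).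
  have h2 := fr_trans h1 g2 (fun _ => id) (fun _ => id).
  have [g3 [L3 [lev3 B3]]] := @bfs_round _ _ d.+1 0 (upd r d i) _ _ _ _ B2 (T0 _ h2) ltac:(lia).
  split; first exact: (fr_trans h2 g3 (fun _ => id) (fun _ => id)).
  by exists L3, lev3; have -> : 3 * i.+1 = (3 * i).+3 by lia.
split; first exact: (fr_trans F f2 (fun _ => id) (fun _ => id)).
exists L, lev, (3 * N); split=> //; case: B => -[_ LT _ _ _] [//|lt] _.
have : #|L| <= #|E| by apply: subset_leq_card; apply: subset_trans LT (TS_sub E s 0).
have := card_EN E; lia.
Qed.

Lemma dec_fCovL d v r s x : vert d r v x -> dec d (fCovL d v) r s (x \in cover (lab s)).
Proof.
move=> V; apply: dec_iff; last first.
  apply: (@dec_fExB _ _ _ _ _ _ (fun e => e \in lab s /\ x \in e)) => e eE.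
  apply: dec_and => [|_]; first by apply: dec_fLab; exact: blk_new.
  by apply: dec_fMem; [exact: vert_up V | exact: blk_new].
split=> [[e eE [eT xe]]|/bigcupP[e eT xe]]; first by apply/bigcupP; exists e.
exists e => //.
by move: eT; rewrite /lab !in_setU => /orP[/orP[]|]; apply: (subsetP (TS_sub E s _)).
Qed.

Definition crosses (S : {set 'I_n}) g := (exists2 y, y \in g & y \in S) /\ (exists2 z, z \in g & ~ z \in S).

Lemma spec_fCross d r s : spec d (fCross d) r s
  (forall g, g \in E -> ~ crosses (cover (lab s)) g)
  (fun s' => exists2 g, g \in E /\ crosses (cover (lab s)) g & s' = put s 0 (epos E g) true).
Proof.
apply: spec_fExB => g gE; have B := blk_new d r gE.
have D : dec d.+1 (pAnd (fExV d.+1 d (fCovL d.+2 d.+1)) (fExV d.+1 d (pNot (fCovL d.+2 d.+1))))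
    (upd r d (epos E g)) s (crosses (cover (lab s)) g).
  apply: dec_and => [|_]; apply: (dec_fExV B) => x xg; last apply: dec_not;
    by apply: dec_fCovL; exact: vert_new.
case: D => b H Eb; case: b H Eb => H Eb; [left|right].
  exists (put s 0 (epos E g) true); first by rewrite (sm_and_true _ Eb) sm_put // upd_eq.
  by exists g => //; split=> //; exact: H.1.
by split; [exact: sm_and_false | move/H.2].
Qed.

(** A hyperedge crossing the boundary of the component of [z0] removes a root when added, and there
    are at most [#|E| < N] roots. If none crosses, connectivity of [E] makes the component cover
    every vertex, so each member of the set meets it and belongs to it. *)
Lemma ef_connect d v r s z0 R q : blk d r v z0 -> rooted E z0 (TS s 0) R q ->
  cover (TS s 0) = setT ->
  let s' := ef d (fConnect k d v) r s in
  [/\ fr [:: 0; 4; 5; 6; 7] s s', cover (TS s' 0) = setT, z0 \in TS s' 0,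
      (forall f, f \in TS s' 0 -> reach E (TS s' 0) z0 f) & #|TS s' 0| <= 1 + q].
Proof.
move=> B RT C s'.
have [f' [C' [R' [[sR RT' H cR] D]]]] : fr [:: 0; 4; 5; 6; 7] s s' /\ (cover (TS s' 0) = setT /\
   exists R', rooted E z0 (TS s' 0) R' q /\
   ((forall f, f \in TS s' 0 -> reach E (TS s' 0) z0 f) \/ #|R'| + N <= #|E|)).
  apply: (@ef_loop n E d _ r s (fun i s' => fr [:: 0; 4; 5; 6; 7] s s' /\ (cover (TS s' 0) = setT /\
   exists R', rooted E z0 (TS s' 0) R' q /\
   ((forall f, f \in TS s' 0 -> reach E (TS s' 0) z0 f) \/ #|R'| + i <= #|E|)))).
    split=> //; split=> //; exists R; split=> //; right; rewrite addn0.
    case: RT => _ RT _ _; apply: subset_leq_card; exact: subset_trans RT (TS_sub E s 0).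
  move=> i s1 iN [f1 [C1 [R1 [RT1 D1]]]]; rewrite ef_seq.
  have sT : z0 \in TS s1 0 by case: RT1 => sR /subsetP RT1 _ _; exact: RT1.
  have [fb [L [lev [m [BF cl]]]]] := ef_bfs (blk_up i B) sT.
  set s2 := ef d.+1 (fBFS k d.+1 v) (upd r d i) s1 in fb BF *.
  have T2 : TS s2 0 = TS s1 0 by exact: (TS_fr E fb).
  have E2 := bfs_lab BF; case: BF => LY _ _.
  have LR := layered_reach LY cl.
  have LT : L \subset TS s1 0 by case: LY.
  have s0L : z0 \in L by case: LY.
  have sub4 : {subset [:: 4; 5; 6; 7] <= [:: 0; 4; 5; 6; 7]} by move=> t; rewrite !inE => /or4P[] /eqP->.
  have f2 : fr [:: 0; 4; 5; 6; 7] s s2 by exact: (fr_trans f1 fb (fun _ => id) sub4).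
  case: (spec_fCross d.+1 (upd r d i) s2) => [[s3 -> [g [gE [[y yg yL] [z zg zL]]] ->]]|[-> HF]] /=.
    rewrite E2 in yL zL.
    have [c cL yc] := bigcupP yL.
    have : z \in cover (TS s1 0) by rewrite C1 in_setT.
    move=> /bigcupP[t tT zt].
    have nt : ~ reach E (TS s1 0) z0 t by move/LR => tL; apply: zL; apply/bigcupP; exists t.
    have [R2 RT2 lt] := rooted_join RT1 gE (subsetP LT _ cL) ((LR c).1 cL) yc yg tT nt zt zg.
    split; first by apply: fr_trans f2 (fr_put _ _ _ _) _ _ => // t'; rewrite !inE => /eqP->.
    rewrite TS_put // T2; split.
      apply/setP => x; rewrite in_setT; apply/bigcupP.
      have : x \in cover (TS s1 0) by rewrite C1 in_setT.
      by move=> /bigcupP[f fT xf]; exists f => //; rewrite in_setU fT orbT.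
    exists R2; split=> //; case: D1 => [D1|D1]; first by case: nt; exact: D1.
    by right; apply: leq_trans D1; rewrite addnS ltn_add2r.
  split=> //; rewrite T2; split=> //; exists R1; split=> //; left=> t tT; apply/LR.
  have sE : z0 \in E by case: B.
  have covL : cover L = setT.
    apply/setP => x; rewrite in_setT; apply/negPn/negP => nx.
    have s0S : z0 \subset cover L by exact: (bigcup_sup z0).
    have [g [y [z [gE yg yS zg zS]]]] := crossing conn sE s0S nx (cov x).
    apply: (HF g gE); rewrite E2; split; [by exists y | exists z => //; exact/negP].
  have /card_gt0P[x xt] : 0 < #|t| by rewrite unif // (subsetP (TS_sub E s1 0)).
  have : x \in cover L by rewrite covL in_setT.
  move=> /bigcupP[c cL xc]; apply: (cl c t cL tT); left; apply/existsP; exists x.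
  by rewrite xt.
(* The root [z0] remains, so [#|T| + #|R'| <= 2 + q] leaves [#|T| <= 1 + q]. *)
have R0 : 0 < #|R'| by apply/card_gt0P; exists z0.
split=> //.
- exact: (subsetP RT').
- by case: D => // D; have := card_EN E; lia.
- by move: cR R0; move: #|R'| #|TS s' 0| => a b; lia.
Qed.

Lemma ef_incr d r s m : m < N -> (forall i, i < N -> trk s 2 i = (i < m)) ->
  ef d (fIncr d) r s = put s 2 m true.
Proof.
move=> mN H.
have S : spec d (fIncr d) r s (forall i, i < N -> ~ i = m) (fun s' => s' = put s 2 m true).
  apply: spec_ex => i iN.
  have D : dec d.+1 (pAnd (pNot (PTrk 2 d)) (pNot (PEx (pAnd (PLt d.+1 d) (pNot (PTrk 2 d.+1))))))
      (upd r d i) s (i = m).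
    apply: dec_iff; last first.
      apply: dec_and => [|_]; first by apply: dec_not; exact: dec_trk.
      apply: dec_not; apply: dec_ex => j jN; apply: dec_and => [|_]; first by apply: dec_lt => //; exact: leqW.
      by apply: dec_not; exact: dec_trk.
    rewrite upd_eq H //; split=> [[/negP h1 h2]|->].
      apply/eqP; rewrite eqn_leq leqNgt; apply/andP; split; last by lia.
      apply/negP => mi; apply: h2; exists m => //; rewrite !upd_eq upd_lt // upd_eq H // ltnn; split=> //.
    rewrite ltnn; split=> // -[j jN]; rewrite upd_eq upd_lt // upd_eq H //; case; lia.
  case: D => b Hb Eb; case: b Hb Eb => Hb Eb; [left|right].
    by exists (put s 2 m true) => //; rewrite (sm_and_true _ Eb) sm_put // upd_eq (Hb.1 isT).
  by split; [exact: sm_and_false | move/Hb.2].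
by case: S => [[s' -> ->]|[_ /(_ m mN)]].
Qed.

Lemma ef_count d r s : let s' := ef d (fCount d) r s in
  fr [:: 2] s s' /\ forall i, i < N -> trk s' 2 i = (i < #|TS s 0|).
Proof.
move=> s'; rewrite /s' /fCount ef_seq; set s1 := ef d (pClear d 2) r s.
have [f1 _ H1] : [/\ fr [:: 2] s s1, TS s1 2 = set0 & forall i, i < N -> trk s1 2 i = false] by exact: ef_clear.
set s2 := ef d _ r s1.
have [f2 H2] : fr [:: 2] s s2 /\ (forall i, i < N -> trk s2 2 i = (i < #|TS s 0 :&: E|)).
  apply: (@ef_forB n E d _ r s1 (fun A s' => fr [:: 2] s s' /\
     (forall i, i < N -> trk s' 2 i = (i < #|TS s 0 :&: A|)))).
    by split=> // i iN; rewrite H1 // setI0 cards0.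
  move=> e A s3 eE eA AE [f3 H3].
  have D := @dec_TS n E d.+1 d _ s3 0 e isT (blk_new d r eE).
  have E0 : TS s3 0 = TS s 0 by exact: (TS_fr E f3).
  have cA : #|TS s 0 :&: A| < N.
    by apply: leq_ltn_trans (card_EN E); apply: subset_leq_card; apply: subset_trans (subsetIr _ _) AE.
  case: (ef_and (fIncr d.+1) D); rewrite E0 => -[h ->].
    rewrite (ef_incr _ _ cA H3); split; first exact: fr_trans f3 (fr_put _ _ _ _) _ _.
    move=> i iN; rewrite /= setIUr (_ : TS s 0 :&: [set e] = [set e]); last first.
      by apply/setIidPr; rewrite sub1set.
    rewrite cardsU1 in_setI (negbTE eA) andbF add1n ltnS.
    have := H3 i iN; case: ifP => [/eqP-> _|/negbT ne ->]; first by rewrite leqnn.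
    by rewrite [RHS]leq_eqVlt (negbTE ne).
  split=> // i iN; rewrite H3 // setIUr (_ : TS s 0 :&: [set e] = set0) ?set0U //.
  by apply/setP => f; rewrite in_setI in_set1 in_set0; case: eqP => [->|_]; rewrite ?andbF ?andbT //; exact/negbTE/negP.
by split=> // i iN; rewrite H2 // (setIidPl (TS_sub E s 0)).
Qed.

Lemma ef_copy d t t' r s : t < KN -> t' < KN -> t != t' -> let s' := ef d (fCopy d t t') r s in
  fr [:: t'] s s' /\ forall i, i < N -> trk s' t' i = trk s t i.
Proof.
move=> tK tK' ne s'.
have [f' H] : fr [:: t'] s s' /\ (forall i, i < N -> i < N -> trk s' t' i = trk s t i).
  apply: (@ef_loop n E d _ r s (fun m s' => fr [:: t'] s s' /\
    (forall i, i < m -> i < N -> trk s' t' i = trk s t i))) => //.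
  move=> m s1 mN [f1 H1].
  have -> : ef d.+1 (PIf (PTrk t d) (PPut t' d true) (PPut t' d false)) (upd r d m) s1
     = put s1 t' m (trk s t m).
    have D := @dec_trk n E d.+1 d t (upd r d m) s1 tK (ltnSn d).
    have Et : trk s1 t = trk s t by apply: f1.1; rewrite inE.
    rewrite upd_eq Et in D.
    case: (ef_if (PPut t' d true) (PPut t' d false) D) => -[h ->]; rewrite ef_put // upd_eq.
      by rewrite h.
    by rewrite (introF idP h).
  split; first exact: fr_trans f1 (fr_put _ _ _ _) _ _.
  move=> i; rewrite ltnS leq_eqVlt /= eqxx => /orP[/eqP->|im iN]; first by rewrite eqxx.
  by rewrite (ltn_eqF im); exact: H1.
by split=> // i iN; exact: H.
Qed.

Lemma TS_eq s s' t t' : (forall i, i < N -> trk s' t' i = trk s t i) -> TS s' t' = TS s t.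
Proof. by move=> H; apply/setP => e; rewrite !inE; case: (boolP (e \in E)) => //= /(epos_lt (E := E))/H. Qed.

(** The greedy run from [e] is remembered, since its cost is bounded only later, for an [e] that
    begins an optimal walk. *)
Definition result e T := [/\ T \subset E, cover T = setT, e \in T,
  forall f, f \in T -> reach E T e f & exists q T0, [/\ chain E [set e] T0 q, cover T0 = setT & #|T| <= 1 + q]].

Definition unary s T := forall i, i < N -> trk s 3 i = (i < #|T|).

Lemma ef_try d v r s e : blk d r v e ->
  let s' := ef d (fTry k d v) r s in
  out s' = out s /\ exists2 T, result e T &
    (if [exists i : 'I_N, trk s 3 i && (#|T| <= i)] then TS s' 1 = T /\ unary s' T
     else trk s' 1 = trk s 1 /\ trk s' 3 = trk s 3).
Proof.
move=> B s'; case: (B) => vd eE rv; rewrite /s' /fTry; do 5!rewrite ef_seq.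
set s1 := ef d (pClear d 0) r s.
have [f1 T1 _] : [/\ fr [:: 0] s s1, TS s1 0 = set0 & forall i, i < N -> trk s1 0 i = false] by exact: ef_clear.
rewrite ef_put // rv; set s2 := put s1 0 _ true.
have f2 : fr [:: 0] s1 s2 by exact: fr_put.
have T2 : TS s2 0 = [set e] by rewrite TS_put // T1 setU0.
have [q [ch C3 f3]] := ef_greedy unif cov d r s2.
set s3 := ef d (fGreedy k d) r s2 in ch C3 f3 *; rewrite T2 in ch.
have [R RT] := chain_rooted ch.
have [f4 C4 e4 r4 c4] := ef_connect B RT C3.
set s4 := ef d (fConnect k d v) r s3 in f4 C4 e4 r4 c4 *.
have [f5 H5] := ef_count d r s4; set s5 := ef d (fCount d) r s4 in f5 H5 *.
have tr t : t \notin [:: 0; 2; 4; 5; 6; 7] -> trk s5 t = trk s t.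
  rewrite !inE !negb_or => /and5P[t0 t2 t4 t5 /andP[t6 t7]].
  rewrite f5.1 ?inE // f4.1 ?inE ?negb_or ?t0 ?t4 ?t5 ?t6 //.
  by rewrite f3.1 ?inE // f2.1 ?inE // f1.1 ?inE.
have o5 : out s5 = out s by rewrite f5.2 f4.2 f3.2 f2.2 f1.2.
have D : dec d (fBetter d) r s5 (exists2 i, i < N & trk s5 3 i /\ ~ trk s5 2 i).
  apply: dec_ex => i iN; rewrite -{2 3}(upd_eq r d i); apply: dec_and => [|_]; first exact: dec_trk.
  by apply: dec_not; exact: dec_trk.
have res : result e (TS s4 0).
  by split=> //; [exact: TS_sub | exists q, (TS s3 0)].
have Bt : (exists2 i, i < N & trk s5 3 i /\ ~ trk s5 2 i) <-> [exists i : 'I_N, trk s 3 i && (#|TS s4 0| <= i)].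
  rewrite tr //; split=> [[i iN [h1]]|/existsP[i /andP[h1 h2]]].
    rewrite H5 // => /negP; rewrite -leqNgt => h2; apply/existsP; exists (Ordinal iN); by rewrite h1.
  by exists i => //; split=> //; rewrite H5 //; apply/negP; rewrite -leqNgt.
case: (ef_if (pSeq (fCopy d 0 1) (fCopy d 2 3)) (PConst true) D) => -[h ->]; last first.
  split=> //; exists (TS s4 0) => //.
  case: ifP => [/Bt//|_]; by rewrite /= !tr.
rewrite ef_seq.
have [f6 H6] := @ef_copy d 0 1 r s5 isT isT isT; set s6 := ef d (fCopy d 0 1) r s5 in f6 H6 *.
have [f7 H7] := @ef_copy d 2 3 r s6 isT isT isT; set s7 := ef d (fCopy d 2 3) r s6 in f7 H7 *.
split; first by rewrite f7.2 f6.2.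
exists (TS s4 0) => //; rewrite Bt.1 //; split.
  rewrite (TS_fr E f7) // (TS_eq H6); exact: (TS_fr E f5).
by move=> i iN; rewrite H7 // f6.1 // H5.
Qed.

Lemma ef_search r s : E != set0 ->
  let s' := ef 0 (fSearch k) r s in
  [/\ out s' = out s, exists e, result e (TS s' 0) &
      forall e, e \in E -> exists2 T, result e T & #|TS s' 0| <= #|T|].
Proof.
move=> E0 s'; rewrite /s' /fSearch !ef_seq.
set s1 := ef 0 (PEx _) r s.
have [o1 H1] : out s1 = out s /\ (forall i, i < N -> i < N -> trk s1 3 i).
  apply: (@ef_loop n E 0 _ r s (fun m s' => out s' = out s /\ (forall i, i < m -> i < N -> trk s' 3 i))) => //.
  move=> m s2 mN [o2 H2]; rewrite ef_put // upd_eq; split=> // i; rewrite ltnS leq_eqVlt /=.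
  by case: eqP => // _; exact: H2.
set s2 := ef 0 (fForB _ _) r s1.
have [o2 [[Ez _]|[h1 h2 h3]]] : out s2 = out s /\ ((E = set0 /\ forall i, i < N -> trk s2 3 i) \/
   [/\ exists e, result e (TS s2 1), unary s2 (TS s2 1) &
     forall e, e \in E -> exists2 T, result e T & #|TS s2 1| <= #|T|]).
  apply: (@ef_forB n E 0 _ r s1 (fun A s2 => out s2 = out s /\ ((A = set0 /\ forall i, i < N -> trk s2 3 i) \/
   [/\ exists e, result e (TS s2 1), unary s2 (TS s2 1) &
     forall e, e \in A -> exists2 T, result e T & #|TS s2 1| <= #|T|]))).
    by split=> //; left; split=> // i iN; exact: H1.
  move=> e A s3 eE eA AE [o3 H3].
  have [o4 [T res H4]] := @ef_try 1 0 (upd r 0 (epos E e)) s3 e (blk_new 0 r eE).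
  set s4 := ef 1 (fTry k 1 0) _ s3 in o4 H4 *.
  split; first by rewrite o4.
  have TN : #|T| < N.
    by apply: leq_ltn_trans (card_EN E); apply: subset_leq_card; case: res.
  right; case: H3 => [[A0 h]|[h1 h2 h3]].
    move: H4; case: ifP => [_ [h4 h5]|/existsP[]]; last by exists (Ordinal TN); rewrite h //= leqnn.
    rewrite h4; split=> //; first by exists e.
    by move=> f; rewrite A0 setU0 in_set1 => /eqP->; exists T.
  move: H4; case: ifP => [/existsP[i /andP[t3 le]] [h4 h5]|ne [h4 h5]].
    rewrite h2 // in t3; have lt := leq_ltn_trans le t3.
    rewrite h4; split=> //; first by exists e.
    move=> f; rewrite in_setU in_set1 => /orP[/eqP->|/h3[T' r' l']]; first by exists T.
    by exists T' => //; exact: leq_trans (ltnW lt) l'.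
  have E1 : TS s4 1 = TS s3 1 by apply: TS_eq => i _; rewrite h4.
  rewrite E1; split=> //; first by move=> i iN; rewrite h5 h2.
  move=> f; rewrite in_setU in_set1 => /orP[/eqP->|/h3 //]; exists T => //.
  rewrite leqNgt; apply/negP => lt; case/negP: (negbT ne); apply/existsP.
  by exists (Ordinal TN); rewrite h2 //= lt leqnn.
- by rewrite Ez eqxx in E0.
have [f3 H3] := @ef_copy 0 1 0 r s2 isT isT isT; set s3 := ef 0 (fCopy 0 1 0) r s2 in f3 H3 *.
have E3 : TS s3 0 = TS s2 1 by exact: TS_eq.
by rewrite E3; split=> //; rewrite f3.2.
Qed.

End Search.

(** * The tour *)

(* Adjacent hyperedges lie in layers at distance at most one, so residues modulo 3 suffice. *)
Definition fUp k d b c := pAnd (PTrk 0 b) (pAnd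
  (pOr (pAnd (PTrk 4 b) (PTrk 5 c)) (pOr (pAnd (PTrk 5 b) (PTrk 6 c)) (pAnd (PTrk 6 b) (PTrk 4 c))))
  (fAdj k d c b)).
(** Of all possible parents the one with the leftmost separator is taken, so the tree is determined
    by the layers and need not be stored. *)
Definition fPar k d b c := pAnd (fUp k d b c) (pNot (fExB d (pAnd (PLt d b) (fUp k d.+1 d c)))).
Definition fEcho v := foldr (fun x P => PIf (PSym x v) (PEmit x) P) (PConst true) (iota 1 4).
Definition fEmit d v := PEx (pDo (pAnd (pAnd (pNot (PLt v d))
  (pNot (PEx (pAnd (PSym 4 d.+1) (pAnd (pNot (PLt d.+1 d)) (PLt d.+1 v)))))) (fEcho d))).
(** The final constant turns the false answer of the copying loop into success. *)
Definition fGo d b c := pSeq (PPut 9 b false) (pSeq (PPut 9 c true) (pSeq (PPut 8 c true)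
  (pSeq (fEmit d c) (PConst true)))).
Definition fDown k d b := fExB d (pAnd (pAnd (PTrk 0 d) (pAnd (pNot (PTrk 8 d)) (fPar k d.+1 b d)))
  (fGo d.+1 b d)).
Definition fBack k d b := pAnd (fExB d (pAnd (PTrk 0 d) (pNot (PTrk 8 d))))
  (fExB d (pAnd (fPar k d.+1 d b) (fGo d.+1 b d))).
Definition fStroll k d := fExB d (pAnd (PTrk 9 d) (pOr (fDown k d.+1 d) (fBack k d.+1 d))).
Definition fTour k := fExB 0 (pAnd (PTrk 0 0) (pSeq (fBFS k 1 0) (pSeq (pClear 1 8) (pSeq (pClear 1 9)
  (pSeq (PPut 8 0 true) (pSeq (PPut 9 0 true) (pSeq (fEmit 1 0)
  (pSeq (PEx (pDo (PEx (pDo (fStroll k 3))))) (PConst true))))))))).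

(** * Depth-first tours of a tree *)

Section DFS.
Variables (n : nat) (E : {set {set 'I_n}}) (T : {set {set 'I_n}}) (z : {set 'I_n}).
Variables (par : {set 'I_n} -> {set 'I_n}) (lev : {set 'I_n} -> nat).
Hypothesis zT : z \in T.
Hypothesis parz : par z = z.
Hypothesis parT : forall c, c \in T -> c != z ->
  [/\ par c \in T, adjacent E c (par c) & lev c = (lev (par c)).+1].
Hypothesis levz : lev z = 0.
Implicit Types (V : {set {set 'I_n}}) (c f v : {set 'I_n}) (w : seq {set 'I_n}).

Definition child V c f := [&& f \in T, f \notin V, f != z & par f == c].

(* The walk [w] makes one step down per new hyperedge and its remaining steps go up: this is the
   equation between [size w] and [lev c]. *)
Definition dfs V c w := [/\ [/\ c \in V, z \in V, V \subset T & forall v, v \in V -> par v \in V],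
  [/\ w != [::], last set0 w = c, {subset w <= T}, {subset V <= w} & adjs E w],
  size w + (lev c).+1 = 2 * #|V|,
  forall v f, v \in V -> child V v f -> exists j, iter j par c = v &
  V = T -> 0 < lev c \/ #|T| = 1].

Lemma adjs_rcons w f : adjs E w -> w != [::] -> adjacent E (last set0 w) f -> adjs E (rcons w f).
Proof.
move=> H w0 A i; rewrite size_rcons ltnS => li; rewrite nth_rcons li nth_rcons.
case: (ltngtP i.+1 (size w)) li => // [l _|Ei _]; first exact: H.
by rewrite (_ : nth set0 w i = last set0 w) // -nth_last -Ei.
Qed.

Lemma dfs_init : dfs [set z] z [:: z].
Proof.
split.
- by split; rewrite ?set11 ?sub1set // => v; rewrite !in_set1 => /eqP->; rewrite parz.
- by split=> // e; rewrite ?inE // => /eqP->.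
- by rewrite levz cards1.
- by move=> v f; rewrite inE => /eqP-> _; exists 0.
- by move=> <-; right; rewrite cards1.
Qed.

Lemma dfs_down V c w f : dfs V c w -> child V c f -> dfs (f |: V) f (rcons w f).
Proof.
move=> [[cV zV VT pV] [w0 lw wT Vw aw] sz anc _] /and4P[fT fV fz /eqP pf].
have [_ A lf] := parT fT fz; rewrite pf in A lf.
split.
- split; rewrite ?in_setU ?set11 ?zV ?orbT ?subUset ?sub1set ?fT //.
  by move=> v; rewrite !in_setU !in_set1 => /orP[/eqP->|/pV->]; rewrite ?pf ?cV orbT.
- split; rewrite ?last_rcons //.
  + by case: (w).
  + by move=> e; rewrite mem_rcons inE => /orP[/eqP->|/wT].
  + by move=> e; rewrite mem_rcons in_setU in_set1 inE => /orP[->|/Vw->]; rewrite ?orbT.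
  + by apply: adjs_rcons => //; rewrite lw; exact: adjacent_sym.
- rewrite size_rcons lf cardsU1 fV; move: sz; move: #|V| => m; lia.
- move=> v g; rewrite in_setU in_set1 => vV /and4P[gT]; rewrite in_setU negb_or => /andP[_ gV] gz pg.
  case/orP: vV => [/eqP->|vV]; first by exists 0.
  have [|j Ej] := anc v g vV; first by apply/and4P.
  by exists j.+1; rewrite iterSr pf.
- by move=> _; left; rewrite lf.
Qed.

(** Visited hyperedges with unvisited children are ancestors of [c] other than [c] itself, hence
    ancestors of its parent. *)
Lemma dfs_up V c w : dfs V c w -> (forall f, ~~ child V c f) -> V != T -> c != z ->
  dfs V (par c) (rcons w (par c)).
Proof.
move=> [[cV zV VT pV] [w0 lw wT Vw aw] sz anc _] nc VnT cz.
have cT := subsetP VT _ cV; have [pT A lc] := parT cT cz.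
split.
- by split=> //; exact: pV.
- split; rewrite ?last_rcons //.
  + by case: (w).
  + by move=> e; rewrite mem_rcons inE => /orP[/eqP->|/wT].
  + by move=> e eV; rewrite mem_rcons inE (Vw e eV) orbT.
  + by apply: adjs_rcons => //; rewrite lw.
- by rewrite size_rcons addSnnS -lc.
- move=> v f vV cf; have [[|j] Ej] := anc v f vV cf.
    by move: cf; rewrite -Ej /= (negbTE (nc f)).
  by exists j; rewrite -iterSr.
- by move=> VT'; rewrite VT' eqxx in VnT.
Qed.

(** The only ancestor of the root is the root, so no visited hyperedge has an unvisited child;
    induction on levels then reaches all of [T]. *)
Lemma dfs_stuck V w : dfs V z w -> (forall f, ~~ child V z f) -> V = T.
Proof.
move=> [[_ zV VT pV] _ _ anc _] nc.
have iz j : iter j par z = z by elim: j => //= j ->.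
have no v f : v \in V -> ~~ child V v f.
  move=> vV; apply/negP => cf; have [j] := anc v f vV cf; rewrite iz => Ev.
  by move: cf; rewrite -Ev (negbTE (nc f)).
apply/eqP; rewrite eqEsubset VT; apply/subsetP => f.
move: {-1}(lev f) (leqnn (lev f)) => m; elim: m f => [|m IH] f lf fT;
  case: (eqVneq f z) => [-> //|fz]; have [pT _ Ef] := parT fT fz; first by rewrite Ef in lf.
have pfV : par f \in V by apply: IH => //; rewrite Ef in lf.
apply/negPn/negP => fV; have := no _ f pfV.
by rewrite /child fT fV fz eqxx.
Qed.

End DFS.

(** * The tour program *)

Section Tour.
Variables (n : nat) (E : {set {set 'I_n}}) (k : nat).
Hypothesis unif : uniform k E.
Hypothesis k0 : 0 < k.
Local Notation W := (enc_graph E).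
Local Notation N := (size W).
Local Notation sym := (nth 0 W).
Local Notation sm := (sem N sym).
Local Notation ef d P r s := (sem N sym d P r s).2.
Local Notation dec := (dec E).
Local Notation spec := (spec E).
Local Notation blk := (blk E).
Local Notation TS := (TS E).
Implicit Types (e g c f : {set 'I_n}) (s : store) (r : nat -> nat) (d t : nat).
#[local] Opaque enc_graph.

Lemma sm_or_true d P Q r s s' : sm d P r s = (true, s') -> sm d (pOr P Q) r s = (true, s').
Proof. by move=> H; rewrite /= H. Qed.
Lemma sm_or_false d P Q r s : sm d P r s = (false, s) -> sm d (pOr P Q) r s = sm d Q r s.
Proof. by move=> H; rewrite /= H. Qed.

Lemma TS_trk s s' t : trk s' = trk s -> TS s' t = TS s t.
Proof. by move=> h; apply/setP => e; rewrite !inE h. Qed.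

Lemma TS_unput e s t : e \in E -> TS (put s t (epos E e) false) t = TS s t :\ e.
Proof.
move=> eE; apply/setP => f; rewrite !inE /= eqxx.
case: (boolP (f \in E)) => fE /=; last by rewrite andbF.
have -> : (epos E f == epos E e) = (f == e) by apply/eqP/eqP => [/epos_inj|->] //; exact.
by case: eqP; rewrite ?andbT.
Qed.

Lemma sm_echo d v r s : v < d -> r v < N ->
  sm d (fEcho v) r s = (true, emit s (sym (r v))).
Proof.
move=> vd vN; have H := allP (word_ok E) (sym (r v)) (mem_nth 0 vN).
have /or4P[] : [|| sym (r v) == 1, sym (r v) == 2, sym (r v) == 3 | sym (r v) == 4].
  by move: H; case: (sym (r v)) => [|[|[|[|[|]]]]].
all: by move=> /eqP Es; rewrite /fEcho; do 4!rewrite /= ?vd ?Es.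
Qed.

Lemma ef_emit d v r s e : blk d r v e ->
  trk (ef d (fEmit d v) r s) = trk s /\ out (ef d (fEmit d v) r s) = out s ++ enc_set e ++ [:: 4].
Proof.
move=> [vd eE rv].
pose inb j := (size (pre E e) <= j) && (j <= epos E e).
have [-> ->] : trk (ef d (fEmit d v) r s) = trk s /\
   out (ef d (fEmit d v) r s) = out s ++ [seq sym j | j <- iota 0 N & inb j].
  apply: (@ef_loop n E d _ r s (fun i s' => trk s' = trk s /\
     out s' = out s ++ [seq sym j | j <- iota 0 i & inb j])); first by rewrite cats0.
  move=> i s1 iN [t1 o1].
  have D : dec d.+1 (pAnd (pNot (PLt v d))
     (pNot (PEx (pAnd (PSym 4 d.+1) (pAnd (pNot (PLt d.+1 d)) (PLt d.+1 v)))))) (upd r d i) s1 (inb i).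
    apply: dec_iff; last first.
      apply: dec_and => [|_]; first by apply: dec_not; apply: dec_lt => //; exact: leqW.
      apply: dec_not; apply: dec_ex => j jN; apply: dec_and => [|_]; first exact: dec_sym.
      apply: dec_and => [|_]; first by apply: dec_not; apply: dec_lt.
      by apply: dec_lt => //; lia.
    have u1 j : upd (upd r d i) d.+1 j d.+1 = j by rewrite upd_eq.
    have u2 j : upd (upd r d i) d.+1 j d = i by rewrite upd_lt // upd_eq.
    have u3 j : upd (upd r d i) d.+1 j v = epos E e by rewrite upd_lt ?upd_lt //; exact: leqW.
    rewrite upd_eq upd_lt // rv /inb; split=> [[h1 h2]|/andP[h1 h2]].
      apply/andP; split; last by lia.
      rewrite leqNgt; apply/negP => lt; apply: h2; exists (size (pre E e)).-1.
        by have := epos_lt eE; rewrite /epos; lia.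
      rewrite u1 u2 u3 sym_prev //.
      by have := pre_gt0 E e; split=> //; split; rewrite ?/epos; lia.
    split; first by lia.
    move=> [j jN]; rewrite u1 u2 u3 => -[s4 [h3 h4]].
    by apply: (no4 eE _ s4); lia.
  have Ei : iota 0 i.+1 = rcons (iota 0 i) i by rewrite -cats1 -[i.+1]addn1 iotaD.
  rewrite Ei filter_rcons; case: (ef_and (fEcho d) D) => -[h ->]; last first.
    by rewrite (introF idP h).
  rewrite h sm_echo ?upd_eq //= o1 map_rcons rcons_cat; by split.
split=> //; congr (_ ++ _).
have -> : [seq j <- iota 0 N | inb j] = iota (size (pre E e)) (size (enc_set e)).+1.
  have lt := epos_lt eE; rewrite /epos in lt.
  have EN : N = size (pre E e) + ((size (enc_set e)).+1 + (N - (size (pre E e) + (size (enc_set e)).+1))) by lia.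
  rewrite EN iotaD iotaD !filter_cat add0n.
  rewrite [X in X ++ _](@eq_in_filter _ _ pred0) ?filter_pred0; last first.
    by move=> j; rewrite mem_iota /inb => /andP[_]; rewrite add0n => l; apply/negbTE; lia.
  rewrite [X in _ ++ (X ++ _)](@eq_in_filter _ _ predT) ?filter_predT; last first.
    by move=> j; rewrite mem_iota /inb /epos /= => l; lia.
  rewrite [X in _ ++ (_ ++ X)](@eq_in_filter _ _ pred0) ?filter_pred0 ?cats0 //.
  by move=> j; rewrite mem_iota /inb /epos /= => l; apply/negbTE; lia.
apply: (eq_from_nth (x0 := 0)) => [|i].
  by rewrite size_map size_iota size_cat /= addn1.
rewrite size_map size_iota ltnS => li.
rewrite (nth_map 0) ?size_iota ?ltnS // nth_iota ?ltnS // nth_cat.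
case: (ltnP i (size (enc_set e))) => l; first exact: sym_set.
have -> : i = size (enc_set e) by apply/eqP; rewrite eqn_leq li l.
by rewrite subnn; exact: sym_epos.
Qed.

Definition moved s c f s' := [/\ forall t, t != 8 -> t != 9 -> trk s' t = trk s t,
  TS s' 8 = f |: TS s 8, TS s' 9 = f |: (TS s 9 :\ c) & out s' = out s ++ enc_set f ++ [:: 4]].

Lemma sm_go d b v r s c f : blk d r b c -> blk d r v f ->
  exists2 s', sm d (fGo d b v) r s = (true, s') & moved s c f s'.
Proof.
move=> [bd cE rb] B; case: (B) => vd fE rv; rewrite /fGo !sm_seq !ef_put // rb rv.
set s1 := put s 9 (epos E c) false; set s2 := put s1 9 _ true; set s3 := put s2 8 _ true.
have [t4 o4] := ef_emit s3 B; set s4 := ef d (fEmit d v) r s3 in t4 o4 *.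
exists s4 => //; have T4 t : TS s4 t = TS s3 t by exact: TS_trk.
split.
- by move=> t t8 t9; rewrite t4 /= (negbTE t8) (negbTE t9).
- by rewrite T4 TS_put.
- have -> : TS s4 9 = TS s2 9 by rewrite T4 (TS_fr E (fr_put 8 _ _ _)).
  by rewrite TS_put // TS_unput.
- by rewrite o4.
Qed.

Section Walk.
Variables (T : {set {set 'I_n}}) (z : {set 'I_n}).
Variables (par : {set 'I_n} -> {set 'I_n}) (lev : {set 'I_n} -> nat).
Hypothesis TE : T \subset E.
Hypothesis zT : z \in T.
Hypothesis parz : par z = z.
Definition up b c := [/\ b \in T, (lev b).+1 = lev c & adjacent E c b].
Hypothesis parP : forall c, c \in T -> c != z ->
  up (par c) c /\ forall b, up b c -> epos E (par c) <= epos E b.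
Hypothesis levz : lev z = 0.
Hypothesis levA : forall b c, b \in T -> c \in T -> adjacent E b c -> lev b <= (lev c).+1.

Definition tracks s := TS s 0 = T /\
  forall e j, j < 3 -> (e \in TS s (4 + j)) = (e \in T) && (lev e %% 3 == j).

Lemma dec_fUp d b v r s g c : tracks s -> blk d r b g -> blk d r v c -> c \in T ->
  dec d (fUp k d b v) r s (up g c).
Proof.
move=> [T0 TL] B V cT.
have D t (tK : t < KN) := dec_TS s tK B; have D' t (tK : t < KN) := dec_TS s tK V.
have DA := dec_fAdj unif s V B.
have DL := dec_or (dec_and (D 4 isT) (fun _ => D' 5 isT))
  (dec_or (dec_and (D 5 isT) (fun _ => D' 6 isT)) (dec_and (D 6 isT) (fun _ => D' 4 isT))).
apply: dec_iff (dec_and (D 0 isT) (fun _ => dec_and DL (fun _ => DA))).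
rewrite T0 !(TL _ 0) // !(TL _ 1) // !(TL _ 2) // cT /=; split.
  move=> [gT [H A]]; split=> //; rewrite gT /= in H.
  have := levA cT gT A; have := levA gT cT (adjacent_sym A).
  by case: H => [[/eqP h1 /eqP h2]|[[/eqP h1 /eqP h2]|[/eqP h1 /eqP h2]]]; lia.
move=> [gT El A]; split=> //; split=> //; rewrite gT /= -El.
have : lev g %% 3 < 3 by exact: ltn_pmod.
case Em : (lev g %% 3) => [|[|[|]]] // _; [left|right; left|right; right]; split=> //; apply/eqP; lia.
Qed.

Lemma dec_fPar d b v r s g c : tracks s -> blk d r b g -> blk d r v c -> c \in T ->
  dec d (fPar k d b v) r s (g = par c /\ c != z).
Proof.
move=> G B V cT; case: (B) => bd gE rb; apply: dec_iff; last first.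
  apply: dec_and => [|_]; first exact: dec_fUp G B V cT.
  apply: dec_not; apply: (@dec_fExB _ _ _ _ _ _ (fun f => epos E f < epos E g /\ up f c)) => f fE.
  apply: dec_and => [|_].
    have := @dec_lt n E d.+1 d b (upd r d (epos E f)) s (ltnSn d) (leqW bd).
    by rewrite upd_eq upd_lt // rb.
  by apply: dec_fUp; [| exact: blk_new | exact: blk_up |].
split=> [[U H]|[-> cz]].
  have cz : c != z by apply/eqP => Ec; case: U; rewrite Ec levz.
  split=> //; have [U' M] := parP cT cz.
  have pE : par c \in E by apply: (subsetP TE); case: U'.
  have := M _ U; rewrite leq_eqVlt => /orP[/eqP/esym/epos_inj|lt]; first by apply.
  by case: H; exists (par c).
have [U' M] := parP cT cz; split=> // -[f fE [lt U]].
by have := M _ U; rewrite leqNgt lt.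
Qed.

Local Notation chd := (child T z par).
Local Notation dfs := (dfs E T z par lev).

Definition stroll s V c w := [/\ tracks s, TS s 8 = V, TS s 9 = [set c], out s = enc_edges w & dfs V c w].

Lemma parT c : c \in T -> c != z -> [/\ par c \in T, adjacent E c (par c) & lev c = (lev (par c)).+1].
Proof. by move=> cT cz; have [[h1 h2 h3] _] := parP cT cz. Qed.

Lemma stroll_move s s' V c w f : stroll s V c w -> moved s c f s' ->
  dfs (f |: V) f (rcons w f) -> stroll s' (f |: V) f (rcons w f).
Proof.
move=> [[T0 TL] T8 T9 os _] [tr M8 M9 M10] D.
have Tt t : t != 8 -> t != 9 -> TS s' t = TS s t by move=> h8 h9; apply/setP => e; rewrite !inE tr.
split=> //.
- split; first by rewrite Tt.
  by move=> e j j3; rewrite Tt ?TL //; lia.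
- by rewrite M8 T8.
- by rewrite M9 T9 setDv setU0.
- by rewrite M10 os -cats1 enc_edges_cat enc_edges_cons.
Qed.

(** With something unvisited and no child to descend to, the current hyperedge is not the root by
    [dfs_stuck], so the step up is possible. *)
Lemma spec_fStroll d r s V c w : stroll s V c w -> spec d (fStroll k d) r s (V = T)
  (fun s' => V != T /\ exists V' c', stroll s' V' c' (rcons w c')).
Proof.
move=> S; case: (S) => G T8 T9 os D.
have [[cV zV VT pV] _ _ _ _] := D; have cT := subsetP VT _ cV.
have cE := subsetP TE _ cT; have T0 := G.1.
pose Q s' := V != T /\ exists V' c', stroll s' V' c' (rcons w c').
have down b r' d' : blk d' r' b c ->
   spec d' (fDown k d' b) r' s (forall f, f \in E -> ~ chd V c f) Q.
  move=> B; apply: spec_fExB => f fE; have BF := blk_new d' r' fE.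
  have DD : dec d'.+1 (pAnd (PTrk 0 d') (pAnd (pNot (PTrk 8 d')) (fPar k d'.+1 b d')))
      (upd r' d' (epos E f)) s (chd V c f).
    have D0 := @dec_TS n E d'.+1 d' _ s 0 f isT BF; rewrite T0 in D0.
    have D8 := dec_not (@dec_TS n E d'.+1 d' _ s 8 f isT BF); rewrite T8 in D8.
    apply: dec_iff; last first.
      apply: dec_and D0 _ => fT; apply: dec_and D8 (fun _ => dec_fPar G (blk_up _ B) BF fT).
    rewrite /child; split=> [[-> [/negP-> [-> ->]]]|/and4P[-> /negP fV -> /eqP->]] //.
    by rewrite eqxx.
  apply: spec_iff; last first.
    apply: spec_and DD _ => ch; left.
    have [s' Es' M] := sm_go s (blk_up _ B) BF; exists s' => //.
    have D' : dfs (f |: V) f (rcons w f) by apply: dfs_down D ch => //; exact: parT.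
    split.
      by apply/eqP => EV; case/and4P: ch; rewrite EV => ->.
    by exists (f |: V), f; exact: (stroll_move S M D').
  exact: iff_refl.
have back b r' d' : (forall f, ~~ chd V c f) -> blk d' r' b c -> spec d' (fBack k d' b) r' s (V = T) Q.
  move=> nc B.
  have DD : dec d' (fExB d' (pAnd (PTrk 0 d') (pNot (PTrk 8 d')))) r' s
      (exists2 f, f \in E & f \in T /\ ~ f \in V).
    apply: (@dec_fExB _ _ _ _ _ _ (fun f => f \in T /\ ~ f \in V)) => f fE; have BF := blk_new d' r' fE.
    have D0 := @dec_TS n E d'.+1 d' _ s 0 f isT BF; rewrite T0 in D0.
    have D8 := dec_not (@dec_TS n E d'.+1 d' _ s 8 f isT BF); rewrite T8 in D8.
    exact: dec_and D0 (fun _ => D8).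
  apply: spec_iff; last first.
    apply: spec_and DD _ => un; apply: spec_fExB => f fE; have BF := blk_new d' r' fE.
    apply: (spec_and (F := False)) (dec_fPar G BF (blk_up _ B) cT) _ => -[Ef cz]; left.
    have VnT : V != T by apply/eqP => EV; case: un => h _ []; rewrite EV.
    have [s' Es' M] := sm_go s (blk_up _ B) BF; exists s' => //.
    have D' : dfs V (par c) (rcons w (par c)) by apply: dfs_up D nc VnT cz => //; exact: parT.
    split=> //.
    exists V, f; rewrite Ef in M *.
    have EV : V = par c |: V by apply/esym/setUidPr; rewrite sub1set; exact: pV.
    by rewrite EV; apply: (stroll_move S M); rewrite -EV.
  split=> [H|EV [f fE [fT []]]]; last by rewrite EV.
  apply/eqP/negPn/negP => VnT.
  have un : exists2 f, f \in E & f \in T /\ ~ f \in V.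
    have /subsetPn[f fT fV] : ~~ (T \subset V) by move: VnT; rewrite eqEsubset VT.
    by exists f; [exact: (subsetP TE) | split=> //; exact/negP].
  case: (eqVneq c z) => [Ec|cz].
    by case/eqP: VnT; rewrite Ec in D nc; apply: dfs_stuck D nc => //; exact: parT.
  have [pT _ _] := parT cT cz.
  exact: (H un (par c) (subsetP TE _ pT) (conj erefl cz)).
have SP : spec d (fStroll k d) r s (forall e, e \in E -> e = c -> V = T) Q.
  apply: spec_fExB => e eE; have B := blk_new d r eE.
  have D9 := @dec_TS n E d.+1 d _ s 9 e isT B; rewrite T9 in D9.
  apply: spec_iff; last first.
    apply: (spec_and (F := e = c -> V = T)) D9 _; rewrite in_set1 => /eqP Ec; rewrite Ec in B *.
    case: (down _ _ _ B) => [[s' Es' q]|[Ef nc]].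
      by left; exists s' => //; exact: sm_or_true.
    have nc' f : ~~ chd V c f.
      by apply/negP => ch; apply: (nc f) => //; apply: (subsetP TE); case/and4P: ch.
    case: (back _ _ _ nc' B) => [[s' Es' q]|[Eb VT']].
      by left; exists s' => //; rewrite (sm_or_false _ Ef).
    by right; rewrite (sm_or_false _ Ef).
  by split=> [H Ec|H _]; [apply: H => //; rewrite Ec set11 | ].
by apply: spec_iff SP; split=> [H|-> //]; exact: (H c).
Qed.

(** The nested loops allow [N * N] steps, whereas a tour has fewer than [2 * #|V|] entries and
    [#|V| < N]. *)
Lemma ef_strolls r s : stroll s [set z] z [:: z] -> exists V c w,
  stroll (ef 1 (PEx (pDo (PEx (pDo (fStroll k 3))))) r s) V c w /\ V = T.
Proof.
move=> S0.
pose I m s' := exists V c w, stroll s' V c w /\ (V = T \/ m < size w).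
have step m s1 r' : I m s1 -> I m.+1 (ef 3 (fStroll k 3) r' s1).
  move=> [V [c [w [S H]]]].
  case: (spec_fStroll 3 r' S) => [[s' -> [VnT [V' [c' S']]]]|[-> EV]].
    exists V', c', (rcons w c'); split=> //; right; rewrite size_rcons ltnS.
    by case: H => // EV; rewrite EV eqxx in VnT.
  by exists V, c, w; split=> //; left.
have [V [c [w [S H]]]] : I (N * N) (ef 1 (PEx (pDo (PEx (pDo (fStroll k 3))))) r s).
  apply: (@ef_loop n E 1 _ r s (fun i s' => I (i * N) s')).
    by exists [set z], z, [:: z]; split=> //; right.
  move=> i s1 iN I1; rewrite mulSn addnC.
  apply: (@ef_loop n E 2 _ _ s1 (fun j s' => I (i * N + j) s')); first by rewrite addn0.
  by move=> j s2 jN I2; rewrite addnS; exact: step.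
exists V, c, w; split=> //; case: H => // lt; exfalso.
case: S => _ _ _ _ [[_ _ VT _] _ sz _ _].
have : #|V| <= #|E| by apply: subset_leq_card; exact: subset_trans VT TE.
have := card_EN E; move: sz lt; move: #|V| #|E| N (size w) => a b m q; nia.
Qed.

End Walk.

Definition tour_of (T : {set {set 'I_n}}) (w : seq {set 'I_n}) := [/\ w != [::], {subset w <= T}, {subset T <= w}, adjs E w &
  size w = 1 \/ size w + 2 <= 2 * #|T|].

Lemma ef_tour r s e0 : e0 \in TS s 0 -> (forall f, f \in TS s 0 -> reach E (TS s 0) e0 f) ->
  out s = [::] -> exists2 w, out (ef 0 (fTour k) r s) = enc_edges w & tour_of (TS s 0) w.
Proof.
move=> e0T re os; set T := TS s 0 in e0T re *.
suff : spec 0 (fTour k) r s (forall z, z \in E -> ~ z \in T)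
   (fun s' => exists2 w, out s' = enc_edges w & tour_of T w).
  case=> [[s' -> H] //|[_ H]]; case: (H e0) => //; exact: (subsetP (TS_sub E s 0)).
(* The tour is rooted at whichever hyperedge of [T] the search finds; reachability is symmetric, so
   [T] is also reachable from there. *)
apply: spec_fExB => z zE; have B := blk_new 0 r zE; set r1 := upd r 0 _ in B *.
apply: spec_and (dec_TS s (t := 0) isT B) _ => zT; left; rewrite -/T in zT.
rewrite sm_seq; have [f1 [L [lev [i [BF cl]]]]] := ef_bfs unif k0 B zT.
set s1 := ef 1 (fBFS k 1 0) r1 s in f1 BF *.
case: BF => LY _ TL; rewrite -/T in LY cl.
have EL : L = T.
  apply/setP => f; apply/idP/idP => [|fT]; first by case: LY => _ /subsetP LT _ _ _; exact: LT.
  by apply/(layered_reach LY cl); apply: reach_trans (re _ fT); apply: reach_sym; exact: re.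
rewrite EL in LY TL cl; case: LY => _ _ levz par0 [levi levc].
have levA b c : b \in T -> c \in T -> adjacent E b c -> lev b <= (lev c).+1.
  move=> bT cT A; case: (ltnP (lev c) i) => lc; first by have [] := levc _ _ cT bT A lc.
  exact: leqW (leq_trans (levi _ bT) lc).
(* A parent function agreeing with [fPar]; at the root and outside [T] its value is [z]. *)
have parE c : exists p, (c = z -> p = z) /\
   (c \in T -> c != z -> up T lev p c /\ forall b, up T lev b c -> epos E p <= epos E b).
  case: (eqVneq c z) => [->|cz]; first by exists z; split=> // _ /eqP.
  case: (boolP (c \in T)) => cT; last by exists z; split=> // /(negP cT).
  have [b0 b0T [A El]] := par0 _ cT cz.
  pose P b := [&& b \in T, (lev b).+1 == lev c & adjb E c b].
  have Pup b : P b <-> up T lev b c.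
    by split=> [/and3P[h1 /eqP h2 /adjbP h3]|[h1 h2 h3]]; [split | apply/and3P; split=> //; [exact/eqP | exact/adjbP]].
  have Pb0 : P b0 by apply/Pup; split.
  exists [arg min_(b < b0 | P b) epos E b]; split; first by move=> Ec; rewrite Ec eqxx in cz.
  move=> _ _; case: arg_minnP => // b /Pup Ub M; split=> // b' /Pup; exact: M.
have [par parP] := fin_all_exists parE.
have parz : par z = z by exact: (parP z).1.
have TE : T \subset E by exact: TS_sub.
rewrite sm_seq; set s2 := ef 1 (pClear 1 8) r1 s1.
have [f2 T2 _] : [/\ fr [:: 8] s1 s2, TS s2 8 = set0 & forall i, i < N -> trk s2 8 i = false] by exact: ef_clear.
rewrite sm_seq; set s3 := ef 1 (pClear 1 9) r1 s2.
have [f3 T3 _] : [/\ fr [:: 9] s2 s3, TS s3 9 = set0 & forall i, i < N -> trk s3 9 i = false] by exact: ef_clear.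
have rz : r1 0 = epos E z by case: B.
rewrite sm_seq ef_put // rz; set s4 := put s3 8 _ true; have f4 : fr [:: 8] s3 s4 by exact: fr_put.
rewrite sm_seq ef_put // rz; set s5 := put s4 9 _ true; have f5 : fr [:: 9] s4 s5 by exact: fr_put.
rewrite sm_seq; have [t6 o6] := ef_emit s5 B; set s6 := ef 1 (fEmit 1 0) r1 s5 in t6 o6 *.
have T6 t : TS s6 t = TS s5 t by exact: TS_trk.
have S : stroll T z par lev s6 [set z] z [:: z].
  have Tt t : t != 8 -> t != 9 -> TS s6 t = TS s1 t.
    by move=> h8 h9; rewrite T6 (TS_fr E f5) ?inE // (TS_fr E f4) ?inE // (TS_fr E f3) ?inE // (TS_fr E f2) ?inE.
  split.
  - split; first by rewrite Tt // (TS_fr E f1).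
    by move=> e j j3; rewrite Tt ?TL //; lia.
  - by rewrite T6 (TS_fr E f5) // TS_put // (TS_fr E f3) // T2 setU0.
  - by rewrite T6 TS_put // (TS_fr E f4) // T3 setU0.
  - by rewrite o6 f5.2 f4.2 f3.2 f2.2 f1.2 os enc_edges_cons.
  - exact: dfs_init.
rewrite sm_seq; have [V [c [w [S' EV]]]] : exists V c w,
    stroll T z par lev (ef 1 (PEx (pDo (PEx (pDo (fStroll k 3))))) r1 s6) V c w /\ V = T.
  by apply: ef_strolls S => // c; exact: (parP c).2.
eexists; first reflexivity.
case: S' => _ _ _ o7 [_ [w0 _ wT Vw aw] sz _ last1]; exists w => //; rewrite EV in Vw sz.
split=> //; case: (last1 EV) => [l0|T1]; [right | left].
  by move: sz; move: #|T| => m; lia.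
by move: sz w0; rewrite T1; case: (w) => //= a l; lia.
Qed.

End Tour.

(** * The bound on the length *)

Section Bound.
Variables (n : nat) (E : {set {set 'I_n}}) (k h : nat) (o : nat -> {set 'I_n}).
Hypothesis k2 : 2 <= k.
Hypothesis oE : forall t, t <= h -> o t \in E.
Hypothesis ok : forall t, t <= h -> #|o t| = k.
Hypothesis oadj : forall t, t < h -> adjacent E (o t) (o t.+1).
Hypothesis ospan : forall x, exists2 t, t <= h & x \in o t.

Lemma chain_cost T q : chain E [set o 0] T q -> (INR q <= cK k * INR h + 2 * xK k)%R.
Proof.
move=> ch; suff H : (INR q <= Phi k h o (o 0) - Phi k h o (cover T))%R.
  by have := Phi_init k2 ok; have := Phi_ge0 h o k2 (cover T); lra.
elim: ch => [|{}T {}q p w c ch IH bst].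
  by rewrite /cover big_set1 /=; lra.
have sub : o 0 \subset cover T.
  by apply: (bigcup_sup (o 0)) => //; apply: (subsetP (chain_base ch)); rewrite set11.
have B := best_drop k2 oE ok oadj ospan sub bst.
by rewrite cover_add plus_INR; lra.
Qed.

End Bound.

Theorem theorem5 :
  forall k : nat, 2 <= k ->
  exists (M : TM) (c : nat),
    forall (n : nat) (E : {set {set 'I_n}}),
      uniform k E -> covers E -> hconnected E -> E != set0 ->
      exists (t : nat) (w : seq {set 'I_n}),
        [/\ t <= c * (size (enc_graph E)) ^ c + c,
            halts_with M (enc_graph E) t (enc_edges w),
            transition_walk E w,
            spanning w &
            forall h : nat, is_hk E h ->
              Rle (INR (walk_length w)) (Rmult (Rmult (INR 2) (Rplus (INR 1) (ln (INR k)))) (INR h))].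
Proof.
move=> k k2; have k0 : 0 < k by exact: ltnW.
have [M [c HM]] := tm_of_prog (pSeq (fSearch k) (fTour k)); exists M, c => n E unif cov conn E0.
have N0 : 0 < size (enc_graph E) by exact: leq_ltn_trans (leq0n _) (card_EN E).
have := HM _ N0 (word_ok E); rewrite sm_seq.
have [o1 [e0 res0] opt] := ef_search unif cov conn k0 (fun=> 0) store0 E0.
set s1 := (sem _ _ 0 (fSearch k) _ _).2 in o1 res0 opt *.
have [_ C0 e0T r0 _] := res0.
have [w -> [w0 wT Tw aw sz]] := ef_tour unif k0 (fun=> 0) e0T r0 o1.
have one : enc_edges w != [::].
  by case: (w) w0 => // f l _; rewrite enc_edges_cons; case: (enc_set f).
move=> /(_ one)[t tb hm]; exists t, w; split=> //.
- by split=> // e /wT; exact: (subsetP (TS_sub E s1 0)).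
- move=> x; have : x \in cover (TS E s1 0) by rewrite C0 in_setT.
  by move=> /bigcupP[e eT xe]; exists e => //; exact: Tw.
move=> h [[w' [[w'0 w'E w'a] w's w'h]] _].
pose o t := nth set0 w' t.
have s0 : 0 < size w' by case: (w') w'0.
have hs t' : t' <= h -> t' < size w' by rewrite -w'h /walk_length; lia.
have oE t' : t' <= h -> o t' \in E by move=> /hs th; apply: w'E; exact: mem_nth.
have ok t' : t' <= h -> #|o t'| = k by move=> /oE; exact: unif.
have oadj t' : t' < h -> adjacent E (o t') (o t'.+1) by move=> /hs; exact: w'a.
have ospan x : exists2 t', t' <= h & x \in o t'.
  have [e /(nthP set0)[i li <-] xe] := w's x; exists i => //.
  by rewrite -w'h /walk_length -ltnS prednK.
(* The candidate grown from the first hyperedge of the optimal walk; the selected set is no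
   larger. *)
have [T [_ _ _ _ [q [T0 [ch _ cT]]]] le] := opt _ (oE 0 (leq0n _)).
have := chain_cost k2 oE ok oadj ospan ch.
have xl := xK_le k2.
have h0 : (0 <= cK k * INR h)%R.
  apply: Rmult_le_pos; last exact: pos_INR.
  have := ln_increasing 1 (INR k); have := le_INR 2 k (leP k2); rewrite ln_1 /cK /=; lra.
have -> : (INR 2 * (INR 1 + ln (INR k)) * INR h = 2 * (cK k * INR h))%R by rewrite /cK /=; ring.
move=> cq; case: sz => sz.
  by rewrite /walk_length sz /=; lra.
have sw : 0 < size w by case: (w) w0.
(* [#|T| <= 1 + q] gives at most [2 * q] entries, so the length is at most
   [2 * (cK k * h + 2 * xK k) - 1], and [4 * xK k < 1] because [xK k <= 1 / 6]. *)
have l2 : walk_length w + 1 <= 2 * q.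
  by rewrite /walk_length; move: sw sz le cT; move: #|TS E s1 0| #|T| (size w) => a b m; lia.
by have := le_INR _ _ (leP l2); rewrite plus_INR mult_INR /=; lra.
Qed.
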